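(* Assume the standing setup, fix integers $p\ge2$, $k\ge p$, $\lambda>0$ and $\delta\in(0,1)$. With probability at least $1-5\delta$ the following hold simultaneously: (a) if $k\ge\max\{k_1(p,\delta),k_2(k,p,\delta)\}$, then $$\mathcal T_p\bar E_k\bar E_k^*\mathcal T_p^*\succeq\frac{k-p+1}{2}\Sigma_E\succeq\frac{k-p+1}{2}\sigma_RI\quad\text{and}\quad \bar Z_k\bar Z_k^*\succeq\tfrac12\mathcal O_p\bar X_k\bar X_k^*\mathcal O_p^*+\tfrac12\mathcal T_p\bar E_k\bar E_k^*\mathcal T_p^*;$$ (b) $\bar Z_k\bar Z_k^*\preceq(k-p+1)\frac{mp}{\delta}\Gamma_{Z,k}$; (c) $\|S_k\bar V_k^{-1/2}\|_2\le g_1(k,p,\delta)$.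
   Context: Standing setup: $x_{k+1}=Ax_k+w_k$, $y_k=Cx_k+v_k$, $x_k\in\mathbb R^n$, $y_k\in\mathbb R^m$, $w_k\sim\mathcal N(0,Q)$, $v_k\sim\mathcal N(0,R)$ i.i.d. independent, $x_0\sim\mathcal N(0,P)$; $\rho(A)\le1$; $(A,C)$ observable, $(A,Q^{1/2})$ controllable, $R\succ0$; $K=APC^*(CPC^*+R)^{-1}$ with $P\succ0$ solving $P=(A-KC)P(A-KC)^*+Q+KRK^*$; $(A,K)$ controllable. Kalman filter $\hat x_{k+1}=A\hat x_k+Ke_k$, $\hat x_0=0$, $e_k=y_k-C\hat x_k$ i.i.d. $\mathcal N(0,\bar R)$, $\bar R=CPC^*+R$. $\sigma_R=\sigma_{\min}(R)$. Notation: $Z_t=[y_{t-p}^*,\dots,y_{t-1}^*]^*$, $E_t=[e_{t-p}^*,\dots,e_{t-1}^*]^*$; $\bar Z_k=[Z_p,\dots,Z_k]$, $\bar E_k=[E_p,\dots,E_k]$, $\bar X_k=[\hat x_0,\dots,\hat x_{k-p}]$; $\bar V_k=\lambda I+\bar Z_k\bar Z_k^*$; $S_k=\sum_{t=p}^ke_tZ_t^*$; $\mathcal O_p=[C^*,A^*C^*,\dots,(A^* )^{p-1}C^*]^*$; $\mathcal T_p$ is the $mp\times mp$ lower block-triangular block-Toeplitz matrix with diagonal blocks $I_m$ and $(i,j)$ block $CA^{i-j-1}K$ for $i>j$ (so $Z_t=\mathcal O_p\hat x_{t-p}+\mathcal T_pE_t$); $\Sigma_E=\mathcal T_p\operatorname{diag}(\bar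 R,\dots,\bar R)\mathcal T_p^*$; $\Gamma_t=\mathbb E\hat x_t\hat x_t^*$; $\Gamma_{Z,k}=\mathbb EZ_kZ_k^*$. $k_1(p,\delta)=p+128(mp^2\log9+p\log2+p\log\tfrac1\delta)$; $k_2(k,p,\delta)=p+\frac{64}{\min\{4,\sigma_R\}}\Big(4pn\log\big(\tfrac{n\|\mathcal O_p\|_2^2\|\Gamma_{k-p}\|_2}{\delta}+1\big)+8p\log\tfrac{p5^m}{\delta}\Big)$; $g_1(k,p,\delta)=\sqrt8\sqrt{\|\bar R\|_2mp}\sqrt{\log\tfrac{3mp}{\delta}+\tfrac12\log(k-p+1)+\tfrac1{2mp}\log\det(\Gamma_{Z,k}\lambda^{-1}+I)}$. *)

(* Defs.v *)
From HB Require Import structures.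
From mathcomp Require Import all_boot all_order all_algebra.
From mathcomp Require Import all_classical all_reals all_analysis.
From mathcomp Require Import complex.
Set Implicit Arguments. Unset Strict Implicit. Unset Printing Implicit Defensive.
Import Order.TTheory GRing.Theory Num.Theory.

Local Open Scope classical_set_scope.
Local Open Scope ring_scope.

Section LinAlg.
Variable R : realType.

Definition vnorm d (x : 'cV[R]_d) : R := Num.sqrt (\sum_i (x i 0) ^+ 2).

Definition opnorm a b (M : 'M[R]_(a, b)) : R :=
  sup [set vnorm (M *m x) | x in [set x : 'cV[R]_b | vnorm x = 1]].

Definition sigma_min a b (M : 'M[R]_(a, b)) : R :=
  inf [set vnorm (M *m x) | x in [set x : 'cV[R]_b | vnorm x = 1]].

Definition quadf d (M : 'M[R]_d) (x : 'cV[R]_d) : R := (x^T *m M *m x) 0 0.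

Definition symmx d (M : 'M[R]_d) := M^T = M.
Definition psd d (M : 'M[R]_d) := symmx M /\ forall x, 0 <= quadf M x.
Definition posdef d (M : 'M[R]_d) :=
  symmx M /\ forall x : 'cV[R]_d, x != 0 -> 0 < quadf M x.

Definition loewner_le d (M N : 'M[R]_d) := forall x, quadf M x <= quadf N x.

Definition msqrt d (M : 'M[R]_d) : 'M[R]_d :=
  xget 0 [set B : 'M[R]_d | psd B /\ B *m B = M].

Definition minvsqrt d (M : 'M[R]_d) : 'M[R]_d := invmx (msqrt M).

Definition spec_rad_le1 d (A : 'M[R]_d) :=
  forall z : R[i], eigenvalue (map_mx (fun r : R => (r%:C)%C) A) z -> `|z| <= 1.

Definition observable d q (A : 'M[R]_d) (C : 'M[R]_(q, d)) :=
  \rank (\mxcol_(i < d) (C *m A ^+ i)) = d.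
Definition controllable d q (A : 'M[R]_d) (B : 'M[R]_(d, q)) :=
  \rank (\mxrow_(i < d) (A ^+ i *m B)) = d.

End LinAlg.

Section Prob.
Context {R : realType} {dT : measure_display} {T : measurableType dT}.
Variable P : probability T R.

Definition gauss_law (var : R) : set R -> \bar R :=
  if var == 0 then \d_(0 : R) else normal_prob 0 (Num.sqrt var).

Definition gaussian_vec d (X : T -> 'cV[R]_d) (Sigma : 'M[R]_d) :=
  (forall r : 'I_d, measurable_fun setT (fun w => X w r 0)) /\
  forall (u : 'cV[R]_d) (B : set R), measurable B ->
    P ((fun w => (u^T *m X w) 0 0) @^-1` B) = gauss_law (quadf Sigma u) B.

(* events generated by the coordinates of a random vector (a pi-system
   generating sigma(X)) *)
Definition vec_events d (X : T -> 'cV[R]_d) : set (set T) :=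
  [set [set w | forall r, B r (X w r 0)] |
     B in [set B : 'I_d -> set R | forall r, measurable (B r)]].

Definition mutually_independent (I : eqType) (E : I -> set (set T)) :=
  forall (J : seq I) (A : I -> set T), uniq J ->
    (forall i, i \in J -> E i (A i)) ->
    P [set w | forall i, i \in J -> A i w] = (\prod_(i <- J) P (A i))%E.

End Prob.

Section System.
Context {R : realType} {T : Type}.
Variables (n m : nat) (A : 'M[R]_n) (C : 'M[R]_(m, n)).

Fixpoint state (x0 : T -> 'cV[R]_n) (w : nat -> T -> 'cV[R]_n) (k : nat)
  : T -> 'cV[R]_n :=
  match k with
  | 0 => x0
  | k'.+1 => fun o => A *m state x0 w k' o + w k' o
  end.

Definition output x0 w (v : nat -> T -> 'cV[R]_m) (k : nat) : T -> 'cV[R]_m :=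
  fun o => C *m state x0 w k o + v k o.

Definition kgain (Pm : 'M[R]_n) (Rm : 'M[R]_m) : 'M[R]_(n, m) :=
  A *m Pm *m C^T *m invmx (C *m Pm *m C^T + Rm).

Fixpoint xhat (K : 'M[R]_(n, m)) (y : nat -> T -> 'cV[R]_m) (k : nat)
  : T -> 'cV[R]_n :=
  match k with
  | 0 => fun _ => 0
  | k'.+1 => fun o => A *m xhat K y k' o + K *m (y k' o - C *m xhat K y k' o)
  end.

Definition innov K y (k : nat) : T -> 'cV[R]_m :=
  fun o => y k o - C *m xhat K y k o.

Variable p : nat.

Definition stack (u : nat -> T -> 'cV[R]_m) (t : nat)
  : T -> 'cV[R]_(\sum_(i < p) m) :=
  fun o => \mxcol_(i < p) u (t - p + i)%N o.

Definition obsmx : 'M[R]_(\sum_(i < p) m, n) := \mxcol_(i < p) (C *m A ^+ i).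

Definition toepmx (K : 'M[R]_(n, m)) : 'M[R]_(\sum_(i < p) m) :=
  \mxblock_(i < p, j < p)
     (if (j < i)%N then C *m A ^+ (i - j - 1)%N *m K
      else if i == j then 1%:M else 0 : 'M[R]_m).

Definition SigmaE (K : 'M[R]_(n, m)) (Rbar : 'M[R]_m) : 'M[R]_(\sum_(i < p) m) :=
  toepmx K *m (\mxdiag_(i < p) Rbar) *m (toepmx K)^T.

Definition barmx (U : nat -> T -> 'cV[R]_(\sum_(i < p) m)) (k : nat)
  : T -> 'M[R]_(\sum_(i < p) m, k - p + 1) :=
  fun o => \matrix_(i, j) U (p + j)%N o i 0.

Definition barX (xh : nat -> T -> 'cV[R]_n) (k : nat) : T -> 'M[R]_(n, k - p + 1) :=
  fun o => \matrix_(i, j) xh j o i 0.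

Definition Smx (e : nat -> T -> 'cV[R]_m) (Z : nat -> T -> 'cV[R]_(\sum_(i < p) m))
  (k : nat) : T -> 'M[R]_(m, \sum_(i < p) m) :=
  fun o => \sum_(p <= t < k.+1) e t o *m (Z t o)^T.

End System.

Definition second_moment {R : realType} {dT : measure_display}
  {T : measurableType dT} (P : probability T R) d (X : T -> 'cV[R]_d) : 'M[R]_d :=
  \matrix_(i, j) fine ('E_P[fun o => (X o *m (X o)^T) i j]).

Section Constants.
Variable R : realType.

Definition k1 (m p : nat) (delta : R) : R :=
  p%:R + 128 * (m%:R * p%:R ^+ 2 * ln 9 + p%:R * ln 2 + p%:R * ln delta^-1).

Definition k2 (n m p : nat) (sigmaR normO normG delta : R) : R :=
  p%:R + 64 / Num.min 4 sigmaR *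
    (4 * p%:R * n%:R * ln (n%:R * normO ^+ 2 * normG / delta + 1)
     + 8 * p%:R * ln (p%:R * 5 ^+ m / delta)).

Definition g1 (m p k : nat) (normRbar delta logdet : R) : R :=
  Num.sqrt 8 * Num.sqrt (normRbar * m%:R * p%:R) *
  Num.sqrt (ln (3 * m%:R * p%:R / delta) + 2^-1 * ln (k - p + 1)%N%:R
            + (2 * m%:R * p%:R)^-1 * logdet).
End Constants.

(* Main.v *)
(** The innovations [e_t] are Gaussian white noise: the prediction error
    [x_t - xhat_t] keeps covariance [P] by the Riccati equation, and is
    independent of the past innovations.  This is extracted from the one-
    dimensional laws [u . e] alone, through characteristic functions written
    with cosines only: bounded nonnegative densities whose cosine transforms
    agree have the same image measure on the line.

    Writing [Z_t = O xhat_{t-p} + T E_t], five exceptional events of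
    probability at most [delta] remain.
    - Chi-square Chernoff bounds for [E], on a net of the sphere; windows that
      overlap are decoupled by averaging over residue classes modulo [p].
    - Martingale method of mixtures for the cross terms [sum xhat_j e_{j+i}^*]
      (and, for (c), for [sum Z_t e_t^*]):
      [E exp (S^* V^-1 S / 2) / sqrt (det V)] is conserved from step to step.
    - Markov bounds for the trace of [X X^*] and for [Z Z^*] normalized by
      [Gamma_Z]; second moments are nondecreasing in [t] because [xhat_t] and
      [Z_t] are moving averages of [e] with time-invariant coefficients.
    The Riccati equation telescopes along a window to give
    [Sigma_E >= sigma_min(R)]. *)

Require Import Defs.
From HB Require Import structures.
From mathcomp Require Import all_boot all_order all_algebra perm.
From mathcomp Require Import all_classical all_reals all_analysis.
From mathcomp Require Import measurable_realfun complex ring lra zify.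
Set Implicit Arguments. Unset Strict Implicit. Unset Printing Implicit Defensive.
Import Order.TTheory GRing.Theory Num.Theory.
Import numFieldNormedType.Exports.
Local Open Scope classical_set_scope.
Local Open Scope ring_scope.

(** * Quadratic forms and Loewner order *)

Section EuclideanForms.
Variable R : realType.

(** The hypotheses give laws of scalar projections only, so all conditioning is funnelled into one
    scalar statement: a normalized linear form in the innovations from time [t] on is standard
    normal and independent of every event before [t]. The chi-square bound, the method of mixtures
    and the second moments use the noise only through it. The weights [1 + cos (x - z)] are
    nonnegative, so integrals are exchanged by Tonelli, and the phase [z] carries the sine part.

    The constants of [k1], [k2] and [g1] are fixed in advance and shape the estimates. In [k1] one
    has [128 * ln 9 = 256 / 3 * ln 27], so a net of the sphere with 27 points per dimension,
    combined with the Chernoff exponents 1/10 and -1/6, meets the leading term with equality. In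
    [g1] the same net is absorbed by [2 <= p]. In [k2] the logarithm of the determinant is paid by
    the trace of the states, and the regularization [tau] is tuned to the noise energy that is
    already known to be present.

    Matrices are compared through Cholesky factors, which whiten vectors and reduce Loewner bounds
    to bounds by the identity. *)

Definition dotv d (u v : 'cV[R]_d) : R := (u^T *m v) 0 0.

Lemma dotvE d (u v : 'cV[R]_d) : dotv u v = \sum_i u i 0 * v i 0.
Proof. by rewrite /dotv mxE; apply: eq_bigr => i _; rewrite !mxE. Qed.

Lemma dotvC d (u v : 'cV[R]_d) : dotv u v = dotv v u.
Proof. by rewrite !dotvE; apply: eq_bigr => i _; rewrite mulrC. Qed.

Lemma dotvDl d (u v w : 'cV[R]_d) : dotv (u + v) w = dotv u w + dotv v w.
Proof. by rewrite /dotv linearD mulmxDl mxE. Qed.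

Lemma dotvDr d (u v w : 'cV[R]_d) : dotv w (u + v) = dotv w u + dotv w v.
Proof. by rewrite dotvC dotvDl !(dotvC w). Qed.

Lemma dotvZl d (a : R) (u v : 'cV[R]_d) : dotv (a *: u) v = a * dotv u v.
Proof. by rewrite /dotv linearZ -scalemxAl mxE. Qed.

Lemma dotvZr d (a : R) (u v : 'cV[R]_d) : dotv u (a *: v) = a * dotv u v.
Proof. by rewrite dotvC dotvZl dotvC. Qed.

Lemma dotvNl d (u v : 'cV[R]_d) : dotv (- u) v = - dotv u v.
Proof. by rewrite -scaleN1r dotvZl mulN1r. Qed.

Lemma dotvNr d (u v : 'cV[R]_d) : dotv u (- v) = - dotv u v.
Proof. by rewrite dotvC dotvNl dotvC. Qed.

Lemma dotv0l d (v : 'cV[R]_d) : dotv 0 v = 0.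
Proof. by rewrite /dotv trmx0 mul0mx mxE. Qed.

Lemma dotv0r d (v : 'cV[R]_d) : dotv v 0 = 0.
Proof. by rewrite dotvC dotv0l. Qed.

Lemma dotv_suml (I : Type) (r : seq I) (Q : pred I) d (f : I -> 'cV[R]_d) v :
  dotv (\sum_(i <- r | Q i) f i) v = \sum_(i <- r | Q i) dotv (f i) v.
Proof.
elim/big_rec2: _ => [|i y1 y2 _ <-]; first exact: dotv0l.
by rewrite dotvDl.
Qed.

Lemma dotv_sumr (I : Type) (r : seq I) (Q : pred I) d (f : I -> 'cV[R]_d) v :
  dotv v (\sum_(i <- r | Q i) f i) = \sum_(i <- r | Q i) dotv v (f i).
Proof. by rewrite dotvC dotv_suml; apply: eq_bigr => i _; rewrite dotvC. Qed.

Lemma dotv_mulmxl a b (M : 'M[R]_(a, b)) u v :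
  dotv (M *m u) v = dotv u (M^T *m v).
Proof. by rewrite /dotv trmx_mul mulmxA. Qed.

Lemma dotv_ge0 d (u : 'cV[R]_d) : 0 <= dotv u u.
Proof. by rewrite dotvE sumr_ge0 // => i _; rewrite -expr2 sqr_ge0. Qed.

Lemma dotv_eq0 d (u : 'cV[R]_d) : (dotv u u == 0) = (u == 0).
Proof.
apply/eqP/eqP => [|->]; last exact: dotv0l.
rewrite dotvE => /psumr_eq0P h; apply/colP => i; rewrite mxE.
by apply/eqP; rewrite -sqrf_eq0 expr2 h // => j _; rewrite -expr2 sqr_ge0.
Qed.

Lemma dotv_gt0 d (u : 'cV[R]_d) : u != 0 -> 0 < dotv u u.
Proof. by move=> u0; rewrite lt_def dotv_ge0 dotv_eq0 u0. Qed.

Lemma vnormE d (u : 'cV[R]_d) : vnorm u = Num.sqrt (dotv u u).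
Proof. by rewrite dotvE. Qed.

Lemma vnorm_sqr d (u : 'cV[R]_d) : vnorm u ^+ 2 = dotv u u.
Proof. by rewrite vnormE sqr_sqrtr // dotv_ge0. Qed.

Lemma vnorm_ge0 d (u : 'cV[R]_d) : 0 <= vnorm u.
Proof. exact: sqrtr_ge0. Qed.

Lemma vnorm_unitP d (u : 'cV[R]_d) : vnorm u = 1 <-> dotv u u = 1.
Proof.
split=> h; first by rewrite -vnorm_sqr h expr1n.
by rewrite vnormE h sqrtr1.
Qed.

Lemma quadfE d (M : 'M[R]_d) x : quadf M x = dotv x (M *m x).
Proof. by rewrite /quadf /dotv mulmxA. Qed.

Lemma quadfD d (M N : 'M[R]_d) x : quadf (M + N) x = quadf M x + quadf N x.
Proof. by rewrite !quadfE mulmxDl dotvDr. Qed.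

Lemma quadfZ d (a : R) (M : 'M[R]_d) x : quadf (a *: M) x = a * quadf M x.
Proof. by rewrite !quadfE -scalemxAl dotvZr. Qed.

Lemma quadfZv d (a : R) (M : 'M[R]_d) x : quadf M (a *: x) = a ^+ 2 * quadf M x.
Proof. by rewrite !quadfE -scalemxAr dotvZr dotvZl mulrA expr2. Qed.

Lemma quadfN d (M : 'M[R]_d) x : quadf (- M) x = - quadf M x.
Proof. by rewrite -scaleN1r quadfZ mulN1r. Qed.

Lemma quadf0 d (M : 'M[R]_d) : quadf M 0 = 0.
Proof. by rewrite quadfE dotv0l. Qed.

Lemma quadf0m d (x : 'cV[R]_d) : quadf 0 x = 0.
Proof. by rewrite quadfE mul0mx dotv0r. Qed.

Lemma quadf1 d (x : 'cV[R]_d) : quadf 1%:M x = dotv x x.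
Proof. by rewrite quadfE mul1mx. Qed.

Lemma quadf_sum (I : Type) (r : seq I) (Q : pred I) d (F : I -> 'M[R]_d) x :
  quadf (\sum_(i <- r | Q i) F i) x = \sum_(i <- r | Q i) quadf (F i) x.
Proof.
elim/big_rec2: _ => [|i y1 y2 _ <-]; first exact: quadf0m.
by rewrite quadfD.
Qed.

Lemma quadf_congr a b (M : 'M[R]_(a, b)) (N : 'M[R]_b) x :
  quadf (M *m N *m M^T) x = quadf N (M^T *m x).
Proof. by rewrite !quadfE -!mulmxA -{1}(trmxK M) -dotv_mulmxl. Qed.

Lemma quadf_mulT a b (M : 'M[R]_(a, b)) x :
  quadf (M *m M^T) x = dotv (M^T *m x) (M^T *m x).
Proof. by rewrite -(quadf1 (M^T *m x)) -quadf_congr mulmx1. Qed.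

Lemma quadf_outer d (z x : 'cV[R]_d) : quadf (z *m z^T) x = dotv z x ^+ 2.
Proof. by rewrite quadf_mulT dotvE big_ord1 -expr2. Qed.

Lemma quadf_addv d (M : 'M[R]_d) x y : symmx M ->
  quadf M (x + y) = quadf M x + 2 * dotv x (M *m y) + quadf M y.
Proof.
move=> sM; rewrite !quadfE mulmxDr !dotvDl !dotvDr.
have -> : dotv y (M *m x) = dotv x (M *m y) by rewrite dotvC dotv_mulmxl sM.
ring.
Qed.

Lemma psd_CauchySchwarz d (M : 'M[R]_d) u v : psd M ->
  dotv u (M *m v) ^+ 2 <= quadf M u * quadf M v.
Proof.
move=> [sM pM].
have h (t : R) : 0 <= quadf M u + 2 * t * dotv u (M *m v) + t ^+ 2 * quadf M v.
  have := pM (u + t *: v).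
  by rewrite quadf_addv // quadfZv -scalemxAr dotvZr mulrA.
have a0 := pM u; have c0 := pM v.
set a := quadf M u in h a0 *; set b := dotv u _ in h *; set c := quadf M v in h c0 *.
have [c00|cn0] := eqVneq c 0.
  rewrite c00 mulr0; have [->|bn0] := eqVneq b 0; first by rewrite expr0n.
  (* When [c = 0] the polynomial in [t] is affine, and at this point its value is -1. *)
  have := h (- (a + 1) / (2 * b)); rewrite c00 mulr0 addr0.
  have -> : 2 * (- (a + 1) / (2 * b)) * b = - (a + 1) by field.
  lra.
have cgt0 : 0 < c by rewrite lt_def cn0.
have := h (- b / c).
have -> : a + 2 * (- b / c) * b + (- b / c) ^+ 2 * c = (a * c - b ^+ 2) / c by field.
by rewrite pmulr_lge0 ?invr_gt0 // subr_ge0.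
Qed.

Lemma psd1 d : psd (1%:M : 'M[R]_d).
Proof. by split; [exact: trmx1|move=> x; rewrite quadf1 dotv_ge0]. Qed.

Lemma dotv_CauchySchwarz d (u v : 'cV[R]_d) :
  dotv u v ^+ 2 <= dotv u u * dotv v v.
Proof. by have := psd_CauchySchwarz u v (psd1 d); rewrite !quadf1 mul1mx. Qed.

(** The squared Frobenius norm: a crude bound that makes the supremum in [opnorm] a genuine one, and
    later keeps [sigma_min] of an invertible matrix away from 0. *)
Definition frob2 a b (M : 'M[R]_(a, b)) := \sum_i \sum_j M i j ^+ 2.

Lemma dotv_mulmx_frob a b (M : 'M[R]_(a, b)) x :
  dotv (M *m x) (M *m x) <= frob2 M * dotv x x.
Proof.
rewrite dotvE /frob2 mulr_suml; apply: ler_sum => i _.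
have := dotv_CauchySchwarz (row i M)^T x; rewrite !dotvE.
under eq_bigr do rewrite !mxE.
under [X in _ <= X * _]eq_bigr do rewrite !mxE -expr2.
by rewrite mxE -expr2.
Qed.

Lemma frob2_ge0 a b (M : 'M[R]_(a, b)) : 0 <= frob2 M.
Proof. by do 2 apply: sumr_ge0 => ? _; rewrite sqr_ge0. Qed.

Lemma opnorm_ge a b (M : 'M[R]_(a, b)) x : vnorm x = 1 -> vnorm (M *m x) <= opnorm M.
Proof.
move=> x1; apply: ub_le_sup; last by exists x.
exists (Num.sqrt (frob2 M)) => _ [y /= y1 <-].
rewrite vnormE ler_wsqrtr // (le_trans (dotv_mulmx_frob _ _)) //.
by rewrite (vnorm_unitP y).1 // mulr1.
Qed.

Lemma opnorm_ge0 a b (M : 'M[R]_(a, b)) : 0 <= opnorm M.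
Proof.
have [[x x1]|h] := pselect (exists x : 'cV[R]_b, vnorm x = 1).
  exact: le_trans (vnorm_ge0 _) (opnorm_ge _ x1).
(* Without a unit vector the supremum is over the empty set, whose value is 0. *)
rewrite /opnorm (_ : [set _ | _ in _] = set0) ?sup0 //.
by apply/seteqP; split=> [t [x x1 _]|//]; apply: h; exists x.
Qed.

Lemma opnorm_le a b (M : 'M[R]_(a, b)) c : 0 <= c ->
  (forall x, dotv x x = 1 -> dotv (M *m x) (M *m x) <= c ^+ 2) -> opnorm M <= c.
Proof.
move=> c0 h; have [[x x1]|hn] := pselect (exists x : 'cV[R]_b, vnorm x = 1).
  apply: ge_sup; first by exists (vnorm (M *m x)), x.
  move=> _ [y /= /vnorm_unitP y1 <-].
  by rewrite vnormE -(ger0_norm c0) -sqrtr_sqr ler_wsqrtr // h.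
rewrite /opnorm (_ : [set _ | _ in _] = set0) ?sup0 //.
by apply/seteqP; split=> [t [x x1 _]|//]; apply: hn; exists x.
Qed.

Lemma unit_vec d (u : 'cV[R]_d) : u != 0 ->
  exists2 x : 'cV[R]_d, dotv x x = 1 & u = vnorm u *: x.
Proof.
move=> u0; have n0 : vnorm u != 0.
  by rewrite -sqrf_eq0 vnorm_sqr dotv_eq0.
exists ((vnorm u)^-1 *: u); last by rewrite scalerA divff // scale1r.
by rewrite dotvZl dotvZr -vnorm_sqr expr2; field.
Qed.

Lemma dotv_mulmx_opnorm a b (M : 'M[R]_(a, b)) x :
  dotv (M *m x) (M *m x) <= opnorm M ^+ 2 * dotv x x.
Proof.
have [->|/unit_vec[y y1 ->]] := eqVneq x 0; first by rewrite mulmx0 !dotv0l mulr0.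
rewrite -scalemxAr !dotvZl !dotvZr y1 mulr1 !mulrA -expr2 [leRHS]mulrAC -mulrA -expr2 [leRHS]mulrC.
rewrite ler_wpM2l ?sqr_ge0 // -vnorm_sqr ler_pXn2r ?nnegrE ?vnorm_ge0 ?opnorm_ge0 //.
by apply: opnorm_ge; apply/vnorm_unitP.
Qed.

Lemma quadf_opnorm d (M : 'M[R]_d) x : quadf M x <= opnorm M * dotv x x.
Proof.
rewrite quadfE; apply: le_trans (ler_norm _) _.
rewrite -(@ler_pXn2r _ 2) ?nnegrE ?mulr_ge0 ?dotv_ge0 ?opnorm_ge0 // real_normK ?num_real //.
apply: le_trans (dotv_CauchySchwarz _ _) _.
rewrite exprMn expr2 mulrC [X in _ <= X](_ : _ = opnorm M ^+ 2 * dotv x x * dotv x x); last by ring.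
by rewrite ler_wpM2r ?dotv_ge0 // dotv_mulmx_opnorm.
Qed.

End EuclideanForms.

(** * Schur complements, Cholesky factors and comparison of determinants *)

Section PositiveDefinite.
Variable R : realType.

Lemma posdef_psd d (M : 'M[R]_d) : posdef M -> psd M.
Proof.
move=> [sM pM]; split=> // x; have [->|x0] := eqVneq x 0; first by rewrite quadf0.
exact: ltW (pM _ x0).
Qed.

Lemma quadf_block d (a : 'M[R]_1) (b : 'cV[R]_d) (D : 'M[R]_d) (s : 'cV[R]_1) (y : 'cV[R]_d) :
  quadf (block_mx a (b^T) b D : 'M[R]_(1 + d)) (col_mx s y) =
  a 0 0 * s 0 0 ^+ 2 + 2 * s 0 0 * dotv b y + quadf D y.
Proof.
rewrite /quadf /dotv tr_col_mx mul_row_block mul_row_col !mulmxDl -!addrA.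
rewrite mxE [X in _ + X]mxE [X in _ + (_ + X)]mxE.
have -> : (s^T *m a *m s) 0 0 = a 0 0 * s 0 0 ^+ 2.
  by rewrite !(mxE, big_ord1); ring.
have -> : (y^T *m b *m s) 0 0 = s 0 0 * (b^T *m y) 0 0.
  rewrite !(mxE, big_ord1) mulrC; congr (_ * _).
  by apply: eq_bigr => j _; rewrite !mxE mulrC.
have -> : (s^T *m b^T *m y) 0 0 = s 0 0 * (b^T *m y) 0 0.
  by rewrite [s]mx11_scalar tr_scalar_mx mul_scalar_mx -scalemxAl !mxE eqxx mulr1n.
ring.
Qed.

(** Minimizing the form over the first coordinate, at [- (dotv b y) / a], leaves the form of the
    Schur complement, which therefore inherits positivity. The inductions on the dimension peel off
    one coordinate this way. *)
Lemma posdef_Schur d (M : 'M[R]_(1 + d)) (a := M 0 0) (b := dlsubmx M) :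
  posdef M ->
  [/\ 0 < a, M = block_mx a%:M (b^T) b (drsubmx M) &
      posdef (drsubmx M - a^-1 *: (b *m b^T))].
Proof.
move=> [sM pM].
have Mb : M = block_mx a%:M (b^T) b (drsubmx M).
  rewrite -{1}(submxK M); congr block_mx.
    by rewrite [LHS]mx11_scalar !mxE; congr ((M _ _)%:M); apply/val_inj.
  by rewrite /b -{1}sM -trmx_dlsub.
have qM s y : quadf M (col_mx s%:M y) = a * s ^+ 2 + 2 * s * dotv b y + quadf (drsubmx M) y.
  by rewrite {1}Mb quadf_block !mxE eqxx !mulr1n.
have a0 : 0 < a.
  have := pM (col_mx 1%:M 0); rewrite qM dotv0r quadf0 expr1n !addr0 mulr1.
  rewrite mulr0 addr0; apply; apply/eqP => /(congr1 (fun N : 'cV_(1 + d) => N (lshift d 0) 0)).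
  by rewrite col_mxEu !mxE eqxx /= => /eqP; rewrite oner_eq0.
split=> //; split.
  rewrite /symmx linearB linearZ /= trmx_mul trmxK; congr (_ - _).
  by rewrite trmx_drsub sM.
move=> y y0; rewrite quadfD quadfN quadfZ quadf_outer.
have := pM (col_mx (- (dotv b y) / a)%:M y).
rewrite qM.
have -> : a * (- dotv b y / a) ^+ 2 + 2 * (- dotv b y / a) * dotv b y + quadf (drsubmx M) y
  = quadf (drsubmx M) y - a^-1 * dotv b y ^+ 2 by field; rewrite gt_eqF.
move=> h0; apply: h0; apply/eqP => h; case/eqP: y0.
by have := congr1 (@dsubmx _ _ _ _) h; rewrite col_mxKd linear0.
Qed.

(** One step of block elimination. The sign of [a] is left free because [det_rank1] takes
    [a = -1]. *)
Lemma det_Schur d (a : R) (b : 'cV[R]_d) (D : 'M[R]_d) : a != 0 ->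
  \det (block_mx a%:M (b^T) b D : 'M[R]_(1 + d)) = a * \det (D - a^-1 *: (b *m b^T)).
Proof.
move=> a0.
have -> : (block_mx a%:M (b^T) b D : 'M[R]_(1 + d)) =
   block_mx 1%:M 0 (a^-1 *: b) 1%:M *m
   block_mx a%:M (b^T) 0 (D - a^-1 *: (b *m b^T)).
  rewrite mulmx_block !mul1mx !mul0mx !addr0.
  by rewrite mul_mx_scalar scalerA mulfV // scale1r -scalemxAl addrC subrK.
rewrite det_mulmx det_lblock det_ublock !det1 !mul1r; congr (_ * _).
by rewrite det_scalar expr1.
Qed.

(** Induction through the Schur complement. The factor [L] acts as a square root from here on:
    [invmx L] whitens vectors and turns [M] into the identity by congruence. *)
Lemma Cholesky d (M : 'M[R]_d) : posdef M ->
  exists2 L : 'M[R]_d, L \in unitmx & M = L *m L^T.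
Proof.
elim: d M => [|d IH] M pM.
  by exists 1%:M; rewrite ?unitmx1 //; apply/matrixP => -[].
have [a0 Mb /IH[L uL LE]] := @posdef_Schur d M pM.
set a := M 0 0 in a0 Mb LE; set b := dlsubmx (M : 'M[R]_(1 + d)) in Mb LE.
pose r := Num.sqrt a.
have r0 : 0 < r by rewrite sqrtr_gt0.
have rr : r * r = a by rewrite -expr2 sqr_sqrtr // ltW.
exists (block_mx r%:M 0 (r^-1 *: b) L : 'M[R]_(1 + d)).
  rewrite unitmxE (@det_lblock _ 1 d) unitrM -!unitmxE uL andbT.
  by rewrite unitmxE det_scalar expr1 unitfE gt_eqF.
rewrite [LHS]Mb (@tr_block_mx _ 1 d 1 d) (@mulmx_block _ 1 d 1 d 1 d).
rewrite tr_scalar_mx trmx0 !mulmx0 !mul0mx !addr0 -scalar_mxM rr.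
rewrite linearZ /= mul_scalar_mx scalerA divff ?gt_eqF // scale1r.
rewrite mul_mx_scalar scalerA divff ?gt_eqF // scale1r -LE.
rewrite -scalemxAl -scalemxAr scalerA -invfM rr.
by rewrite [in RHS]addrC subrK.
Qed.

Lemma posdef_det_gt0 d (M : 'M[R]_d) : posdef M -> 0 < \det M.
Proof.
move=> /Cholesky[L uL ->]; rewrite det_mulmx det_tr -expr2 exprn_even_gt0 //=.
by rewrite -unitfE -unitmxE.
Qed.

Lemma posdef_unit d (M : 'M[R]_d) : posdef M -> M \in unitmx.
Proof. by move=> pM; rewrite unitmxE unitfE gt_eqF // posdef_det_gt0. Qed.

(** The pivot is at most 1, as the first basis vector shows, and the Schur complement subtracts a
    square from the lower block, hence stays below the identity. The determinant is their
    product. *)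
Lemma det_le1 d (M : 'M[R]_d) : posdef M ->
  (forall x, quadf M x <= dotv x x) -> \det M <= 1.
Proof.
elim: d M => [|d IH] M pM M1; first by rewrite det_mx00.
have [a0 Mb pS] := @posdef_Schur d M pM.
set a := M 0 0 in a0 Mb pS; set b := dlsubmx (M : 'M[R]_(1 + d)) in Mb pS.
have qM (s : R) y : quadf (M : 'M[R]_(1 + d)) (col_mx s%:M y) =
    a * s ^+ 2 + 2 * s * dotv b y + quadf (drsubmx (M : 'M[R]_(1 + d))) y.
  by rewrite {1}Mb quadf_block !mxE eqxx !mulr1n.
have dM (s : R) (y : 'cV_d) : dotv (col_mx s%:M y : 'cV_(1 + d)) (col_mx s%:M y) = s ^+ 2 + dotv y y.
  by rewrite /dotv tr_col_mx mul_row_col mxE tr_scalar_mx -scalar_mxM mxE eqxx mulr1n expr2.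
rewrite [M]Mb det_Schur ?gt_eqF //.
apply: mulr_ile1; rewrite ?(ltW a0) ?(ltW (posdef_det_gt0 pS)) //.
  have := M1 (col_mx 1%:M 0 : 'cV[R]_(1 + d)); rewrite qM dM !dotv0r quadf0 expr1n; lra.
apply: IH => // y; rewrite quadfD quadfN quadfZ quadf_outer.
have := M1 (col_mx 0%:M y : 'cV[R]_(1 + d)); rewrite qM dM.
have : 0 <= a^-1 * dotv b y ^+ 2 by rewrite mulr_ge0 ?invr_ge0 ?sqr_ge0 // ltW.
rewrite expr0n /=; lra.
Qed.

Lemma posdef_congr d (M L : 'M[R]_d) : L \in unitmx -> posdef M -> posdef (L *m M *m L^T).
Proof.
move=> uL [sM pM]; split; first by rewrite /symmx !trmx_mul trmxK sM mulmxA.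
move=> x x0; rewrite quadf_congr; apply: pM.
apply: contraNneq x0 => h; apply/eqP.
have uLT : L^T \in unitmx by rewrite unitmx_tr.
by rewrite -(mulKmx uLT x) h mulmx0.
Qed.

(** Congruence by the inverse Cholesky factor of [N] sends [N] to the identity and reduces the claim
    to [det_le1]. *)
Lemma det_le_Loewner d (M N : 'M[R]_d) : posdef M -> posdef N ->
  loewner_le M N -> \det M <= \det N.
Proof.
move=> pM pN MN; have [L uL NE] := Cholesky pN.
have uLi : invmx L \in unitmx by rewrite unitmx_inv.
have /det_le1 : posdef (invmx L *m M *m (invmx L)^T) by exact: posdef_congr.
rewrite !det_mulmx det_tr det_inv => h.
have dL : 0 < \det L ^+ 2 by rewrite exprn_even_gt0 //= -unitfE -unitmxE.
have dL0 : \det L != 0 by rewrite -unitfE -unitmxE.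
rewrite NE det_mulmx det_tr -expr2.
have := h _; rewrite (_ : _ * _ * _ = \det M / \det L ^+ 2); last by field.
rewrite ler_pdivrMr // mul1r; apply => x.
rewrite quadf_congr; apply: le_trans (MN _) _.
by rewrite -quadf_congr {1}NE mulmxA mulVmx // mul1mx trmx_inv mulmxV ?unitmx_tr // quadf1.
Qed.

Lemma posdefD d (M N : 'M[R]_d) : posdef M -> psd N -> posdef (M + N).
Proof.
move=> [sM pM] [sN pN]; split; first by rewrite /symmx linearD /= sM sN.
by move=> x x0; rewrite quadfD ltr_wpDr // pM.
Qed.

Lemma posdef_scalar d (a : R) : 0 < a -> posdef (a%:M : 'M[R]_d).
Proof.
move=> a0; split; first exact: tr_scalar_mx.
by move=> x x0; rewrite -scalemx1 quadfZ quadf1 mulr_gt0 // dotv_gt0.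
Qed.

Lemma psd_mulT a b (M : 'M[R]_(a, b)) : psd (M *m M^T).
Proof.
split; first by rewrite /symmx trmx_mul trmxK.
by move=> x; rewrite quadf_mulT dotv_ge0.
Qed.

Lemma psdD d (M N : 'M[R]_d) : psd M -> psd N -> psd (M + N).
Proof.
move=> [sM pM] [sN pN]; split; first by rewrite /symmx linearD /= sM sN.
by move=> x; rewrite quadfD addr_ge0.
Qed.

Lemma psd0 d : psd (0 : 'M[R]_d).
Proof. by split; [exact: trmx0|move=> x; rewrite quadf0m]. Qed.

Lemma psd_sum (I : Type) (r : seq I) (Q : pred I) d (F : I -> 'M[R]_d) :
  (forall i, psd (F i)) -> psd (\sum_(i <- r | Q i) F i).
Proof.
by move=> h; elim/big_rec: _ => [|i M _]; [exact: psd0|exact: psdD].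
Qed.

Lemma posdefZ d (M : 'M[R]_d) a : 0 < a -> posdef M -> posdef (a *: M).
Proof.
move=> a0 [sM pM]; split; first by rewrite /symmx linearZ /= sM.
by move=> x x0; rewrite quadfZ mulr_gt0 // pM.
Qed.

Lemma dotv_inv_Cholesky d (L : 'M[R]_d) x y : L \in unitmx ->
  dotv x (invmx (L *m L^T) *m y) = dotv (invmx L *m x) (invmx L *m y).
Proof.
move=> uL; rewrite dotv_mulmxl mulmxA; congr (dotv _ (_ *m _)).
have uLT : L^T \in unitmx by rewrite unitmx_tr.
by apply: (@row_full_inj _ _ _ _ (L *m L^T)); rewrite ?row_full_unit ?unitmx_mul ?uL //
  mulmxV ?unitmx_mul ?uL // trmx_inv mulmxA mulmxK // mulmxV.
Qed.

End PositiveDefinite.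

Section SigmaMin.
Variable R : realType.

Lemma sigma_min_le d (M : 'M[R]_d) x : dotv x x = 1 -> sigma_min M <= vnorm (M *m x).
Proof.
move=> /vnorm_unitP x1; apply: ge_inf; last by exists x.
by exists 0 => _ [y _ <-]; exact: vnorm_ge0.
Qed.

Lemma sigma_min_ge0 d (M : 'M[R]_d) : 0 <= sigma_min M.
Proof.
have [[x x1]|h] := pselect (exists x : 'cV[R]_d, vnorm x = 1).
  apply: lb_le_inf; first by exists (vnorm (M *m x)), x.
  by move=> _ [y _ <-]; exact: vnorm_ge0.
rewrite /sigma_min (_ : [set _ | _ in _] = set0) ?inf0 //.
by apply/seteqP; split=> [t [x x1 _]|//]; apply: h; exists x.
Qed.

(** Writing [x] as [invmx M *m (M *m x)] bounds the length of a unit vector by that of its image.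
    Positive dimension matters: the infimum over an empty set is 0. *)
Lemma sigma_min_gt0 d (M : 'M[R]_d) : (0 < d)%N -> M \in unitmx -> 0 < sigma_min M.
Proof.
case: d M => // d M _ uM.
pose c := frob2 (invmx M) + 1.
have c0 : 0 < c by rewrite ltr_wpDl // frob2_ge0.
apply: (@lt_le_trans _ _ (Num.sqrt c^-1)); first by rewrite sqrtr_gt0 invr_gt0.
apply: lb_le_inf.
  exists (vnorm (M *m delta_mx 0 0)), (delta_mx 0 0) => //=; apply/vnorm_unitP.
  rewrite dotvE (bigD1 ord0) //= big1 ?addr0 => [|i i0]; rewrite !mxE ?eqxx ?mulr1 //.
  by rewrite (negbTE i0) mul0r.
move=> _ [x /= /vnorm_unitP x1 <-]; rewrite vnormE ler_wsqrtr //.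
rewrite -[leLHS]mul1r ler_pdivrMr // mulrC.
have := dotv_mulmx_frob (invmx M) (M *m x); rewrite mulKmx // x1 => /le_trans; apply.
by rewrite ler_wpM2r ?dotv_ge0 // lerDl.
Qed.

(** Let [l] be the infimum of the form on the sphere and [B = M - l%:M], which is psd. For an almost
    minimizing unit [u], Cauchy-Schwarz for the form of [B] bounds the squared length of [B *m u] by
    [opnorm B * e]. So [M *m u] is nearly [l *: u], and [sigma_min M <= l]. *)
Lemma sigma_min_quadf d (M : 'M[R]_d) x : psd M -> sigma_min M * dotv x x <= quadf M x.
Proof.
move=> [sM pM].
have [->|/unit_vec[y y1 ->]] := eqVneq x 0; first by rewrite dotv0l quadf0 mulr0.
rewrite dotvZl dotvZr y1 mulr1 -expr2 quadfZv mulrC ler_wpM2l ?sqr_ge0 //.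
pose E := [set quadf M u | u in [set u : 'cV[R]_d | dotv u u = 1]].
have lbE : has_lbound E by exists 0 => _ [u _ <-]; exact: pM.
have E0 : E !=set0 by exists (quadf M y), y.
pose l := inf E.
have l0 : 0 <= l by apply: lb_le_inf => // _ [u _ <-]; exact: pM.
apply: (@le_trans _ _ l); last by apply: ge_inf => //; exists y.
pose B := M - l%:M.
have quB u : quadf B u = quadf M u - l * dotv u u.
  by rewrite quadfD quadfN -scalemx1 quadfZ quadf1.
have pB : psd B.
  split; first by rewrite /symmx linearB /= sM tr_scalar_mx.
  move=> u; rewrite quB subr_ge0.
  have [->|/unit_vec[v v1 ->]] := eqVneq u 0; first by rewrite dotv0l quadf0 mulr0.
  rewrite dotvZl dotvZr v1 mulr1 -expr2 quadfZv mulrC ler_wpM2l ?sqr_ge0 //.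
  by apply: ge_inf => //; exists v.
have o0 := opnorm_ge0 B.
have key e : 0 < e -> sigma_min M ^+ 2 <= l ^+ 2 + (opnorm B + 2 * l) * e.
  move=> e0.
  have [_ [u /= u1 <-] ue] : exists2 t, E t & t < l + e.
    by apply: inf_lt; rewrite // ltrDl.
  have qe : quadf B u <= e by rewrite quB u1; lra.
  have Bu : dotv (B *m u) (B *m u) <= opnorm B * e.
    have := psd_CauchySchwarz (B *m u) u pB.
    have := quadf_opnorm B (B *m u).
    have := dotv_ge0 (B *m u).
    set t := dotv _ _; rewrite le_eqVlt => /predU1P[<- _ _|t0 h1 h2].
      by rewrite mulr_ge0 // ltW.
    have : t ^+ 2 <= opnorm B * t * e.
      apply: le_trans h2 _.
      by apply: ler_pM => //; [case: pB => _; exact|case: pB => _; exact].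
    by rewrite expr2 mulrAC ler_pM2r.
  have : sigma_min M ^+ 2 <= dotv (M *m u) (M *m u).
    by rewrite -vnorm_sqr ler_pXn2r ?nnegrE ?sigma_min_ge0 ?vnorm_ge0 // sigma_min_le.
  move=> /le_trans; apply.
  have -> : M *m u = B *m u + l *: u.
    by rewrite mulmxBl mul_scalar_mx subrK.
  rewrite dotvDl !dotvDr !dotvZl !dotvZr u1 [dotv (B *m u) u]dotvC -quadfE.
  have : l * quadf B u <= l * e by rewrite ler_wpM2l.
  rewrite mulr1 -expr2; lra.
have h2 : sigma_min M ^+ 2 <= l ^+ 2.
  apply/ler_addgt0Pr => e e0.
  have c0 : 0 < opnorm B + 2 * l + 1 by rewrite ltr_wpDl // addr_ge0 // mulr_ge0.
  apply: le_trans (key (e / (opnorm B + 2 * l + 1)) _) _; first by rewrite divr_gt0.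
  rewrite lerD2l mulrCA -[leRHS]mulr1 ler_wpM2l ?(ltW e0) //.
  by rewrite ler_pdivrMr // mul1r lerDl.
by rewrite -(@ler_pXn2r _ 2) ?nnegrE // sigma_min_ge0.
Qed.

End SigmaMin.

(** * Rank one updates of determinants and inverse quadratic forms *)

Section RankOneUpdate.
Variables (R : realType) (d : nat).
Implicit Types (V : 'M[R]_d) (z S : 'cV[R]_d).

(** The matrix determinant lemma: the block matrix with corner -1, border [z] and block [V] is
    eliminated from either corner. *)
Lemma det_rank1 V z : V \in unitmx ->
  \det (V + z *m z^T) = \det V * (1 + dotv z (invmx V *m z)).
Proof.
move=> uV; have n1 : (-1 : R) != 0 by rewrite oppr_eq0 oner_eq0.
have := det_Schur z V n1.
have -> : (block_mx (-1)%:M (z^T) z V : 'M[R]_(1 + d)) =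
   block_mx 1%:M (z^T *m invmx V) 0 1%:M *m
   block_mx (- (1 + dotv z (invmx V *m z)))%:M 0 z V.
  rewrite mulmx_block !mul1mx !mul0mx !add0r mulmxKV //; congr block_mx.
  rewrite -mulmxA; apply/matrixP => i j; rewrite !ord1 [RHS]mxE [X in X + _]mxE.
  by rewrite !mxE eqxx !mulr1n /dotv !mxE; ring.
rewrite det_mulmx det_ublock det_lblock !det1 !mul1r det_scalar expr1.
rewrite invrN invr1 scaleN1r opprK mulN1r => h.
by apply: oppr_inj; rewrite -h; ring.
Qed.

(** Sherman-Morrison, arranged so that the new scalar [h] enters as [h ^+ 2] minus a square centred
    at [b]. After halving and exponentiating against a standard normal density, the first term
    cancels that density and the second leaves a Gaussian of mean [b] and variance [1 + q]. *)
Lemma quad_rank1 V z S (h : R) : posdef V ->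
  let q := dotv z (invmx V *m z) in
  let b := dotv z (invmx V *m S) in
  let S' := S + h *: z in
  dotv S' (invmx (V + z *m z^T) *m S') =
  dotv S (invmx V *m S) + h ^+ 2 - (h - b) ^+ 2 / (1 + q).
Proof.
move=> pV q b S'.
have uV := posdef_unit pV.
have [L uL LE] := Cholesky pV.
have q0 : 0 <= q by rewrite /q LE dotv_inv_Cholesky // dotv_ge0.
have q1 : 1 + q != 0 by rewrite gt_eqF // ltr_wpDr.
have bC : dotv S (invmx V *m z) = b.
  by rewrite /b LE !dotv_inv_Cholesky // dotvC.
have uV' : V + z *m z^T \in unitmx by apply/posdef_unit/posdefD => //; exact: psd_mulT.
pose c := (h - b) / (1 + q).
have -> : invmx (V + z *m z^T) *m S' = invmx V *m S + c *: (invmx V *m z).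
  rewrite -[RHS](mulKmx uV'); congr (_ *m _).
  rewrite mulmxDl !mulmxDr -!scalemxAr !mulKVmx //.
  rewrite -!mulmxA [z^T *m (invmx V *m S)]mx11_scalar [z^T *m (invmx V *m z)]mx11_scalar.
  rewrite !mul_mx_scalar -[(_ *m _) 0 0]/b -[(z^T *m _) 0 0]/q scalerA.
  rewrite -addrA; congr (_ + _); rewrite -scalerDl -scalerDl; congr (_ *: _).
  by rewrite /c; field.
rewrite dotvDl !dotvDr !dotvZl !dotvZr bC -/b -/q /c; field.
exact: q1.
Qed.

End RankOneUpdate.

(** * Nets of the sphere *)

Section Nets.
Variable R : realType.

(** Integer points of an l1 ball, coded by sign and magnitude, are counted with an exponential
    weight: the ratio 3/4 costs at most [2 * 4 * (4 / 3) ^+ 4 = 2048 / 81] per dimension. The bound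
    is rounded up to a power of 3 so as to meet the logarithms of 9 in [k1] and of 3 in [g1]. *)
Lemma card_l1_ball d :
  (#|[set f : {ffun 'I_d -> bool * 'I_(4 * d).+1} | (\sum_i (f i).2 <= 4 * d)%N]%SET| <= 27 ^ d)%N.
Proof.
set F := finset _.
rewrite -(ler_nat R) natrX.
pose x : R := 3 / 4.
have x0 : 0 < x by rewrite /x; lra.
have xV : 4 / 3 = x^-1 by rewrite /x; field.
have x1 : x <= 1 by rewrite /x; lra.
pose g (j : bool * 'I_(4 * d).+1) := x ^+ j.2.
have g0 j : 0 <= g j by rewrite exprn_ge0 // ltW.
have h1 : (#|F|%:R : R) <= \sum_(f in F) ((4 / 3) ^+ (4 * d) * \prod_i g (f i)).
  rewrite -sum1_card natr_sum; apply: ler_sum => f; rewrite inE => fF.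
  rewrite prodrXr xV exprVn ler_pdivlMl ?exprn_gt0 // mulr1.
  by apply: ler_wiXn2l => //; exact: ltW.
apply: le_trans h1 _.
apply: (@le_trans _ _ (\sum_(f : {ffun 'I_d -> bool * 'I_(4 * d).+1}) ((4 / 3) ^+ (4 * d) * \prod_i g (f i)))).
  rewrite big_mkcond /=; apply: ler_sum => f _; case: ifP => // _.
  by rewrite mulr_ge0 ?prodr_ge0 // exprn_ge0 // divr_ge0.
rewrite -mulr_sumr -(bigA_distr_bigA (fun _ : 'I_d => g)) /=.
rewrite prodr_const card_ord exprM -exprMn.
apply: lerXn2r; rewrite ?nnegrE //; first by rewrite mulr_ge0 ?exprn_ge0 ?sumr_ge0 ?divr_ge0.
have -> : \sum_j g j = \sum_(b : bool) \sum_(i < (4 * d).+1) x ^+ i.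
  by rewrite pair_big /=; apply: eq_bigr => -[].
have hs n : \sum_(i < n) x ^+ i = 4 * (1 - x ^+ n).
  elim: n => [|n IH]; first by rewrite big_ord0 expr0 subrr mulr0.
  by rewrite big_ord_recr /= IH exprS /x; lra.
rewrite hs sumr_const card_bool.
have : 0 <= x ^+ (4 * d).+1 by rewrite exprn_ge0 // ltW.
set y := x ^+ _; move=> y0.
rewrite (_ : (4 / 3) ^+ 4 = 256 / 81); last by field.
rewrite mulr2n; lra.
Qed.

(** The coordinates of [u] are rounded towards 0 on the grid of step [H^-1]. With [H] equal to 4
    times the root of [d], the squared error is at most [d * H^-2 = 1 / 16], and Cauchy-Schwarz
    places the grid point in the l1 ball of radius [4 * d]. Grid points are then normalized; their
    length [r] is at most 1 because rounding shortens, and [u] is approximated by [r *: z] rather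
    than by [z] itself. *)
Lemma sphere_net d : exists N : seq 'cV[R]_d,
  [/\ (size N <= 27 ^ d)%N, (forall z, z \in N -> dotv z z = 1) &
   forall u, dotv u u = 1 -> exists2 z, z \in N &
     exists2 r, 0 <= r <= 1 & dotv (u - r *: z) (u - r *: z) <= 4^-1 ^+ 2].
Proof.
have [->|d0] := posnP d.
  exists [::]; split=> // u; rewrite dotvE big_ord0 => /eqP.
  by rewrite eq_sym oner_eq0.
pose H : R := 4 * Num.sqrt d%:R.
have H0 : 0 < H by rewrite mulr_gt0 // sqrtr_gt0 ltr0n.
have HH : H ^+ 2 = 16 * d%:R by rewrite exprMn sqr_sqrtr // -natrX.
pose vec (f : {ffun 'I_d -> bool * 'I_(4 * d).+1}) : 'cV[R]_d :=
  \col_i (H^-1 * (-1) ^+ (f i).1 * (f i).2%:R).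
pose F := [set f : {ffun 'I_d -> bool * 'I_(4 * d).+1} | (\sum_i (f i).2 <= 4 * d)%N]%SET.
exists [seq (vnorm (vec f))^-1 *: vec f | f <- enum F & vec f != 0]; split.
- rewrite size_map size_filter (leq_trans (count_size _ _)) // -cardE.
  exact: card_l1_ball.
- move=> z /mapP[f]; rewrite mem_filter => /andP[f0 _] ->.
  rewrite dotvZl dotvZr -vnorm_sqr expr2; field.
  by rewrite -sqrf_eq0 vnorm_sqr dotv_eq0.
move=> u u1.
pose k i := Num.truncn (`|u i 0| * H).
have uH0 i : 0 <= `|u i 0| * H by rewrite mulr_ge0 // ltW.
have kle i : (k i)%:R <= `|u i 0| * H by rewrite -truncn_ge_nat.
have klt i : `|u i 0| * H < (k i).+1%:R by rewrite truncnS_gt.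
have sk : (\sum_i k i <= 4 * d)%N.
  rewrite -(ler_nat R) natr_sum.
  apply: le_trans (_ : \sum_i (`|u i 0| * H) <= _); first exact: ler_sum.
  rewrite -mulr_suml.
  have h : (\sum_i `|u i 0|) ^+ 2 <= d%:R.
    have := dotv_CauchySchwarz (\col_i `|u i 0|) (const_mx 1 : 'cV[R]_d).
    rewrite !dotvE (eq_bigr (fun i => `|u i 0|)) => [|i _]; last by rewrite !mxE mulr1.
    rewrite [X in X * _](eq_bigr (fun i => u i 0 * u i 0)) => [|i _]; last first.
      by rewrite !mxE -normrM ger0_norm // -expr2 sqr_ge0.
    rewrite -(dotvE u u) u1 mul1r => /le_trans; apply.
    under eq_bigr do rewrite !mxE mulr1.
    by rewrite sumr_const card_ord.
  have s0 : 0 <= \sum_i `|u i 0| by exact: sumr_ge0.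
  rewrite -(@ler_pXn2r _ 2) ?nnegrE // ?mulr_ge0 // ?(ltW H0) //.
  rewrite exprMn HH.
  apply: le_trans (_ : d%:R * (16 * d%:R) <= _); first by rewrite ler_wpM2r // mulr_ge0.
  by rewrite natrM; nra.
have kb i : (k i < (4 * d).+1)%N.
  by rewrite ltnS (leq_trans _ sk) // (bigD1 i) //= leq_addr.
pose f : {ffun 'I_d -> bool * 'I_(4 * d).+1} :=
  [ffun i => (u i 0 < 0, Ordinal (kb i))].
have fF : f \in F.
  by rewrite inE (eq_bigr k) // => i _; rewrite ffunE.
have fE i : vec f i 0 = H^-1 * (-1) ^+ (u i 0 < 0)%R * (k i)%:R.
  by rewrite mxE ffunE.
have dist : dotv (u - vec f) (u - vec f) <= 4^-1 ^+ 2.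
  rewrite dotvE; apply: le_trans (_ : \sum_(i < d) H^-1 ^+ 2 <= _).
    apply: ler_sum => i _.
    pose s : R := (-1) ^+ (u i 0 < 0)%R.
    have ue : u i 0 = s * `|u i 0| by rewrite -numEsign.
    have ss : s * s = 1 by rewrite /s; case: ltP; rewrite ?expr0 ?expr1 ?mulrNN mulr1.
    rewrite mxE [(- vec f) i 0]mxE fE -/s.
    have -> : u i 0 - H^-1 * s * (k i)%:R = s * H^-1 * (`|u i 0| * H - (k i)%:R).
      by rewrite {1}ue; field; rewrite gt_eqF.
    have -> a : s * H^-1 * a * (s * H^-1 * a) = (s * s) * H^-1 ^+ 2 * a ^+ 2 by ring.
    rewrite ss mul1r ler_piMr ?sqr_ge0 //.
    have := kle i; have := klt i; rewrite -natr1.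
    set a := _ * H; set b := _%:R => h1 h2.
    by rewrite expr_le1 //; lra.
  have -> : \sum_(i < d) H^-1 ^+ 2 = 4^-1 ^+ 2 :> R.
    rewrite sumr_const card_ord [H^-1 ^+ 2]exprVn HH -[LHS]mulr_natl.
    by field; rewrite pnatr_eq0 -lt0n.
  exact: lexx.
have f0 : vec f != 0.
  apply: contraTneq dist => ->; rewrite subr0 u1 -ltNge; lra.
have n0 : vnorm (vec f) != 0 by rewrite -sqrf_eq0 vnorm_sqr dotv_eq0.
exists ((vnorm (vec f))^-1 *: vec f).
  by apply/mapP; exists f => //; rewrite mem_filter f0 mem_enum.
exists (vnorm (vec f)); last by rewrite scalerA divff // scale1r.
rewrite vnorm_ge0 -(@ler_pXn2r _ 2) ?nnegrE ?vnorm_ge0 // vnorm_sqr expr1n -u1 !dotvE.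
apply: ler_sum => i _; rewrite -!expr2 fE.
have -> : (u i 0) ^+ 2 = (H^-1 * (-1) ^+ (u i 0 < 0)%R) ^+ 2 * (`|u i 0| * H) ^+ 2.
  rewrite -[in LHS](@real_normK _ (u i 0)) ?num_real // [in RHS]exprMn sqrr_sign mulr1 -exprMn.
  by congr (_ ^+ 2); field; rewrite gt_eqF.
rewrite [leLHS]exprMn ler_wpM2l ?sqr_ge0 //.
by rewrite ler_pXn2r ?nnegrE.
Qed.

Lemma ler_vnormD d (u v : 'cV[R]_d) : vnorm (u + v) <= vnorm u + vnorm v.
Proof.
rewrite -(@ler_pXn2r _ 2) ?nnegrE ?addr_ge0 ?vnorm_ge0 //.
rewrite sqrrD !vnorm_sqr dotvDl !dotvDr [dotv v u]dotvC.
have : dotv u v <= vnorm u * vnorm v.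
  apply: le_trans (ler_norm _) _.
  rewrite -(@ler_pXn2r _ 2) ?nnegrE ?mulr_ge0 ?vnorm_ge0 //.
  by rewrite real_normK ?num_real // exprMn !vnorm_sqr dotv_CauchySchwarz.
by rewrite mulr2n; lra.
Qed.

Lemma vnormZ d a (u : 'cV[R]_d) : vnorm (a *: u) = `|a| * vnorm u.
Proof.
by rewrite !vnormE dotvZl dotvZr mulrA -expr2 sqrtrM ?sqr_ge0 // sqrtr_sqr.
Qed.

Lemma vnorm_mulmx a b (M : 'M[R]_(a, b)) x : vnorm (M *m x) <= opnorm M * vnorm x.
Proof.
rewrite -(@ler_pXn2r _ 2) ?nnegrE ?mulr_ge0 ?vnorm_ge0 ?opnorm_ge0 //.
by rewrite exprMn !vnorm_sqr dotv_mulmx_opnorm.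
Qed.

Section NetTransfer.
Variables (d : nat) (N : seq 'cV[R]_d).
Hypothesis N1 : forall z, z \in N -> dotv z z = 1.
Hypothesis Nnet : forall u, dotv u u = 1 -> exists2 z, z \in N &
  exists2 r, 0 <= r <= 1 & dotv (u - r *: z) (u - r *: z) <= 4^-1 ^+ 2.

(** Approximating a unit vector by [r *: z] gives [opnorm M <= Num.sqrt c + opnorm M / 4]; the
    factor 16/9 is the square of 4/3. *)
Lemma net_mulmx a (M : 'M[R]_(a, d)) c : 0 <= c ->
  (forall z, z \in N -> dotv (M *m z) (M *m z) <= c) ->
  forall x, dotv (M *m x) (M *m x) <= 16 / 9 * c * dotv x x.
Proof.
move=> c0 Mc x.
have : opnorm M <= Num.sqrt c + opnorm M / 4.
  apply: opnorm_le => [|u u1]; first by rewrite addr_ge0 ?sqrtr_ge0 // divr_ge0 ?opnorm_ge0.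
  rewrite -vnorm_sqr ler_pXn2r ?nnegrE ?vnorm_ge0 ?addr_ge0 ?sqrtr_ge0 ?divr_ge0 ?opnorm_ge0 //.
  have [z zN [r /andP[r0 r1] rz]] := Nnet u1.
  have -> : M *m u = r *: (M *m z) + M *m (u - r *: z).
    by rewrite scalemxAr -mulmxDr addrC subrK.
  apply: le_trans (ler_vnormD _ _) _; apply: lerD.
    rewrite vnormZ ger0_norm //; apply: le_trans (ler_piMl (vnorm_ge0 _) r1) _.
    by rewrite vnormE ler_wsqrtr // Mc.
  apply: le_trans (vnorm_mulmx _ _) _.
  rewrite ler_wpM2l ?opnorm_ge0 // vnormE.
  by rewrite -[leRHS]ger0_norm ?invr_ge0 // -sqrtr_sqr ler_wsqrtr.
move=> h; have h2 : opnorm M <= 4 / 3 * Num.sqrt c by lra.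
apply: le_trans (dotv_mulmx_opnorm _ _) _; rewrite ler_wpM2r ?dotv_ge0 //.
have -> : 16 / 9 * c = (4 / 3 * Num.sqrt c) ^+ 2 by rewrite exprMn sqr_sqrtr //; field.
by rewrite ler_pXn2r ?nnegrE ?opnorm_ge0 ?mulr_ge0 ?sqrtr_ge0.
Qed.

(** A symmetric form loses only a factor 2: its values at [u] and [r *: z] differ by the bilinear
    value at [u - r *: z] and [u + r *: z], which polarization bounds by half of the supremum [s].
    Hence [s <= c + s / 2]. *)
Lemma net_quadf (B : 'M[R]_d) c : symmx B -> 0 <= c ->
  (forall z, z \in N -> `|quadf B z| <= c) ->
  forall x, `|quadf B x| <= 2 * c * dotv x x.
Proof.
move=> sB c0 Bc x.
have [->|/unit_vec[w w1 ->]] := eqVneq x 0; first by rewrite quadf0 dotv0l mulr0 normr0.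
rewrite quadfZv normrM dotvZl dotvZr w1 mulr1 -expr2 ger0_norm ?sqr_ge0 // mulrC.
rewrite ler_wpM2r ?sqr_ge0 //.
pose E := [set `|quadf B u| | u in [set u : 'cV[R]_d | dotv u u = 1]].
have nB u : `|quadf B u| <= opnorm B * dotv u u.
  have := quadf_opnorm B u; have := quadf_opnorm (- B) u.
  rewrite quadfN (_ : opnorm (- B) = opnorm B); last first.
    rewrite /opnorm; congr sup; apply/seteqP; split=> [t [y y1 <-]|t [y y1 <-]];
    by exists y => //; rewrite mulNmx -scaleN1r vnormZ normrN1 mul1r.
  by move=> h1 h2; rewrite ler_norml h2 andbT lerNl.
have ubE : has_ubound E.
  by exists (opnorm B) => _ [u u1 <-]; have := nB u; rewrite u1 mulr1.
have E0 : E !=set0 by exists `|quadf B w|, w.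
pose s := sup E.
have sle u : `|quadf B u| <= s * dotv u u.
  have [->|/unit_vec[y y1 ->]] := eqVneq u 0; first by rewrite quadf0 dotv0l mulr0 normr0.
  rewrite quadfZv normrM dotvZl dotvZr y1 mulr1 -expr2 ger0_norm ?sqr_ge0 // mulrC.
  by rewrite ler_wpM2r ?sqr_ge0 //; apply: ub_le_sup => //; exists y.
have s0 : 0 <= s.
  by have := sle w; rewrite w1 mulr1; apply: le_trans.
have pol a b : `|dotv a (B *m b)| <= s / 2 * (dotv a a + dotv b b).
  have h1 := quadf_addv a b sB.
  have := quadf_addv a (- b) sB; rewrite mulmxN dotvNr -scaleN1r quadfZv sqrrN expr1n mul1r => h2.
  have -> : dotv a (B *m b) = 4^-1 * (quadf B (a + b) - quadf B (a + -1 *: b)).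
    by rewrite h1 h2; field.
  rewrite normrM ger0_norm ?invr_ge0 //.
  have h3 := ler_normB (quadf B (a + b)) (quadf B (a + -1 *: b)).
  have := sle (a + b); have := sle (a + -1 *: b).
  rewrite !dotvDl !dotvDr !dotvZl !dotvZr [dotv b a]dotvC; lra.
apply: le_trans (_ : s <= _); first by apply: ub_le_sup => //; exists w.
(* This weight balances the two vectors: 8 times the squared length of [u - r *: z] and one eighth
   of that of [u + r *: z] are each at most 1/2. *)
pose e : R := Num.sqrt 8.
have e0 : 0 < e by rewrite sqrtr_gt0.
have ee : e * e = 8 by rewrite -expr2 sqr_sqrtr.
have : s <= c + s / 2.
  apply: ge_sup => // _ [u /= u1 <-].
  have [z zN [r /andP[r0 r1] rz]] := Nnet u1.
  have -> : quadf B u = r ^+ 2 * quadf B z + dotv (e *: (u - r *: z)) (B *m (e^-1 *: (u + r *: z))).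
    rewrite dotvZl -scalemxAr dotvZr mulrA divff ?gt_eqF // mul1r.
    have hq : quadf B u = quadf B (u - r *: z) + 2 * dotv (u - r *: z) (B *m (r *: z))
        + quadf B (r *: z) by rewrite -quadf_addv // subrK.
    have -> : u + r *: z = (u - r *: z) + 2 *: (r *: z).
      by rewrite scaler_nat mulr2n addrA subrK.
    rewrite hq mulmxDr dotvDr -quadfE -[B *m (2 *: _)]scalemxAr dotvZr quadfZv; ring.
  apply: le_trans (ler_normD _ _) _; apply: lerD.
    rewrite normrM normrX ger0_norm //.
    have r2 : r ^+ 2 <= 1 by rewrite expr_le1.
    exact: le_trans (ler_piMl (normr_ge0 _) r2) (Bc _ zN).
  apply: le_trans (pol _ _) _.
  rewrite -[leRHS]mulr1 ler_wpM2l ?divr_ge0 // !dotvZl !dotvZr !mulrA -invfM ee.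
  have h1 : dotv (u + r *: z) (u + r *: z) + dotv (u - r *: z) (u - r *: z) <= 4.
    rewrite !dotvDl !dotvDr -!scaleNr !dotvZl !dotvZr u1 (N1 zN) [dotv z u]dotvC.
    have : r * r <= 1 by rewrite mulr_ile1.
    lra.
  have h2 := dotv_ge0 (u - r *: z).
  move: rz h1 h2; set A := dotv (u - _) _; set A' := dotv (u + _) _; lra.
lra.
Qed.

End NetTransfer.

End Nets.

(** * Uniqueness of the Fourier transform *)

Section CauchyKernel.
Variable R : realType.
Local Notation mu := (@lebesgue_measure R).

(** An antiderivative in [t] of [expR (- t) * (1 + cos (t * x))], vanishing at infinity. It realizes
    the Cauchy kernel as a Laplace average of cosines. *)
Let F (x t : R) : R := expR (- t) * ((x * sin (t * x) - cos (t * x)) / (1 + x ^+ 2) - 1).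

Let oneDsqr_neq0 (x : R) : 1 + x ^+ 2 != 0.
Proof. by rewrite gt_eqF // ltr_pwDl // sqr_ge0. Qed.

Let dF (x t : R) : is_derive t 1 (F x) (expR (- t) * (1 + cos (t * x))).
Proof.
rewrite /F; apply: is_derive_eq.
rewrite /GRing.scale /=; field.
exact: oneDsqr_neq0.
Qed.

Let cF (x t : R) : {for t, continuous (F x)}.
Proof. exact/differentiable_continuous/derivable1_diffP/(@ex_derive _ _ _ _ _ _ _ (dF x t)). Qed.

Let limF (x : R) : F x t @[t --> +oo] --> 0.
Proof.
apply/cvgr0Pnorm_le => /= e e0.
pose C := (`|x| + 1) / (1 + x ^+ 2) + 1.
have C0 : 0 < C by rewrite ltr_wpDl // divr_ge0 ?addr_ge0 // sqr_ge0.
have hC t : `|(x * sin (t * x) - cos (t * x)) / (1 + x ^+ 2) - 1| <= C.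
  apply: le_trans (ler_normB _ _) _; rewrite normr1 lerD2r normrM.
  rewrite [`|_^-1|]ger0_norm ?invr_ge0 ?addr_ge0 ?sqr_ge0 // ler_wpM2r ?invr_ge0 ?addr_ge0 ?sqr_ge0 //.
  apply: le_trans (ler_normB _ _) _; rewrite lerD //; last by rewrite ler_norml cos_geN1 cos_le1.
  by rewrite normrM ler_piMr // ler_norml sin_geN1 sin_le1.
near=> t; rewrite normrM ger0_norm ?expR_ge0 //.
apply: le_trans (_ : expR (- t) * C <= _); first by rewrite ler_wpM2l ?expR_ge0.
rewrite -ler_pdivlMr // -[leRHS]lnK ?posrE ?divr_gt0 // ler_expR lerNl.
near: t; apply: nbhs_pinfty_ge; exact: num_real.
Unshelve. all: end_near. Qed.

Lemma integral_exp_cos (x : R) :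
  (\int[mu]_(t in `[0%R, +oo[) (expR (- t) * (1 + cos (t * x)))%:E =
   (1 + (1 + x ^+ 2)^-1)%:E)%E.
Proof.
rewrite (@ge0_continuous_FTC2y _ _ (F x) 0 0).
- rewrite sub0e -EFinN; congr EFin.
  by rewrite /F oppr0 expR0 !mul0r sin0 cos0; field.
- move=> t _; rewrite mulr_ge0 ?expR_ge0 //.
- apply: continuous_subspaceT => t.
  apply/differentiable_continuous/derivable1_diffP.
  by apply: derivableM; apply: ex_derive.
- exact: limF.
- by move=> t _; have [] := dF x t.
- by apply: cvg_at_right_filter; exact: cF.
- by move=> t _; rewrite derive1E; have [_ ->] := dF x t.
Qed.

Let cK (s x y : R) : {for y, continuous (fun y => 1 + (1 + (s * (y - x)) ^+ 2)^-1)}.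
Proof.
have h : 1 + (s * (y - x)) ^+ 2 != 0 by exact: oneDsqr_neq0.
apply: cvgD; first exact: cvg_cst.
apply: cvgV => //; apply: cvgD; first exact: cvg_cst.
apply: (@cvg_comp _ _ _ (fun y => s * (y - x)) (fun z => z ^+ 2)); last exact: exprn_continuous.
by apply: cvgM; [exact: cvg_cst|apply: cvgB; [exact: cvg_id|exact: cvg_cst]].
Qed.

Lemma integral_Cauchy (s x a b : R) : 0 < s -> a < b ->
  (\int[mu]_(y in `[a, b]) (1 + (1 + (s * (y - x)) ^+ 2)^-1)%:E =
   (b - a + s^-1 * (atan (s * (b - x)) - atan (s * (a - x))))%:E)%E.
Proof.
move=> s0 ab.
pose G (y : R) := y + s^-1 * atan (s * (y - x)).
have dG (y : R) : is_derive y 1 G (1 + (1 + (s * (y - x)) ^+ 2)^-1).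
  apply: is_derive_eq; rewrite /GRing.scale /=; field.
  by rewrite oneDsqr_neq0 gt_eqF.
have cG (y : R) : {for y, continuous G}.
  exact/differentiable_continuous/derivable1_diffP/(@ex_derive _ _ _ _ _ _ _ (dG y)).
rewrite (@continuous_FTC2 _ _ G) //.
- by rewrite -EFinB /G; congr EFin; ring.
- by apply: continuous_subspaceT => y; exact: cK.
- split.
  + by move=> y _; have [] := dG y.
  + by apply: cvg_at_right_filter; exact: cG.
  + by apply: cvg_at_left_filter; exact: cG.
- by move=> y _; rewrite derive1E; have [_ ->] := dG y.
Qed.

End CauchyKernel.

Section BoundedFunctions.
Context d (T : measurableType d) (R : realType) (P : probability T R).

Lemma bounded_integrable (f : T -> R) (M : R) : measurable_fun setT f ->
  (forall x, `|f x| <= M) -> P.-integrable setT (EFin \o f).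
Proof.
move=> mf fM; apply: (@le_integrable _ _ _ P _ measurableT _ (cst M%:E)) => //.
- exact/measurable_EFinP.
- move=> x _ /=; rewrite lee_fin; apply: le_trans (fM x) (ler_norm _).
- exact: finite_measure_integrable_cst.
Qed.

End BoundedFunctions.

Section FourierUniqueness.
Context d (T : measurableType d) (R : realType) (P : probability T R).
Local Notation mu := (@lebesgue_measure R).

Lemma measurable_cauchy (s : R) :
  measurable_fun setT (fun x : R => 1 + (1 + (s * x) ^+ 2)^-1).
Proof.
apply: measurable_funD => //; apply: measurable_funTS; apply: continuous_measurable_fun => y.
have h : 1 + (s * y) ^+ 2 != 0 by rewrite gt_eqF // ltr_pwDl // sqr_ge0.
apply: cvgV => //; apply: cvgD; first exact: cvg_cst.
apply: (@cvg_comp _ _ _ (fun y => s * y) (fun z => z ^+ 2)); last exact: exprn_continuous.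
by apply: cvgM; [exact: cvg_cst|exact: cvg_id].
Qed.

Lemma measurable_cos : measurable_fun setT (@cos R).
Proof. by apply: continuous_measurable_fun; exact: continuous_cos. Qed.

Lemma measurable_atan : measurable_fun setT (@atan R).
Proof. by apply: continuous_measurable_fun; exact: continuous_atan. Qed.

Lemma oneDcos_ge0 (x : R) : 0 <= 1 + cos x.
Proof. by have := cos_geN1 x; lra. Qed.

Section OneWeight.
Variables (phi f : T -> R).
Hypotheses (mphi : measurable_fun setT phi) (mf : measurable_fun setT f).
Hypothesis phi0 : forall o, 0 <= phi o.

(** Tonelli applied to the Laplace representation of the Cauchy kernel: its mean against [phi]
    depends only on the cosine transform of [f] under the density [phi]. *)
Lemma integral_cauchy_fourier (s y : R) :
  (\int[P]_o (phi o * (1 + (1 + (s * (y - f o)) ^+ 2)^-1))%:E =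
   \int[mu]_(t in `[0%R, +oo[) ((expR (- t))%:E *
      \int[P]_o (phi o * (1 + cos (t * s * f o - t * s * y)))%:E))%E.
Proof.
pose g (z : T * R) : \bar R := ((phi z.1 * (expR (- z.2) * (1 + cos (z.2 * (s * (y - f z.1))))))
  * \1_`[0, +oo[ z.2)%:E.
have g0 z : (0 <= g z)%E.
  by rewrite lee_fin !mulr_ge0 ?phi0 ?expR_ge0 ?oneDcos_ge0.
have mg : measurable_fun setT g.
  apply/measurable_EFinP; apply: measurable_funM.
    apply: measurable_funM; first exact: measurableT_comp.
    apply: measurable_funM; first by do 2 apply: measurableT_comp => //.
    apply: measurable_funD => //; apply: measurableT_comp; first exact: measurable_cos.
    apply: measurable_funM => //; apply: measurable_funM => //; apply: measurable_funB => //.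
    exact: measurableT_comp.
  exact: measurableT_comp.
have := @fubini_tonelli _ _ _ _ R P mu g mg g0.
rewrite (eq_integral (fun o => (phi o * (1 + (1 + (s * (y - f o)) ^+ 2)^-1))%:E)); last first.
  move=> o _; rewrite EFinM -integral_exp_cos -ge0_integralZl //=.
  - rewrite [RHS]integral_mkcond; apply: eq_integral => t _.
    rewrite /g /= patchE indicE; case: ifPn => _; rewrite ?mulr1 ?mulr0 ?EFinM //.
  - apply/measurable_EFinP/measurable_funTS; apply: measurable_funM.
      by apply: measurableT_comp => //.
    apply: measurable_funD => //; apply: measurableT_comp; first exact: measurable_cos.
    exact: measurable_funM.
  - by rewrite lee_fin phi0.
move=> ->; rewrite [RHS]integral_mkcond; apply: eq_integral => t _.
rewrite patchE; case: ifPn => tD.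
  rewrite -ge0_integralZl //=.
  - apply: eq_integral => o _; rewrite /g /= indicE tD mulr1 -EFinM; congr EFin.
    by rewrite mulrCA -[in LHS]cosN; congr (_ * (_ * (1 + cos _))); ring.
  - apply/measurable_EFinP; apply: measurable_funM => //.
    apply: measurable_funD => //; apply: measurableT_comp; first exact: measurable_cos.
    by apply: measurable_funB => //; apply: measurable_funM.
  - by move=> o _; rewrite lee_fin mulr_ge0 ?phi0 ?oneDcos_ge0.
by apply: integral0_eq => o _; rewrite /g /= indicE (negbTE tD) mulr0.
Qed.

(** Integrating the kernel in its centre [y] over an interval produces a difference of arctangents,
    which is a smoothed indicator of the interval when [s] is large. *)
Lemma integral_cauchy_atan (s a b : R) : 0 < s -> a < b ->
  (\int[P]_o (phi o * (b - a + s^-1 * (atan (s * (b - f o)) - atan (s * (a - f o)))))%:E =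
   \int[mu]_(y in `[a, b]) \int[P]_o (phi o * (1 + (1 + (s * (y - f o)) ^+ 2)^-1))%:E)%E.
Proof.
move=> s0 ab.
pose g (z : T * R) : \bar R := ((phi z.1 * (1 + (1 + (s * (z.2 - f z.1)) ^+ 2)^-1))
  * \1_`[a, b] z.2)%:E.
have K0 (x : R) : 0 <= 1 + (1 + x ^+ 2)^-1.
  by rewrite addr_ge0 // invr_ge0 addr_ge0 // sqr_ge0.
have g0 z : (0 <= g z)%E by rewrite lee_fin !mulr_ge0 ?phi0 ?K0.
have mg : measurable_fun setT g.
  apply/measurable_EFinP; apply: measurable_funM.
    apply: measurable_funM; first exact: measurableT_comp.
    apply: (@measurableT_comp _ _ _ _ _ _ (fun x => 1 + (1 + (s * x) ^+ 2)^-1)).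
      exact: measurable_cauchy.
    by apply: measurable_funB => //; exact: measurableT_comp.
  exact: measurableT_comp.
have := @fubini_tonelli _ _ _ _ R P mu g mg g0.
rewrite (eq_integral (fun o => (phi o * (b - a + s^-1 * (atan (s * (b - f o)) - atan (s * (a - f o)))))%:E)); last first.
  move=> o _; rewrite EFinM -integral_Cauchy // -ge0_integralZl //=.
  - rewrite [RHS]integral_mkcond; apply: eq_integral => t _.
    by rewrite /g /= patchE indicE; case: ifPn => _; rewrite ?mulr1 ?mulr0 ?EFinM.
  - apply/measurable_EFinP/measurable_funTS.
    apply: (@measurableT_comp _ _ _ _ _ _ (fun x => 1 + (1 + (s * x) ^+ 2)^-1)).
      exact: measurable_cauchy.
    exact: measurable_funB.
  - by move=> t _; rewrite lee_fin K0.
  - by rewrite lee_fin phi0.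
move=> ->; rewrite [RHS]integral_mkcond; apply: eq_integral => t _.
rewrite patchE; case: ifPn => tD.
  by apply: eq_integral => o _; rewrite /g /= indicE tD mulr1.
by apply: integral0_eq => o _; rewrite /g /= indicE (negbTE tD) mulr0.
Qed.

(** Packs density and map into one measure on the line, to which uniqueness on a pi-system
    applies. *)
Lemma weighted_pushforward : exists nu : {measure set R -> \bar R},
  forall B, nu B = (\int[P]_(o in f @^-1` B) (phi o)%:E)%E.
Proof.
pose m (B : set R) := (\int[P]_(o in f @^-1` B) (phi o)%:E)%E.
have m0 : m set0 = 0%E by rewrite /m preimage_set0 integral_set0.
have mge0 B : (0 <= m B)%E by apply: integral_ge0 => o _; rewrite lee_fin.
have madd : semi_sigma_additive m.
  move=> F mF tF mUF; rewrite /m preimage_bigcup ge0_integral_bigcup //=.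
  - by apply: is_cvg_ereal_nneg_natsum_cond => n _ _; exact: mge0.
  - by move=> k; rewrite -[X in measurable X]setTI; exact: mf.
  - exact/measurable_EFinP/measurable_funTS.
  - by move=> o _; rewrite lee_fin.
  - apply/trivIsetP => i j _ _ ij; rewrite -preimage_setI.
    by move/trivIsetP : tF => /(_ i j Logic.I Logic.I ij) ->; rewrite preimage_set0.
by exists (HB.pack m (isMeasure.Build _ _ _ m m0 mge0 madd) : {measure set R -> \bar R}).
Qed.

End OneWeight.

Lemma cvg_scaled_pinfty (c e : R) : 0 < c \/ c = 0 /\ 0 < e ->
  (n.+1%:R ^+ 2 * (c + e / n.+1%:R)) @[n --> \oo] --> +oo.
Proof.
move=> h.
suff [k k0 hk] : exists2 k, 0 < k & \forall n \near \oo, k <= n.+1%:R * c + e.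
  apply/cvgryPge => A; near=> n.
  have -> : n.+1%:R ^+ 2 * (c + e / n.+1%:R) = n.+1%:R * (n.+1%:R * c + e).
    by field; rewrite gt_eqF.
  apply: (@le_trans _ _ (n.+1%:R * k)); last first.
    by rewrite ler_wpM2l //; near: n.
  rewrite -ler_pdivrMr // -natr1; near: n.
  have := nbhs_infty_ger (A / k); apply: filterS => n /= hn.
  by apply: le_trans hn _; rewrite lerDl.
case: h => [c0|[-> e0]]; last by exists e => //; near=> n; rewrite mulr0 add0r.
exists 1 => //; near=> n.
rewrite -lerBlDr -ler_pdivrMr // -natr1.
have : (1 - e) / c <= n%:R by near: n; exact: nbhs_infty_ger.
by move/le_trans; apply; rewrite lerDl.
Unshelve. all: end_near. Qed.

Lemma cvg_atan_scaled (c e : R) : 0 < c \/ c = 0 /\ 0 < e ->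
  atan (n.+1%:R ^+ 2 * (c + e / n.+1%:R)) @[n --> \oo] --> pi / 2.
Proof.
move=> h; apply: (@cvg_comp _ _ _ _ (@atan R)); last exact: cvgy_atan.
exact: cvg_scaled_pinfty.
Qed.

Lemma cvg_atan_scaledN (c e : R) : c < 0 \/ c = 0 /\ e < 0 ->
  atan (n.+1%:R ^+ 2 * (c + e / n.+1%:R)) @[n --> \oo] --> - (pi / 2).
Proof.
move=> h.
rewrite (_ : (fun n => _) = fun n => - atan (n.+1%:R ^+ 2 * (- c + (- e) / n.+1%:R))).
  by apply: cvgN; apply: cvg_atan_scaled; case: h => [|[->]]; [left|right]; lra.
by apply/funext => n; rewrite -atanN; congr atan; ring.
Qed.

(** The steepness grows like [n ^+ 2] while the ends move inwards by only [e / n], so at [x = a] and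
    at [x = b] both arctangents tend to the same value. The limit is then exactly the indicator of
    the open interval times [pi], even if the law has atoms. Division by 3 keeps the moved ends in
    order. *)
Definition smooth_step (a b : R) (n : nat) (x : R) :=
  let e := (b - a) / 3 in
  atan (n.+1%:R ^+ 2 * (b - e / n.+1%:R - x)) -
  atan (n.+1%:R ^+ 2 * (a + e / n.+1%:R - x)).

Lemma cvg_smooth_step (a b x : R) : a < b ->
  smooth_step a b n x @[n --> \oo] --> pi * \1_`]a, b[ x.
Proof.
move=> ab; rewrite /smooth_step; set e := (b - a) / 3.
have e0 : 0 < e by rewrite divr_gt0 // subr_gt0.
have hb (n : nat) : b - e / n.+1%:R - x = (b - x) + (- e) / n.+1%:R by ring.
have ha (n : nat) : a + e / n.+1%:R - x = (a - x) + e / n.+1%:R by ring.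
under eq_cvg do rewrite hb ha.
rewrite indicE mem_setE in_itv /=; case h: (_ && _) => /=.
  move: h => /andP[ax xb]; rewrite mulr1.
  rewrite (_ : pi = pi / 2 - - (pi / 2)); last by field.
  apply: cvgB; first by apply: cvg_atan_scaled; left; lra.
  by apply: cvg_atan_scaledN; left; lra.
rewrite mulr0.
have [ax|xa] := ltP a x.
  move: h; rewrite ax /= => /negbT; rewrite -leNgt => h.
  have c1 : b - x < 0 \/ b - x = 0 /\ - e < 0.
    by move: h; rewrite le_eqVlt => /predU1P[->|?]; [right|left]; lra.
  have c2 : a - x < 0 \/ a - x = 0 /\ e < 0 by left; lra.
  have hh := cvgB (cvg_atan_scaledN c1) (cvg_atan_scaledN c2); rewrite subrr in hh; exact: hh.
have c1 : 0 < b - x \/ b - x = 0 /\ 0 < - e by left; lra.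
have c2 : 0 < a - x \/ a - x = 0 /\ 0 < e.
  by move: xa; rewrite le_eqVlt => /predU1P[->|?]; [right|left]; lra.
have hh := cvgB (cvg_atan_scaled c1) (cvg_atan_scaled c2); rewrite subrr in hh; exact: hh.
Qed.

Lemma normr_smooth_step (a b : R) n x : `|smooth_step a b n x| <= pi.
Proof.
apply: le_trans (ler_normB _ _) _.
have h (y : R) : `|atan y| <= pi / 2.
  by rewrite ler_norml !ltW ?atan_gtNpi2 ?atan_ltpi2.
by apply: le_trans (lerD (h _) (h _)) _; lra.
Qed.

Lemma measurable_smooth_step a b n (f : T -> R) : measurable_fun setT f ->
  measurable_fun setT (fun o => smooth_step a b n (f o)).
Proof.
move=> mf; apply: measurable_funB; apply: measurableT_comp; try exact: measurable_atan;
  by apply: measurable_funM => //; apply: measurable_funB.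
Qed.

Section TwoWeights.
Variables (phi1 phi2 f1 f2 : T -> R) (M : R).
Hypotheses (mphi1 : measurable_fun setT phi1) (mf1 : measurable_fun setT f1).
Hypotheses (mphi2 : measurable_fun setT phi2) (mf2 : measurable_fun setT f2).
Hypotheses (phi10 : forall o, 0 <= phi1 o <= M) (phi20 : forall o, 0 <= phi2 o <= M).
Hypothesis fourier : forall t z,
  (\int[P]_o (phi1 o * (1 + cos (t * f1 o - z)))%:E =
   \int[P]_o (phi2 o * (1 + cos (t * f2 o - z)))%:E)%E.

Let int_phi (phi h : T -> R) (N : R) : measurable_fun setT phi -> (forall o, 0 <= phi o <= M) ->
  measurable_fun setT h -> (forall o, `|h o| <= N) ->
  P.-integrable setT (EFin \o (fun o => phi o * h o)).
Proof.
move=> mphi b mh hN; apply: (@bounded_integrable _ _ _ P _ (M * N)).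
  exact: measurable_funM.
move=> o; rewrite normrM; have /andP[p0 pM] := b o.
by rewrite ger0_norm // ler_pM.
Qed.

Lemma fourier_smooth_step (a b : R) n : a < b ->
  \int[P]_o (phi1 o * smooth_step a b n (f1 o)) =
  \int[P]_o (phi2 o * smooth_step a b n (f2 o)).
Proof.
move=> ab; pose e := (b - a) / 3.
pose a' := a + e / n.+1%:R; pose b' := b - e / n.+1%:R; pose s : R := n.+1%:R ^+ 2.
have e0 : 0 < e by rewrite divr_gt0 // subr_gt0.
have s0 : 0 < s by rewrite exprn_gt0.
have en : e / n.+1%:R <= e by rewrite ler_pdivrMr // ler_peMr ?(ltW e0) // ler1n.
have ab' : a' < b' by rewrite /a' /b'; move: en; rewrite /e; set q := _ / n.+1%:R; lra.
have p10 o : 0 <= phi1 o by case/andP: (phi10 o).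
have p20 o : 0 <= phi2 o by case/andP: (phi20 o).
have key : \int[P]_o (phi1 o * (b' - a' + s^-1 * smooth_step a b n (f1 o))) =
           \int[P]_o (phi2 o * (b' - a' + s^-1 * smooth_step a b n (f2 o))).
  rewrite /Rintegral; congr fine.
  rewrite (@integral_cauchy_atan _ _ mphi1 mf1 p10 s a' b' s0 ab').
  rewrite (@integral_cauchy_atan _ _ mphi2 mf2 p20 s a' b' s0 ab').
  apply: eq_integral => y _.
  rewrite (integral_cauchy_fourier mphi1 mf1 p10 s y) (integral_cauchy_fourier mphi2 mf2 p20 s y).
  by apply: eq_integral => t _; rewrite fourier.
(* At frequency and phase 0 the transform is twice the total mass; equality of masses removes the
   constant part [b' - a'] from [key]. *)
have mass : \int[P]_o (phi1 o) = \int[P]_o (phi2 o).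
  have := fourier 0 0 => /(congr1 fine).
  under eq_integral do rewrite mul0r subr0 cos0 EFinM.
  under [X in _ = fine X -> _]eq_integral do rewrite mul0r subr0 cos0 EFinM.
  rewrite -[fine _]/(\int[P]_o (phi1 o * (1 + 1))) -[fine _ in RHS]/(\int[P]_o (phi2 o * (1 + 1))).
  have i (phi : T -> R) : measurable_fun setT phi -> (forall o, 0 <= phi o <= M) ->
     P.-integrable setT (EFin \o phi).
    move=> mp b1; apply: (@bounded_integrable _ _ _ P _ M) => // o.
    by have /andP[? ?] := b1 o; rewrite ger0_norm.
  by rewrite !RintegralZr // ?i // => /mulIf; apply; rewrite gt_eqF.
have lin (phi f : T -> R) : measurable_fun setT phi -> measurable_fun setT f ->
    (forall o, 0 <= phi o <= M) ->
    \int[P]_o (phi o * (b' - a' + s^-1 * smooth_step a b n (f o))) =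
    (b' - a') * \int[P]_o (phi o) + s^-1 * \int[P]_o (phi o * smooth_step a b n (f o)).
  move=> mp mf pb.
  have i1 : P.-integrable setT (EFin \o phi).
    apply: (@bounded_integrable _ _ _ P _ M) => // o.
    by have /andP[? ?] := pb o; rewrite ger0_norm.
  have i2 : P.-integrable setT (EFin \o (fun o => phi o * smooth_step a b n (f o))).
    apply: (@int_phi _ _ pi) => //; first exact: measurable_smooth_step.
    by move=> o; exact: normr_smooth_step.
  rewrite -RintegralZl // -RintegralZl // -RintegralD //.
  - by apply: eq_Rintegral => o _; ring.
  - exact: (integrableZl measurableT (b' - a') i1).
  - exact: (integrableZl measurableT s^-1 i2).
move: key; rewrite lin // lin // mass => /addrI /mulfI; apply.
by rewrite invr_neq0 // gt_eqF.
Qed.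

Lemma fourier_itvoo (a b : R) : a < b ->
  (\int[P]_(o in f1 @^-1` `]a, b[%classic) (phi1 o)%:E =
   \int[P]_(o in f2 @^-1` `]a, b[%classic) (phi2 o)%:E)%E.
Proof.
move=> ab.
have cvgG (phi f : T -> R) : measurable_fun setT phi -> measurable_fun setT f ->
    (forall o, 0 <= phi o <= M) ->
    (\int[P]_o (phi o * smooth_step a b n (f o))%:E)%E @[n --> \oo] -->
    (pi%:E * \int[P]_(o in f @^-1` `]a, b[%classic) (phi o)%:E)%E.
  move=> mp mf pb.
  have -> : (pi%:E * \int[P]_(o in f @^-1` `]a, b[%classic) (phi o)%:E)%E =
      (\int[P]_o (phi o * (pi * \1_`]a, b[ (f o)))%:E)%E.
    rewrite integral_mkcond -ge0_integralZl //=.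
    - apply: eq_integral => o _; rewrite patchE indicE.
      have -> : (o \in f @^-1` `]a, b[%classic) = (f o \in `]a, b[%classic) by [].
      by case: ifPn => _; rewrite ?mulr1 ?mulr0 ?mule0 // -EFinM mulrC.
    - apply/(measurable_restrictT (EFin \o phi)).
        by rewrite -[X in measurable X]setTI; exact: mf.
      exact/measurable_funTS/measurable_EFinP.
    - move=> o _; rewrite patchE; case: ifPn => // _; rewrite lee_fin.
      by case/andP: (pb o).
    - by rewrite lee_fin pi_ge0.
  apply: (@dominated_cvg _ _ _ P _ measurableT _ _ (cst (M * pi)%:E)) => //.
  - move=> n; apply/measurable_EFinP; apply: measurable_funM => //.
    exact: measurable_smooth_step.
  - move=> o _; apply: cvg_EFin; first exact: nearW.
    by apply: cvgM; [exact: cvg_cst|exact: cvg_smooth_step].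
  - exact: finite_measure_integrable_cst.
  - move=> n o _; rewrite /= lee_fin normrM; have /andP[p0 pM] := pb o.
    by rewrite ger0_norm // ler_pM // normr_smooth_step.
have l1 := cvgG _ _ mphi1 mf1 phi10; have l2 := cvgG _ _ mphi2 mf2 phi20.
have E n : (\int[P]_o (phi1 o * smooth_step a b n (f1 o))%:E =
            \int[P]_o (phi2 o * smooth_step a b n (f2 o))%:E)%E.
  have h := congr1 EFin (@fourier_smooth_step a b n ab); move: h.
  rewrite /Rintegral !fineK //; apply: integrable_fin_num => //.
    apply: (@int_phi _ _ pi) => //; first exact: measurable_smooth_step.
    by move=> o; exact: normr_smooth_step.
  apply: (@int_phi _ _ pi) => //; first exact: measurable_smooth_step.
  by move=> o; exact: normr_smooth_step.
have : (pi%:E * \int[P]_(o in f1 @^-1` `]a, b[%classic) (phi1 o)%:E =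
        pi%:E * \int[P]_(o in f2 @^-1` `]a, b[%classic) (phi2 o)%:E)%E.
  move: l1; under eq_cvg do rewrite E; move=> l1.
  exact: cvg_unique l1 l2.
move=> /(congr1 (fun x => (pi^-1)%:E * x)%E); rewrite !muleA -!EFinM mulVf ?gt_eqF ?pi_gt0 //.
by rewrite !mul1e.
Qed.

(** The two finite image measures agree on open intervals, a pi-system that generates the Borel
    sets. *)
Theorem fourier_unique B : measurable B ->
  (\int[P]_(o in f1 @^-1` B) (phi1 o)%:E = \int[P]_(o in f2 @^-1` B) (phi2 o)%:E)%E.
Proof.
move=> mB.
have p10 o : 0 <= phi1 o by case/andP: (phi10 o).
have p20 o : 0 <= phi2 o by case/andP: (phi20 o).
have [nu1 nu1E] := weighted_pushforward mphi1 mf1 p10.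
have [nu2 nu2E] := weighted_pushforward mphi2 mf2 p20.
rewrite -nu1E -nu2E.
pose I (k : nat) : set R := `]- k%:R, k%:R[%classic.
have fin k : (nu1 (I k) < +oo)%E.
  have mk : measurable (f1 @^-1` I k).
    by rewrite -[X in measurable X]setTI; apply: mf1 => //; exact: measurable_itv.
  rewrite nu1E; apply: (@le_lt_trans _ _ (\int[P]_(o in f1 @^-1` I k) (cst M%:E) o)%E).
    apply: ge0_le_integral => //.
    - by move=> o _; rewrite lee_fin.
    - exact/measurable_EFinP/measurable_funTS.
    - by move=> o _; rewrite lee_fin; case/andP: (phi10 o).
  rewrite integral_cst //; apply: lte_mul_pinfty => //.
    rewrite lee_fin; have [t _] : [set: T] !=set0.
      apply/set0P/eqP => T0; have := probability_setT P.
      by rewrite T0 measure0 => /eqP; rewrite eq_sym onee_eq0.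
    by case/andP: (phi10 t) => p0 pM; exact: le_trans pM.
  by apply: le_lt_trans (probability_le1 _ mk) _; rewrite ltry.
apply: (@measure_unique _ R R (@RGenOpens.G R) I) => //.
- exact: RGenOpens.measurableE.
- move=> _ _ [a [b ->]] [a' [b' ->]].
  exists (Num.max a a'), (Num.min b b').
  apply/seteqP; split => x /=; rewrite !in_itv /= ?gt_max ?lt_min.
    by move=> [/andP[-> ->] /andP[-> ->]].
  by move=> /andP[/andP[-> ->] /andP[-> ->]].
- by move=> i; exists (- i%:R), i%:R.
- apply/seteqP; split => // x _; exists (Num.truncn `|x|).+1 => //=.
  by rewrite /I /= in_itv /= -ltr_norml truncnS_gt.
- move=> _ [a [b ->]].
  have [ab|ba] := ltP a b; first by rewrite nu1E nu2E fourier_itvoo.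
  by rewrite set_itv_ge ?bnd_simp -?leNgt // !measure0.
Qed.

End TwoWeights.

End FourierUniqueness.

(** * Gaussian integrals and independence *)

Section IndependenceExtension.
Context d (T : measurableType d) (R : realType) (P : probability T R).

(** As functions of [A], both sides are finite measures: the restriction of [P] to [C], and [c]
    times [P]. They agree on a generating pi-system. *)
Lemma indep_sigma (G : set (set T)) (C : set T) (c : R) :
  setI_closed G -> G setT -> G `<=` measurable -> measurable C -> 0 <= c ->
  (forall A, G A -> P (A `&` C) = P A * c%:E)%E ->
  forall A, <<s G >> A -> (P (A `&` C) = P A * c%:E)%E.
Proof.
move=> GI GT Gm mC c0 GC A sA.
pose m1 := mrestr P mC.
pose m2 := mscale (NngNum c0) P.
suff h : m1 A = m2 A by transitivity (m1 A) => //; rewrite h muleC.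
apply: (g_sigma_algebra_measure_unique G _ (fun=> setT)) => //.
- by rewrite bigcup_const.
- move=> A' GA'; transitivity (P (A' `&` C)); first by [].
  by rewrite GC // muleC.
- move=> k; apply: (@le_lt_trans _ _ 1%E); last exact: ltry.
  by apply: probability_le1; exact: measurableI.
Qed.

End IndependenceExtension.

Section Decoupling.
Context d (T : measurableType d) (R : realType) (P : probability T R).
Variables (G : set (set T)) (X : T -> R) (nu : probability R R).
Hypotheses (GI : setI_closed G) (GT : G setT) (Gm : G `<=` measurable).
Hypothesis mX : measurable_fun setT X.
Hypothesis ind : forall A B, G A -> measurable B ->
  (P (A `&` X @^-1` B) = P A * nu B)%E.

Local Notation TG := (g_sigma_algebraType G).

Lemma measurable_sub_sigma : <<s G >> `<=` @measurable _ T.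
Proof. by apply: smallest_sub => //; exact: sigma_algebra_measurable. Qed.

Lemma measurable_idG : measurable_fun setT (idfun : T -> TG).
Proof. by move=> _ A mA; rewrite setTI preimage_id; exact: measurable_sub_sigma. Qed.

Lemma measurable_fun_sub d' (T' : measurableType d') (f : TG -> T') :
  measurable_fun setT f -> measurable_fun setT (f : T -> T').
Proof. by move=> mf; exact: (measurableT_comp mf measurable_idG). Qed.

Let ind_sigma A B : <<s G >> A -> measurable B ->
  (P (A `&` X @^-1` B) = P A * nu B)%E.
Proof.
move=> sA mB.
have mXB : measurable (X @^-1` B) by rewrite -[X in measurable X]setTI; exact: mX.
have [r r0 rE] : exists2 r : R, 0 <= r & nu B = r%:E.
  by exists (fine (nu B)); rewrite ?fine_ge0 // fineK // fin_num_measure.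
rewrite rE; apply: (@indep_sigma _ _ _ _ G) => // A' GA'.
by rewrite ind // rE.
Qed.

(** The identity, read as a variable valued in the sigma-algebra generated by [G], and [X] have a
    product as joint law; Tonelli integrates [X] out while the past stays frozen. This takes the
    place of conditional expectations. *)
Lemma decouple (F : TG * R -> \bar R) : measurable_fun setT F ->
  (forall z, 0 <= F z)%E ->
  (\int[P]_o F (o, X o) = \int[P]_o \int[nu]_h F (o, h))%E.
Proof.
move=> mF F0.
pose mid := HB.pack (idfun : T -> TG) (isMeasurableFun.Build _ _ _ _ _ measurable_idG) : {mfun T >-> TG}.
pose P1 := distribution P mid.
have mj : measurable_fun setT (fun o : T => (o : TG, X o)).
  by apply: measurable_fun_pair => //; exact: measurable_idG.
pose jj := HB.pack (fun o : T => (o : TG, X o)) (isMeasurableFun.Build _ _ _ _ _ mj) : {mfun T >-> (TG * R)%type}.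
pose P2 := distribution P jj.
have E : forall Y : set (TG * R), measurable Y -> (P1 \x nu)%E Y = P2 Y.
  apply: product_measure_unique => A B mA mB.
  exact: (ind_sigma mA mB).
transitivity (\int[P2]_z F z)%E.
  by rewrite ge0_integral_distribution.
rewrite (eq_measure_integral (P1 \x nu)%E); last by move=> Y mY _; exact/esym/E.
rewrite fubini_tonelli1 // ge0_integral_distribution //.
  exact: measurable_fun_fubini_tonelli_F.
by move=> y; apply: integral_ge0.
Qed.

End Decoupling.

Section GaussianMeasure.
Variable R : realType.
Local Notation mu := (@lebesgue_measure R).

(** The density [normal_pdf] agrees almost everywhere with the Radon-Nikodym derivative, since both
    have the same integrals over measurable sets. *)
Lemma ge0_integral_normal_prob (m s : R) (h : R -> \bar R) :
  measurable_fun setT h -> (forall x, 0 <= h x)%E ->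
  (\int[normal_prob m s]_x h x = \int[mu]_x (h x * (normal_pdf m s x)%:E))%E.
Proof.
move=> mh h0.
have dom := normal_prob_dominates m s.
rewrite -(Radon_Nikodym_SigmaFinite.change_of_variables dom) //.
apply: ae_eq_integral => //.
- apply: emeasurable_funM => //.
  exact: measurable_int (Radon_Nikodym_SigmaFinite.f_integrable dom).
- apply: emeasurable_funM => //; apply/measurable_EFinP; exact: measurable_normal_pdf.
- apply: ae_eqe_mul2l; apply: integral_ae_eq => //.
  + exact: Radon_Nikodym_SigmaFinite.f_integrable.
  + by apply/measurable_EFinP; exact: measurable_normal_pdf.
  + by move=> A AE mA; rewrite -Radon_Nikodym_SigmaFinite.f_integral.
Qed.

Let idTR : measurableTypeR R -> R := idfun.

#[local] HB.instance Definition _ :=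
  @isMeasurableFun.Build _ _ _ _ idTR (@measurable_id _ _ setT).

(** [gauss_law] as a bundled probability; pushing forward along [idTR] moves the measure between the
    two measurable structures on the line. *)
Definition gprob (s : R) : probability R R :=
  if s == 0 then \d_(0 : R) : probability R R
  else distribution (normal_prob 0 (Num.sqrt s)) idTR.

Lemma gprobE s B : gprob s B = gauss_law s B.
Proof. by rewrite /gprob /gauss_law; case: ifP. Qed.

Lemma ge0_integral_gprob s (h : R -> \bar R) : s != 0 ->
  measurable_fun setT h -> (forall x, 0 <= h x)%E ->
  (\int[gprob s]_x h x = \int[mu]_x (h x * (normal_pdf 0 (Num.sqrt s) x)%:E))%E.
Proof.
move=> /negbTE s0 mh h0; rewrite /gprob s0 ge0_integral_distribution //.
exact: ge0_integral_normal_prob.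
Qed.

Lemma lebesgue_measureD (c : R) (A : set R) : measurable A ->
  pushforward mu ((fun x => x + c) : _ -> measurableTypeR R) A = mu A.
Proof.
have mc : measurable_fun setT ((fun x => x + c) : R -> measurableTypeR R).
  exact: measurable_funD.
move=> mA.
pose mf := HB.pack ((fun x => x + c) : R -> measurableTypeR R)
  (isMeasurableFun.Build _ _ _ _ _ mc) : {mfun R >-> measurableTypeR R}.
apply/esym; apply: (@lebesgue_measure_unique R (pushforward mu mf)) => //= _ [[a b]] _ <-.
rewrite /pushforward (_ : mf @^-1` _ = `](a - c), (b - c)]%classic); last first.
  by apply/seteqP; split => x /=; rewrite !in_itv /= ltrBlDr lerBrDr.
rewrite !lebesgue_measure_itv /= !lte_fin ltrD2r.
by case: ifP => // _; rewrite -!EFinB; congr EFin; ring.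
Qed.

Lemma ge0_integral_shift (c : R) (h : R -> \bar R) : measurable_fun setT h ->
  (forall x, 0 <= h x)%E -> (\int[mu]_x h ((x : R) + c)%R = \int[mu]_x h x)%E.
Proof.
move=> mh h0.
have mc : measurable_fun setT ((fun x => x + c) : R -> measurableTypeR R).
  exact: measurable_funD.
rewrite [RHS](eq_measure_integral (pushforward mu ((fun x => x + c) : R -> measurableTypeR R))).
  by rewrite ge0_integral_pushforward.
by move=> A mA _; exact/esym/lebesgue_measureD.
Qed.

Lemma ge0_integral_opp (h : R -> \bar R) : measurable_fun setT h ->
  (forall x, 0 <= h x)%E -> (\int[mu]_x h (- x)%R = \int[mu]_x h x)%E.
Proof.
move=> mh h0.
rewrite [RHS](eq_measure_integral (pushforward mu (-%R : R -> measurableTypeR R))).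
  by rewrite ge0_integral_pushforward.
by move=> A mA _; exact/esym/lebesgue_measureN.
Qed.

Lemma ge0_integral_gprob_opp s (h : R -> \bar R) : 0 <= s -> measurable_fun setT h ->
  (forall x, 0 <= h x)%E -> (\int[gprob s]_x h (- x)%R = \int[gprob s]_x h x)%E.
Proof.
move=> sge0 mh h0.
have mhN : measurable_fun setT (fun x : R => h (- x)%R) by apply: (measurableT_comp mh).
have [->|s0] := eqVneq s 0.
  rewrite /gprob eqxx.
  rewrite !integral_dirac //.
  by rewrite !diracT !mul1e oppr0.
rewrite !ge0_integral_gprob //.
rewrite -[RHS]ge0_integral_opp.
- apply: eq_integral => x _; congr (_ * _%:E)%E.
  rewrite !normal_pdfE ?sqrtr_eq0 -?ltNge ?lt_def ?s0 //.
  by rewrite /normal_fun !subr0 sqrrN.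
- apply: emeasurable_funM => //; apply/measurable_EFinP; exact: measurable_normal_pdf.
- by move=> x; rewrite mule_ge0 // lee_fin normal_pdf_ge0.
Qed.

(** The characteristic function of a centred normal of variance [s] at frequency 1, real by
    symmetry. It is handled through its value at 0, its bound by 1 and its multiplicativity in
    [s]. *)
Definition chi (s : R) : R := \int[gprob s]_x cos x.

Lemma integrable_cos_sub s (w : R) : (gprob s).-integrable setT (EFin \o (fun x => cos (x - w))).
Proof.
apply: (@bounded_integrable _ _ _ (gprob s) _ 1).
  by apply: measurableT_comp; [exact: measurable_cos|exact: measurable_funB].
by move=> x; rewrite ler_norml cos_geN1 cos_le1.
Qed.

(** By symmetry of the law the phases [w] and [- w] give the same mean, and the two cosines add up
    to [2 * cos x * cos w]. *)
Lemma integral_1Dcos (s w : R) : 0 <= s ->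
  (\int[gprob s]_x (1 + cos (x - w))%:E = (1 + chi s * cos w)%:E)%E.
Proof.
move=> s0.
have mc v : measurable_fun setT (fun x : R => (1 + cos (x - v))%:E).
  apply/measurable_EFinP/measurable_funD => //.
  by apply: measurableT_comp; [exact: measurable_cos|exact: measurable_funB].
have E v : (\int[gprob s]_x (1 + cos (x - v))%:E = (1 + \int[gprob s]_x cos (x - v))%:E)%E.
  rewrite (eq_integral (fun x : R => 1%:E + (cos (x - v))%:E)%E) //.
  rewrite integralD //; last 2 first.
  - exact: finite_measure_integrable_cst.
  - exact: integrable_cos_sub.
  have -> : (\int[gprob s]_x 1%:E = 1%:E)%E.
    by rewrite integral_cst //= (@probability_setT _ _ _ (gprob s)) mule1.
  rewrite EFinD; congr (_ + _)%E.
  by rewrite /Rintegral fineK //; apply: integrable_fin_num => //; exact: integrable_cos_sub.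
rewrite E; congr (1 + _)%:E.
have R1 : \int[gprob s]_x cos (x - - w) = \int[gprob s]_x cos (x - w).
  have h0 (x : R) : (0 <= (1 + cos (x - w))%:E)%E by rewrite lee_fin oneDcos_ge0.
  have := ge0_integral_gprob_opp s0 (mc w) h0; rewrite E.
  rewrite (eq_integral (fun x : R => (1 + cos (x - - w))%:E)); last first.
    by move=> x _; rewrite -cosN; congr (1 + cos _)%:E; ring.
  by rewrite E => -[] /addrI.
have D : \int[gprob s]_x cos (x - w) + \int[gprob s]_x cos (x - - w) = 2 * (chi s * cos w).
  rewrite -RintegralD //; last 2 first.
  - exact: integrable_cos_sub.
  - exact: integrable_cos_sub.
  have ic : (gprob s).-integrable setT (EFin \o (fun x : R => cos x)).
    by have := @integrable_cos_sub s 0; under eq_fun do rewrite subr0.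
  have -> : 2 * (chi s * cos w) = (2 * cos w) * chi s by ring.
  rewrite /chi -RintegralZl //.
  by apply: eq_Rintegral => x _; rewrite opprK cosB cosD; ring.
by move: D; rewrite R1; lra.
Qed.

End GaussianMeasure.

Section GaussianIntegrals.
Variable R : realType.
Local Notation mu := (@lebesgue_measure R).

Lemma normal_pdf_sqrt (m v x : R) : 0 < v ->
  normal_pdf m (Num.sqrt v) x =
  (Num.sqrt (2 * pi * v))^-1 * expR (- (x - m) ^+ 2 / (2 * v)).
Proof.
move=> v0; rewrite normal_pdfE ?gt_eqF ?sqrtr_gt0 //.
rewrite /normal_peak /normal_fun sqr_sqrtr ?ltW //.
by congr ((Num.sqrt _)^-1 * expR (_ / _)); rewrite -mulr_natl; ring.
Qed.

Lemma chi0 : chi (0 : R) = 1.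
Proof.
rewrite /chi /gprob eqxx /Rintegral integral_dirac //.
  by rewrite diracT mul1e /= cos0.
by apply/measurable_EFinP; exact: measurable_cos.
Qed.

Lemma normr_chi (s : R) : `|chi s| <= 1.
Proof.
have ic : (gprob s).-integrable setT (EFin \o (fun x : R => cos x)).
  by have := @integrable_cos_sub _ s 0; under eq_fun do rewrite subr0.
have ib : (gprob s).-integrable setT (EFin \o (fun x : R => 1)).
  exact: finite_measure_integrable_cst.
apply: le_trans (le_normr_Rintegral _ ic) _ => //.
apply: (@le_trans _ _ (\int[gprob s]_x 1)).
  apply: le_Rintegral => //.
    apply: (@bounded_integrable _ _ _ (gprob s) _ 1).
      by apply: measurableT_comp => //; exact: measurable_cos.
    by move=> x; rewrite normr_id ler_norml cos_geN1 cos_le1.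
  by move=> x _; rewrite ler_norml cos_geN1 cos_le1.
by rewrite Rintegral_cst //= (@probability_setT _ _ _ (gprob s)) mulr1.
Qed.

(** Completing the square: the joint density of two independent summands is the density of their sum
    [z] times the conditional density of [x] given [z]. *)
Lemma normal_pdf_convolution (s t x z : R) : 0 < s -> 0 < t ->
  normal_pdf 0 (Num.sqrt s) x * normal_pdf 0 (Num.sqrt t) (z - x) =
  normal_pdf 0 (Num.sqrt (s + t)) z *
  normal_pdf (s * z / (s + t)) (Num.sqrt (s * t / (s + t))) x.
Proof.
move=> s0 t0; have st0 : 0 < s + t by rewrite addr_gt0.
have r0 : 0 < s * t / (s + t) by rewrite divr_gt0 // mulr_gt0.
have p0 : 0 <= 2 * pi :> R by rewrite mulr_ge0 // pi_ge0.
rewrite !normal_pdf_sqrt // mulrACA -expRD [RHS]mulrACA -expRD -!invfM -!sqrtrM;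
  try by rewrite mulr_ge0 // ltW.
congr ((Num.sqrt _)^-1 * expR _); field; rewrite ?gt_eqF //=.
Qed.

(** The mean of [1 + cos] at a sum of two independent normals is a double integral. After a shift by
    [x] and Tonelli, the conditional density integrates to 1 and the density of the sum remains. *)
Lemma chiD (s t : R) : 0 <= s -> 0 <= t -> chi (s + t) = chi s * chi t.
Proof.
rewrite le_eqVlt => /predU1P[<-|s0]; first by rewrite add0r chi0 mul1r.
rewrite le_eqVlt => /predU1P[<-|t0]; first by rewrite addr0 chi0 mulr1.
have st0 : 0 < s + t by rewrite addr_gt0.
have mc : measurable_fun setT (fun x : R => (1 + cos x)%:E).
  by apply/measurable_EFinP/measurable_funD => //; exact: measurable_cos.
have mpdf (m v : R) : measurable_fun setT (fun x => (normal_pdf m v x)%:E).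
  by apply/measurable_EFinP; exact: measurable_normal_pdf.
have c1 u : 0 <= u -> (\int[gprob u]_x (1 + cos x)%:E = (1 + chi u)%:E)%E.
  move=> u0; have := @integral_1Dcos _ u 0 u0; rewrite cos0 mulr1.
  by under eq_integral do rewrite subr0.
have cx u (x : R) : 0 <= u -> (\int[gprob u]_y (1 + cos (x + y))%:E = (1 + chi u * cos x)%:E)%E.
  move=> u0; have := @integral_1Dcos _ u (- x) u0; rewrite cosN => <-.
  by apply: eq_integral => y _; rewrite opprK (addrC x).
suff : (1 + chi (s + t))%:E = (1 + chi s * chi t)%:E by move=> [] /addrI.
rewrite -c1 ?(ltW st0) //.
transitivity (\int[gprob s]_x (1 + chi t * cos x)%:E)%E; last first.
  have ch : 0 <= 1 - `|chi t| by rewrite subr_ge0 normr_chi.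
  rewrite (eq_integral (fun x : R => 1%:E + (chi t * cos x)%:E)%E) //.
  have ic : (gprob s).-integrable setT (EFin \o (fun x : R => cos x)).
    by have := @integrable_cos_sub _ s 0; under eq_fun do rewrite subr0.
  rewrite integralD //; last 2 first.
  - exact: finite_measure_integrable_cst.
  - exact: (integrableZl measurableT (chi t) ic).
  rewrite integral_cst //= (@probability_setT _ _ _ (gprob s)) mule1.
  have e a : (\int[gprob s]_x (a * cos x)%:E = (a * chi s)%:E)%E.
    rewrite /chi -RintegralZl // /Rintegral fineK //.
    by apply: integrable_fin_num => //; exact: (integrableZl measurableT a ic).
  rewrite (e (chi t)).
  rewrite -EFinD.
  by move: (chi s) (chi t) => a b; rewrite mulrC.
transitivity (\int[mu]_x \int[mu]_z
   ((1 + cos z)%:E * (normal_pdf 0 (Num.sqrt (s + t)) z *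
     normal_pdf (s * z / (s + t)) (Num.sqrt (s * t / (s + t))) x)%:E))%E; last first.
  rewrite ge0_integral_gprob ?gt_eqF //; last 2 first.
  - apply/measurable_EFinP/measurable_funD => //.
    by apply: measurable_funM => //; exact: measurable_cos.
  - move=> x; rewrite lee_fin; have := normr_chi t; have := cos_geN1 x; have := cos_le1 x.
    rewrite ler_norml; nra.
  apply: eq_integral => x _.
  have mg : measurable_fun setT (fun y : R => ((1 + cos (x + y)) * (normal_pdf 0 (Num.sqrt s) x * normal_pdf 0 (Num.sqrt t) y))%:E).
    apply/measurable_EFinP; apply: measurable_funM.
      apply: measurable_funD => //; apply: measurableT_comp; first exact: measurable_cos.
      exact: measurable_funD.
    by apply: measurable_funM => //; exact: measurable_normal_pdf.
  transitivity (\int[mu]_z ((1 + cos (x + ((z : R) - x))) * (normal_pdf 0 (Num.sqrt s) x * normal_pdf 0 (Num.sqrt t) ((z : R) - x)))%:E)%E.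
    apply: eq_integral => z _; rewrite -EFinM -normal_pdf_convolution //.
    by congr ((1 + cos _) * _)%:E; ring.
  rewrite (ge0_integral_shift (- x) mg); last first.
    by move=> y; rewrite lee_fin !mulr_ge0 ?oneDcos_ge0 ?normal_pdf_ge0.
  have mcx : measurable_fun setT (fun y : R => (1 + cos (x + y))%:E).
    apply/measurable_EFinP/measurable_funD => //.
    apply: measurableT_comp; first exact: measurable_cos.
    exact: measurable_funD.
  have h0 (y : R) : (0 <= (1 + cos (x + y))%:E)%E by rewrite lee_fin oneDcos_ge0.
  have t1 : t != 0 by rewrite gt_eqF.
  rewrite -(cx t x (ltW t0)) (ge0_integral_gprob t1 mcx h0).
  rewrite -ge0_integralZr //.
  - by apply: eq_integral => y _; rewrite -!EFinM; congr EFin; ring.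
  - by apply: emeasurable_funM; [exact: mcx|exact: mpdf].
  - by move=> y _; rewrite mule_ge0 // lee_fin normal_pdf_ge0.
  - by rewrite lee_fin normal_pdf_ge0.
pose g (z : R * R) := ((1 + cos z.2)%:E * (normal_pdf 0 (Num.sqrt (s + t)) z.2 *
     normal_pdf (s * z.2 / (s + t)) (Num.sqrt (s * t / (s + t))) z.1)%:E)%E.
have r0 : 0 < s * t / (s + t) by rewrite divr_gt0 // mulr_gt0.
rewrite (@fubini_tonelli _ _ _ _ R mu mu g).
- have st1 : s + t != 0 by rewrite gt_eqF.
  have h0 (x : R) : (0 <= (1 + cos x)%:E)%E by rewrite lee_fin oneDcos_ge0.
  rewrite (ge0_integral_gprob st1 mc h0).
  apply: eq_integral => z _; rewrite /g /=.
  under eq_integral do rewrite EFinM muleA.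
  rewrite ge0_integralZl //.
  + by rewrite integral_normal_pdf mule1.
  + exact: mpdf.
  + by move=> x _; rewrite lee_fin normal_pdf_ge0.
  + by rewrite mule_ge0 // lee_fin ?oneDcos_ge0 ?normal_pdf_ge0.
- apply/measurable_EFinP; apply: measurable_funM.
    apply: measurable_funD => //; apply: measurableT_comp => //; exact: measurable_cos.
  apply: measurable_funM.
    by apply: measurableT_comp => //; exact: measurable_normal_pdf.
  under eq_fun do rewrite normal_pdf_sqrt //.
  apply: measurable_funM => //; apply: measurableT_comp => //; apply: measurable_funM => //.
  apply: measurableT_comp => //; apply: measurable_funX; apply: measurable_funB => //.
  by apply: measurable_funM => //; apply: measurable_funM => //.
- by move=> z; rewrite mule_ge0 // lee_fin ?mulr_ge0 ?oneDcos_ge0 ?normal_pdf_ge0.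
Qed.

Lemma gprob1_exp_sqr (a : R) : a < 2^-1 ->
  (\int[gprob 1]_x (expR (a * x ^+ 2))%:E = ((Num.sqrt (1 - 2 * a))^-1)%:E)%E.
Proof.
move=> a2; have a0 : 0 < 1 - 2 * a by lra.
have mh : measurable_fun setT (fun x : R => (expR (a * x ^+ 2))%:E).
  by apply/measurable_EFinP; apply: measurableT_comp => //; apply: measurable_funM.
have h0 (x : R) : (0 <= (expR (a * x ^+ 2))%:E)%E by rewrite lee_fin expR_ge0.
rewrite (ge0_integral_gprob (oner_neq0 R) mh h0).
transitivity (\int[mu]_x (((Num.sqrt (1 - 2 * a))^-1)%:E *
   (normal_pdf 0 (Num.sqrt (1 - 2 * a)^-1) x)%:E))%E.
  apply: eq_integral => x _; rewrite -!EFinM !normal_pdf_sqrt ?invr_gt0 //; congr EFin.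
  rewrite mulr1 mulrCA -expRD [RHS]mulrA -invfM -sqrtrM ?(ltW a0) //.
  congr ((Num.sqrt _)^-1 * expR _); field; rewrite ?gt_eqF //.
rewrite ge0_integralZl //.
- by rewrite integral_normal_pdf mule1.
- by apply/measurable_EFinP; exact: measurable_normal_pdf.
- by move=> x _; rewrite lee_fin normal_pdf_ge0.
Qed.

(** The integrand times the standard density is [Num.sqrt (1 + q)] times the normal density of mean
    [b] and variance [1 + q]. The value does not see [b], which carries the past, and it matches the
    growth of the root of the determinant in a rank one update. *)
Lemma gprob1_self_normalized (q b : R) : 0 <= q ->
  (\int[gprob 1]_x (expR (x ^+ 2 / 2 - (x - b) ^+ 2 / (2 * (1 + q))))%:E =
   (Num.sqrt (1 + q))%:E)%E.
Proof.
move=> q0; have q1 : 0 < 1 + q by lra.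
have mh : measurable_fun setT (fun x : R =>
    (expR (x ^+ 2 / 2 - (x - b) ^+ 2 / (2 * (1 + q))))%:E).
  apply/measurable_EFinP; apply: measurableT_comp => //; apply: measurable_funB.
    by apply: measurable_funM.
  by apply: measurable_funM => //; apply: measurable_funX; exact: measurable_funB.
have h0 (x : R) : (0 <= (expR (x ^+ 2 / 2 - (x - b) ^+ 2 / (2 * (1 + q))))%:E)%E.
  by rewrite lee_fin expR_ge0.
rewrite (ge0_integral_gprob (oner_neq0 R) mh h0).
transitivity (\int[mu]_x ((Num.sqrt (1 + q))%:E *
   (normal_pdf b (Num.sqrt (1 + q)) x)%:E))%E.
  apply: eq_integral => x _; rewrite -!EFinM !normal_pdf_sqrt //; congr EFin.
  rewrite mulr1 mulrCA -expRD [RHS]mulrA.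
  have -> : Num.sqrt (1 + q) / Num.sqrt (2 * pi * (1 + q)) = (Num.sqrt (2 * pi))^-1.
    rewrite [Num.sqrt (2 * pi * _)]sqrtrM ?mulr_ge0 ?pi_ge0 //; field.
    by rewrite !gt_eqF // sqrtr_gt0 // mulr_gt0 // pi_gt0.
  congr (_ * expR _); field; rewrite ?gt_eqF //.
rewrite ge0_integralZl //.
- by rewrite integral_normal_pdf mule1.
- by apply/measurable_EFinP; exact: measurable_normal_pdf.
- by move=> x _; rewrite lee_fin normal_pdf_ge0.
Qed.

End GaussianIntegrals.

(** * Cosine transforms of random variables *)

Section BoundedExpectation.
Context d (T : measurableType d) (R : realType) (P : probability T R).

Definition bmfun (X : T -> R) :=
  measurable_fun setT X /\ exists M, forall o, `|X o| <= M.

Local Notation Ex X := (\int[P]_o X o).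

Lemma bm_integrable X : bmfun X -> P.-integrable setT (EFin \o X).
Proof. by move=> [mX [M XM]]; exact: bounded_integrable XM. Qed.

Lemma bm_cst c : bmfun (fun=> c).
Proof. by split => //; exists `|c|. Qed.

Lemma bmD X Y : bmfun X -> bmfun Y -> bmfun (fun o => X o + Y o).
Proof.
move=> [mX [M XM]] [mY [N YN]]; split; first exact: measurable_funD.
by exists (M + N) => o; apply: le_trans (ler_normD _ _) _; exact: lerD.
Qed.

Lemma bmM X Y : bmfun X -> bmfun Y -> bmfun (fun o => X o * Y o).
Proof.
move=> [mX [M XM]] [mY [N YN]]; split; first exact: measurable_funM.
by exists (M * N) => o; rewrite normrM ler_pM.
Qed.

Lemma bm_cos (X : T -> R) z : measurable_fun setT X -> bmfun (fun o => cos (X o - z)).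
Proof.
move=> mX; split.
  by apply: measurableT_comp; [exact: measurable_cos|exact: measurable_funB].
by exists 1 => o; rewrite ler_norml cos_geN1 cos_le1.
Qed.

Lemma bm_indic A : measurable A -> bmfun (\1_A : T -> R).
Proof.
move=> mA; split => //; exists 1 => o; rewrite indicE.
by case: (_ \in _); rewrite ?normr1 ?normr0.
Qed.

Lemma ExD X Y : bmfun X -> bmfun Y -> Ex (fun o => X o + Y o) = Ex X + Ex Y.
Proof. by move=> bX bY; rewrite RintegralD //; exact: bm_integrable. Qed.

Lemma ExZ c X : bmfun X -> Ex (fun o => c * X o) = c * Ex X.
Proof. by move=> bX; rewrite RintegralZl //; exact: bm_integrable. Qed.

Lemma Ex_EFin X : bmfun X -> (\int[P]_o (X o)%:E = (\int[P]_o X o)%:E)%E.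
Proof.
move=> bX; rewrite /Rintegral fineK //; apply: integrable_fin_num => //.
exact: bm_integrable.
Qed.

Lemma Ex_restrict A X : measurable A -> bmfun X ->
  (\int[P]_(o in A) (X o)%:E = (\int[P]_o (\1_A o * X o))%:E)%E.
Proof.
move=> mA bX; rewrite -Ex_EFin; last by apply: bmM => //; exact: bm_indic.
rewrite integral_mkcond; apply: eq_integral => o _.
by rewrite patchE indicE; case: ifP => _; rewrite ?mul1r ?mul0r.
Qed.

Lemma Ex_indic A : measurable A -> ((\int[P]_o (\1_A o : R))%:E = P A)%E.
Proof.
move=> mA; rewrite -Ex_EFin; last exact: bm_indic.
by rewrite integral_indic // setIT.
Qed.

Lemma Ex_cst c : Ex (fun=> c) = c.
Proof. by rewrite Rintegral_cst //= probability_setT mulr1. Qed.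

(** The phase [z] records the real and the imaginary part of the characteristic function at
    frequency 1. Other frequencies come from rescaling [X], which will be a linear form with free
    coefficients. *)
Definition cfun (X : T -> R) (s : R) :=
  forall z, \int[P]_o cos (X o - z) = chi s * cos z.

Lemma law_cfun (X : T -> R) (s : R) : measurable_fun setT X -> 0 <= s ->
  (forall B, measurable B -> P (X @^-1` B) = gprob s B) -> cfun X s.
Proof.
move=> mX s0 lX z; apply: (@addrI _ 1); apply: EFin_inj.
rewrite -integral_1Dcos // -{1}(Ex_cst 1) -ExD; [|exact: bm_cst|exact: bm_cos].
rewrite -Ex_EFin; last by apply: bmD; [exact: bm_cst|exact: bm_cos].
pose mfX := HB.pack X (isMeasurableFun.Build _ _ _ _ _ mX) : {mfun T >-> R}.
rewrite [RHS](eq_measure_integral (distribution P mfX)); last by move=> B mB _; exact/esym/lX.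
rewrite ge0_integral_distribution //.
  apply/measurable_EFinP/measurable_funD => //.
  by apply: measurableT_comp; [exact: measurable_cos|exact: measurable_funB].
Qed.

Lemma cfun_add (G : set (set T)) (X Y : T -> R) (s t : R) :
  setI_closed G -> G setT -> G `<=` measurable ->
  measurable_fun setT (X : g_sigma_algebraType G -> R) ->
  measurable_fun setT Y -> 0 <= s -> 0 <= t ->
  (forall A B, G A -> measurable B -> P (A `&` Y @^-1` B) = P A * gprob t B)%E ->
  cfun X s -> cfun (fun o => X o + Y o) (s + t).
Proof.
move=> GI GT Gm mXG mY s0 t0 ind cX z.
have mX : measurable_fun setT X by exact: measurable_fun_sub mXG.
apply: (@addrI _ 1); apply: EFin_inj.
rewrite -{1}(Ex_cst 1) -ExD; [|exact: bm_cst|by apply: bm_cos; exact: measurable_funD].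
rewrite -Ex_EFin; last by apply: bmD; [exact: bm_cst|by apply: bm_cos; exact: measurable_funD].
pose F (p : g_sigma_algebraType G * R) : \bar R := (1 + cos (X p.1 + p.2 - z))%:E.
have mF : measurable_fun setT F.
  apply/measurable_EFinP/measurable_funD => //.
  apply: measurableT_comp; first exact: measurable_cos.
  apply: measurable_funB => //; apply: measurable_funD => //.
  exact: (measurableT_comp mXG).
have F0 p : (0 <= F p)%E by rewrite lee_fin oneDcos_ge0.
have := decouple GI GT Gm mY ind mF F0; rewrite /F /= => ->.
rewrite (eq_integral (fun o => (1 + chi t * cos (X o - z))%:E)); last first.
  move=> o _; rewrite -[cos (X o - z)]cosN -integral_1Dcos //.
  by apply: eq_integral => h _; congr (1 + cos _)%:E; ring.
rewrite Ex_EFin; last first.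
  apply: bmD; first exact: bm_cst.
  by apply: bmM; [exact: bm_cst|exact: bm_cos].
rewrite ExD; last 2 first.
- exact: bm_cst.
- by apply: bmM; [exact: bm_cst|exact: bm_cos].
rewrite Ex_cst ExZ; last exact: bm_cos.
rewrite cX chiD //; move: (chi s) (chi t) => a b; congr (1 + _)%:E; ring.
Qed.

Lemma measurable_fun_sigmaS d' (T' : measurableType d') (G1 G2 : set (set T)) (f : T -> T') :
  G1 `<=` <<s G2 >> -> measurable_fun setT (f : g_sigma_algebraType G1 -> T') ->
  measurable_fun setT (f : g_sigma_algebraType G2 -> T').
Proof.
move=> G12 mf _ B mB; rewrite setTI.
have := mf measurableT B mB; rewrite setTI; apply: smallest_sub => //.
exact: smallest_sigma_algebra.
Qed.

End BoundedExpectation.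

(** * Independent families of events and Gaussian vectors *)

Section VecEvents.
Context d (T : measurableType d) (R : realType) (P : probability T R).

Definition mvec (G : set (set T)) n (X : T -> 'cV[R]_n) :=
  forall r, measurable_fun setT ((fun o => X o r 0) : g_sigma_algebraType G -> R).

Lemma mvec_mulmx G a b (M : 'M[R]_(a, b)) X : mvec G X -> mvec G (fun o => M *m X o).
Proof.
move=> mX r; under eq_fun do rewrite mxE.
by apply: measurable_sum => j; apply: measurable_funM => //; exact: mX.
Qed.

Lemma mvecD G n (X Y : T -> 'cV[R]_n) : mvec G X -> mvec G Y -> mvec G (fun o => X o + Y o).
Proof.
move=> mX mY r; under eq_fun do rewrite mxE.
by apply: measurable_funD; [exact: mX|exact: mY].
Qed.

Lemma mvecN G n (X : T -> 'cV[R]_n) : mvec G X -> mvec G (fun o => - X o).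
Proof.
move=> mX r; under eq_fun do rewrite mxE.
by apply: measurableT_comp => //; exact: mX.
Qed.

Lemma mvec_dotv G n u (X : T -> 'cV[R]_n) : mvec G X ->
  measurable_fun setT ((fun o => dotv u (X o)) : g_sigma_algebraType G -> R).
Proof.
move=> mX; under eq_fun do rewrite dotvE.
by apply: measurable_sum => j; apply: measurable_funM => //; exact: mX.
Qed.

Lemma mvecS (G1 G2 : set (set T)) n (X : T -> 'cV[R]_n) :
  G1 `<=` <<s G2 >> -> mvec G1 X -> mvec G2 X.
Proof. by move=> h mX r; exact: measurable_fun_sigmaS (mX r). Qed.

Section Vec.
Variables (n : nat) (X : T -> 'cV[R]_n).
Hypothesis mX : forall r, measurable_fun setT (fun o => X o r 0).

Lemma vec_events_setI : setI_closed (vec_events X).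
Proof.
move=> _ _ [B mB <-] [B' mB' <-]; exists (fun r => B r `&` B' r).
  by move=> r; apply: measurableI; [exact: mB|exact: mB'].
apply/seteqP; split => o /= h; first by split => r; case: (h r).
by case: h => h1 h2 r; split.
Qed.

Lemma vec_events_setT : vec_events X setT.
Proof. by exists (fun=> setT) => //; apply/seteqP; split. Qed.

Lemma vec_events_measurable : vec_events X `<=` measurable.
Proof.
move=> _ [B mB <-].
rewrite (_ : [set o | _] = \bigcap_(r in [set: 'I_n]) ((fun o => X o r 0) @^-1` B r)).
  apply: fin_bigcap_measurable => // r _; rewrite -[X in measurable X]setTI.
  exact: mX.
by apply/seteqP; split => o /= h r; [move=> _; exact: h|exact: h].
Qed.

Lemma mvec_vec_events : mvec (vec_events X) X.
Proof.
move=> r _ B mB; rewrite setTI; apply: sub_sigma_algebra.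
exists (fun r' => if r' == r then B else setT); first by move=> r'; case: ifP.
apply/seteqP; split => o /= h; first by have := h r; rewrite eqxx.
by move=> r'; case: eqP => [->|].
Qed.

End Vec.

Section Rectangles.
Variables (I : eqType) (E : I -> set (set T)).
Hypotheses (EI : forall i, setI_closed (E i)) (ET : forall i, E i setT).
Hypothesis Em : forall i, E i `<=` measurable.
Hypothesis ind : mutually_independent P E.

Definition rects (J : seq I) : set (set T) :=
  [set B | exists A : I -> set T, (forall i, E i (A i)) /\ B = [set o | forall i, i \in J -> A i o]].

Lemma rects_setI J : setI_closed (rects J).
Proof.
move=> _ _ [A [EA ->]] [A' [EA' ->]]; exists (fun i => A i `&` A' i); split.
  by move=> i; exact: EI.
apply/seteqP; split => o /= h; first by move=> i iJ; split; case: h => h1 h2; [exact: h1|exact: h2].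
by split => i iJ; case: (h i iJ).
Qed.

Lemma rects_setT J : rects J setT.
Proof. by exists (fun=> setT); split => //; apply/seteqP; split. Qed.

Lemma rects_measurable J : rects J `<=` measurable.
Proof.
move=> _ [A [EA ->]].
rewrite (_ : [set o | _] = \bigcap_(i in [set` J]) A i) //.
by apply: fin_bigcap_measurable => // i _; exact/Em/EA.
Qed.

Lemma sub_rects J J' : {subset J <= J'} -> rects J `<=` rects J'.
Proof.
move=> JJ' _ [A [EA ->]].
exists (fun i => if i \in J then A i else setT); split; first by move=> i; case: ifP.
apply/seteqP; split => o /= h i iJ; first by case: ifP => // /h.
by have := h i (JJ' _ iJ); rewrite iJ.
Qed.

Lemma events_rects J i : i \in J -> E i `<=` rects J.
Proof.
move=> iJ A EA; exists (fun j => if j == i then A else setT); split.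
  by move=> j; case: eqP => [->|].
apply/seteqP; split => o /= h; last by have := h i iJ; rewrite eqxx.
by move=> j _; case: eqP.
Qed.

Lemma rects_indep J i A B : uniq J -> i \notin J -> rects J A -> E i B ->
  (P (A `&` B) = P A * P B)%E.
Proof.
move=> uJ iJ [A' [EA ->]] EB.
pose A'' j := if j == i then B else A' j.
have EA'' j : E j (A'' j) by rewrite /A''; case: eqP => [->|].
have h1 := @ind (i :: J) A''; rewrite /= iJ uJ in h1.
have {h1} := h1 isT (fun j _ => EA'' j); rewrite big_cons {2}/A'' eqxx.
have E2 : forall j, j \in J -> A'' j = A' j.
  by move=> j jJ; rewrite /A''; case: eqP => // ji; rewrite -ji jJ in iJ.
rewrite (@eq_big_seq _ _ _ _ _ (fun j => P (A'' j)) (fun j => P (A' j))); last first.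
  by move=> j jJ /=; rewrite E2.
rewrite -(ind uJ (fun j _ => EA j)) => h.
rewrite muleC -h; congr (P _); apply/seteqP; split => o /=.
  move=> [h1 h2] j; rewrite inE => /orP[/eqP ->|jJ]; first by rewrite /A'' eqxx.
  by rewrite E2 //; exact: h1.
move=> h1; split; last by have := h1 i; rewrite mem_head /A'' eqxx; exact.
by move=> j jJ; rewrite -E2 //; apply: h1; rewrite inE jJ orbT.
Qed.

Lemma rects_indep_sigma J i A B : uniq J -> i \notin J -> rects J A -> <<s E i >> B ->
  (P (A `&` B) = P A * P B)%E.
Proof.
move=> uJ iJ rA sB; have mA := rects_measurable rA.
have [r r0 rE] : exists2 r : R, 0 <= r & P A = r%:E.
  by exists (fine (P A)); rewrite ?fine_ge0 // fineK // fin_num_measure.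
rewrite setIC muleC rE; apply: (@indep_sigma _ _ _ _ (E i)) => //.
  by move=> B' EB'; rewrite setIC (rects_indep uJ iJ rA EB') muleC rE.
Qed.

End Rectangles.

(** If the variance along [u] were negative, [Num.sqrt] would return 0, and [normal_pdf] with
    deviation 0 is by default the uniform density on the unit interval. Then [dotv u (X o)] and its
    opposite would both be positive almost surely. *)
Lemma gaussian_psd n (X : T -> 'cV[R]_n) S : gaussian_vec P X S -> forall u, 0 <= quadf S u.
Proof.
move=> [mX gX] u; rewrite leNgt; apply/negP => q0.
pose B := `]0, 1]%classic : set R.
have mB : measurable B by exact: measurable_itv.
have g1 : gauss_law (quadf S u) B = 1%E.
  rewrite /gauss_law lt_eqF // /normal_prob ltr0_sqrtr //.
  rewrite /normal_pdf eqxx integral_indic // (_ : _ `&` _ = B).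
    by rewrite /B /= lebesgue_measure_itv /= lte_fin ltr01 oppr0 adde0.
  apply/seteqP; split => [x [] //|x Bx]; split => //.
  by move: Bx; rewrite /B /= !in_itv /= => /andP[/ltW -> ->].
have h1 := gX u B mB; have h2 := gX (- u) B mB.
rewrite -scaleN1r quadfZv sqrrN expr1n mul1r g1 in h2; rewrite g1 in h1.
have m1 (w : 'cV[R]_n) : measurable ((fun o => (w^T *m X o) 0 0) @^-1` B).
  rewrite -[X in measurable X]setTI.
  have -> : (fun o => (w^T *m X o) 0 0) = (fun o => \sum_i w i 0 * X o i 0).
    by apply/funext => o; rewrite -dotvE.
  by apply: measurable_sum => // i; exact: measurable_funM.
set A1 := _ @^-1` B in h1; set A2 := _ @^-1` B in h2.
have d12 : A1 `&` A2 = set0.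
  apply/seteqP; split => // o [b1 b2].
  have {}b1 : B (dotv u (X o)) by exact: b1.
  have {}b2 : B (dotv (-1 *: u) (X o)) by exact: b2.
  move: b1 b2; rewrite dotvZl mulN1r /B /= !in_itv /= oppr_gt0.
  by move=> /andP[h _] /andP[h' _]; have := lt_trans h h'; rewrite ltxx.
have mA1 : measurable A1 by exact: m1.
have mA2 : measurable A2 by exact: m1.
have h : P (A1 `|` A2) = (P A1 + P A2)%E by rewrite measureU.
have : (P (A1 `|` A2) <= 1)%E by apply: probability_le1; exact: measurableU.
by rewrite h h1 h2 -EFinD lee_fin; lra.
Qed.

Lemma gaussian_law_dotv n (X : T -> 'cV[R]_n) S u B : gaussian_vec P X S -> measurable B ->
  (P ((fun o => dotv u (X o)) @^-1` B) = gprob (quadf S u) B)%E.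
Proof. by move=> [_ gX] mB; rewrite gprobE -gX. Qed.

End VecEvents.

(** * The innovations of the filter *)

Section RiccatiAlgebra.
Variables (R : realType) (n m : nat) (A : 'M[R]_n) (C : 'M[R]_(m, n)).
Variables (Q P : 'M[R]_n) (Rv : 'M[R]_m).
Hypotheses (hR : posdef Rv) (hP : posdef P).
Let K := kgain A C P Rv.
Let Rb := C *m P *m C^T + Rv.
Hypothesis hRic : P = (A - K *m C) *m P *m (A - K *m C)^T + Q + K *m Rv *m K^T.

Lemma innov_cov_posdef : posdef Rb.
Proof.
rewrite /Rb addrC; apply: posdefD => //; case: hP => sP _; split.
  by rewrite /symmx !trmx_mul trmxK sP mulmxA.
by move=> x; rewrite quadf_congr; case: (posdef_psd hP) => _; exact.
Qed.

Lemma kgain_innov_cov : K *m Rb = A *m P *m C^T.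
Proof. by rewrite /K /kgain mulmxKV //; apply: posdef_unit; exact: innov_cov_posdef. Qed.

Lemma innov_cov_trK : Rb *m K^T = C *m P *m A^T.
Proof.
have [sRb _] := innov_cov_posdef; have [sP _] := hP.
by apply: trmx_inj; rewrite trmx_mul trmxK sRb kgain_innov_cov !trmx_mul trmxK sP mulmxA.
Qed.

(** The three arguments on the left are the coefficients of the prediction error at [t], of [v t]
    and of [w t] when [c] is paired with the innovation at [t] and [a] with the error at [t.+1]. The
    choice of the gain cancels the cross terms and Riccati restores [P]: innovation and next error
    are uncorrelated. *)
Lemma innovation_variance_step (c : 'cV[R]_m) (a : 'cV[R]_n) :
  quadf P (C^T *m c + (A - K *m C)^T *m a) + quadf Rv (c - K^T *m a) + quadf Q a =
  quadf Rb c + quadf P a.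
Proof.
have [sP _] := hP; have [sR _] := hR.
rewrite [quadf P a]quadfE {2}hRic -quadfE !quadfD !quadf_congr.
rewrite quadf_addv // quadf_addv // -[- (K^T *m a)]scaleN1r quadfZv sqrrN expr1n mul1r.
rewrite -scalemxAr dotvZr.
have -> : dotv (C^T *m c) (P *m ((A - K *m C)^T *m a)) = dotv c (Rv *m (K^T *m a)).
  rewrite dotv_mulmxl trmxK; congr dotv; rewrite !mulmxA; congr (_ *m _).
  rewrite linearB /= mulmxBr trmx_mul mulmxA -innov_cov_trK /Rb -mulmxBl.
  by rewrite [_ + Rv]addrC addrK.
ring.
Qed.

(** The same identity solved for the variance along [u + K^T *m s], which is the shape of the blocks
    of the transposed Toeplitz matrix; the two values of [quadf P] are set up to telescope. *)
Lemma predicted_variance_step (u : 'cV[R]_m) (s : 'cV[R]_n) :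
  quadf Rb (u + K^T *m s) =
  quadf Rv u + quadf P (C^T *m u + A^T *m s) + quadf Q s - quadf P s.
Proof.
have [sRb _] := innov_cov_posdef; have [sP _] := hP.
have := innovation_variance_step (u + K^T *m s) s.
have -> : C^T *m (u + K^T *m s) + (A - K *m C)^T *m s = C^T *m u + A^T *m s.
  rewrite linearB /= [(K *m C)^T]trmx_mul mulmxDr mulmxBl !mulmxA addrA.
  by rewrite [LHS]addrAC addrK.
by rewrite addrK => h; apply: (@addIr _ (quadf P s)); rewrite -h; ring.
Qed.

End RiccatiAlgebra.

Section Innovations.
Context (R : realType) (dT : measure_display) (T : measurableType dT).
Variable Pr : probability T R.
Variables (n m : nat) (A : 'M[R]_n) (C : 'M[R]_(m, n)).
Variables (Q : 'M[R]_n) (Rv : 'M[R]_m) (P : 'M[R]_n).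
Variables (x0 : T -> 'cV[R]_n) (w : nat -> T -> 'cV[R]_n) (v : nat -> T -> 'cV[R]_m).
Hypothesis hx0 : gaussian_vec Pr x0 P.
Hypothesis hw : forall k, gaussian_vec Pr (w k) Q.
Hypothesis hv : forall k, gaussian_vec Pr (v k) Rv.
Let E := (fun i : option (nat + nat) => match i with
       | None => vec_events x0
       | Some (inl k) => vec_events (w k)
       | Some (inr k) => vec_events (v k) end).
Hypothesis hind : mutually_independent Pr E.
Hypotheses (hR : posdef Rv) (hP : posdef P).
Let K := kgain A C P Rv.
Hypothesis hRic : P = (A - K *m C) *m P *m (A - K *m C)^T + Q + K *m Rv *m K^T.
Let y := output A C x0 w v.
Let xh := xhat A C K y.
Let e := innov A C K y.
Let Rb := C *m P *m C^T + Rv.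
Let eps t o := state A x0 w t o - xh t o.

Lemma innov_eps t o : e t o = C *m eps t o + v t o.
Proof. by rewrite /e /innov /y /output /eps mulmxBr addrAC. Qed.

Lemma epsS t o : eps t.+1 o = (A - K *m C) *m eps t o + w t o - K *m v t o.
Proof.
have -> : eps t.+1 o = A *m state A x0 w t o + w t o - (A *m xh t o + K *m e t o) by [].
rewrite innov_eps mulmxDr (mulmxA K C) mulmxBl.
have -> : A *m eps t o = A *m state A x0 w t o - A *m xh t o by rewrite -mulmxBr.
move: (A *m state A x0 w t o) (A *m xh t o) (K *m C *m eps t o) (K *m v t o) => a b c1 c2.
by apply/matrixP => i j; rewrite !mxE; ring.
Qed.

Let EI i : setI_closed (E i).
Proof. by case: i => [[k|k]|]; exact: vec_events_setI. Qed.

Let ET i : E i setT.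
Proof. by case: i => [[k|k]|]; exact: vec_events_setT. Qed.

Let Em i : E i `<=` measurable.
Proof.
case: i => [[k|k]|]; apply: vec_events_measurable; [by case: (hw k)|by case: (hv k)|by case: hx0].
Qed.

(** The noises on which the prediction error at time [t] depends. At each time [v] is listed before
    [w] is added, so that every summand in [cfun_innov_eps] meets an index that is still fresh. *)
Fixpoint noise_idx (t : nat) : seq (option (nat + nat)) :=
  if t is t'.+1 then Some (inl t') :: Some (inr t') :: noise_idx t' else [:: None].

Lemma mem_noise_idx t : (forall s, (Some (inl s) \in noise_idx t) = (s < t)%N) /\
  (forall s, (Some (inr s) \in noise_idx t) = (s < t)%N).
Proof.
elim: t => [|t [IH1 IH2]]; first by split.
by split=> s; rewrite !inE ltnS leq_eqVlt ?IH1 ?IH2.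
Qed.

Lemma noise_idx_uniq t : uniq (noise_idx t).
Proof.
elim: t => // t IH /=; have [h1 h2] := mem_noise_idx t.
by rewrite inE h1 h2 ltnn IH.
Qed.

Lemma noise_idxS t : {subset noise_idx t <= noise_idx t.+1}.
Proof. by move=> i it; rewrite !inE it !orbT. Qed.

Let mvec_in J i (X : T -> 'cV[R]_n) : E i = vec_events X -> i \in J -> mvec (rects E J) X.
Proof.
move=> EX iJ; apply: (mvecS _ (@mvec_vec_events _ _ _ _ X)) => B BX.
by apply: sub_sigma_algebra; apply: (events_rects ET iJ); rewrite EX.
Qed.

Let mvec_in' J i (X : T -> 'cV[R]_m) : E i = vec_events X -> i \in J -> mvec (rects E J) X.
Proof.
move=> EX iJ; apply: (mvecS _ (@mvec_vec_events _ _ _ _ X)) => B BX.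
by apply: sub_sigma_algebra; apply: (events_rects ET iJ); rewrite EX.
Qed.

Let rectsS J J' : {subset J <= J'} -> rects E J `<=` <<s rects E J' >>.
Proof. by move=> JJ' B rB; apply: sub_sigma_algebra; exact: (sub_rects ET JJ'). Qed.

Lemma mvec_eps t : mvec (rects E (noise_idx t)) (eps t).
Proof.
elim: t => [|t IH].
  apply: (@mvec_in _ None); last by rewrite mem_head.
  by congr vec_events; apply/funext => o; rewrite /eps /= subr0.
have h : mvec (rects E (noise_idx t.+1)) (fun o => (A - K *m C) *m eps t o + w t o - K *m v t o).
  apply: mvecD; first apply: mvecD.
  - by apply: mvec_mulmx; apply: mvecS IH; apply: rectsS; exact: noise_idxS.
  - by apply: (@mvec_in _ (Some (inl t))); rewrite // mem_head.
  - apply: mvecN; apply: mvec_mulmx.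
    by apply: (@mvec_in' _ (Some (inr t))); rewrite // !inE eqxx orbT.
suff -> : eps t.+1 = (fun o => (A - K *m C) *m eps t o + w t o - K *m v t o) by [].
by apply/funext => o; rewrite epsS.
Qed.

Lemma mvec_innov s t : (s < t)%N -> mvec (rects E (noise_idx t)) (e s).
Proof.
move=> st; have : mvec (rects E (noise_idx s.+1)) (fun o => C *m eps s o + v s o).
  apply: mvecD.
    apply: mvec_mulmx; apply: (mvecS _ (@mvec_eps s)); apply: rectsS; exact: noise_idxS.
  by apply: (@mvec_in' _ (Some (inr s))); rewrite // !inE eqxx orbT.
rewrite (_ : (fun o => _) = e s); last by apply/funext => o; rewrite innov_eps.
apply: mvecS; apply: rectsS; elim: t st => // t IH; rewrite ltnS leq_eqVlt => /predU1P[->|st]; first by move=> i.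
by move=> i ii; apply: noise_idxS; exact: IH.
Qed.

Lemma measurable_innov s r : measurable_fun setT (fun o => e s o r 0).
Proof.
apply: (@measurable_fun_sub _ T (rects E (noise_idx s.+1))); last exact: mvec_innov.
exact: (rects_measurable Em).
Qed.

Let lf (c : nat -> 'cV[R]_m) t o := \sum_(s < t) dotv (c s) (e s o).
Let vr (c : nat -> 'cV[R]_m) t := \sum_(s < t) quadf Rb (c s).

Let vr_ge0 c t : 0 <= vr c t.
Proof.
by apply: sumr_ge0 => s _; case: (posdef_psd (innov_cov_posdef C hR hP)) => _; exact.
Qed.

(** The innovations alone satisfy no recursion. Carrying the current prediction error along closes
    the induction, because a form in the innovation at [t] and the error at [t.+1] is a form in the
    error at [t] and in the fresh noises [v t] and [w t]. *)
Lemma cfun_innov_eps t c a : cfun Pr (fun o => lf c t o + dotv a (eps t o)) (vr c t + quadf P a).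
Proof.
have mxe u (X : T -> 'cV[R]_n) S : gaussian_vec Pr X S -> measurable_fun setT (fun o => dotv u (X o)).
  move=> [mX _]; under eq_fun do rewrite dotvE.
  by apply: measurable_sum => j; apply: measurable_funM.
have mxe' u (X : T -> 'cV[R]_m) S : gaussian_vec Pr X S -> measurable_fun setT (fun o => dotv u (X o)).
  move=> [mX _]; under eq_fun do rewrite dotvE.
  by apply: measurable_sum => j; apply: measurable_funM.
have pP : forall x, 0 <= quadf P x by case: (posdef_psd hP).
have pR : forall x, 0 <= quadf Rv x by case: (posdef_psd hR).
elim: t c a => [|t IH] c a.
  rewrite (_ : (fun o => _) = (fun o => dotv a (x0 o))); last first.
    by apply/funext => o; rewrite /lf big_ord0 add0r /eps /= subr0.
  rewrite /vr big_ord0 add0r; apply: law_cfun => //; first exact: mxe hx0.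
  by move=> B mB; exact: gaussian_law_dotv.
pose a' := C^T *m c t + (A - K *m C)^T *m a.
pose u := c t - K^T *m a.
rewrite (_ : (fun o => _) = (fun o => (lf c t o + dotv a' (eps t o)) + dotv u (v t o) + dotv a (w t o))); last first.
  apply/funext => o; rewrite /lf big_ord_recr /= innov_eps epsS /a' /u.
  move: (eps t o) (v t o) (w t o) => g1 g2 g3.
  by rewrite !dotvDr !dotvDl !dotvNr !dotvNl !dotv_mulmxl !trmxK; ring.
rewrite (_ : vr c t.+1 + _ = vr c t + quadf P a' + quadf Rv u + quadf Q a); last first.
  rewrite /vr big_ord_recr /= -addrA -(innovation_variance_step hR hP hRic (c t) a) /a' /u.
  by rewrite !addrA.
have [n1 n2] := mem_noise_idx t.
have mlf : measurable_fun setT ((fun o => lf c t o + dotv a' (eps t o)) : g_sigma_algebraType (rects E (noise_idx t)) -> R).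
  apply: measurable_funD; last by apply: mvec_dotv; exact: mvec_eps.
  by apply: measurable_sum => s; apply: mvec_dotv; exact: mvec_innov.
have c1 : cfun Pr (fun o => (lf c t o + dotv a' (eps t o)) + dotv u (v t o)) (vr c t + quadf P a' + quadf Rv u).
  apply: (@cfun_add _ _ _ _ (rects E (noise_idx t))) => //.
  - exact: rects_setI.
  - exact: rects_setT.
  - exact: rects_measurable.
  - exact: mxe' (hv t).
  - by rewrite addr_ge0.
  - move=> B1 B2 rB1 mB2; rewrite -(gaussian_law_dotv u (hv t) mB2).
    apply: (@rects_indep_sigma _ _ _ _ _ E EI ET Em hind (noise_idx t) (Some (inr t))) => //.
    + exact: noise_idx_uniq.
    + by rewrite n2 ltnn.
    + have := mvec_dotv u (@mvec_vec_events _ _ _ _ (v t)) measurableT mB2.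
      by rewrite setTI.
apply: (@cfun_add _ _ _ _ (rects E (Some (inr t) :: noise_idx t))) => //.
- exact: rects_setI.
- exact: rects_setT.
- exact: rects_measurable.
- apply: measurable_funD.
    apply: (measurable_fun_sigmaS _ mlf); apply: rectsS => i it.
    by rewrite inE it orbT.
  by apply: mvec_dotv; apply: (@mvec_in' _ (Some (inr t))); rewrite // mem_head.
- exact: mxe (hw t).
- by rewrite !addr_ge0.
- exact: (gaussian_psd (hw t)).
- move=> B1 B2 rB1 mB2; rewrite -(gaussian_law_dotv a (hw t) mB2).
  apply: (@rects_indep_sigma _ _ _ _ _ E EI ET Em hind (Some (inr t) :: noise_idx t) (Some (inl t))) => //.
  + by rewrite /= n2 ltnn noise_idx_uniq.
  + by rewrite inE n1 ltnn.
  + have := mvec_dotv a (@mvec_vec_events _ _ _ _ (w t)) measurableT mB2.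
    by rewrite setTI.
Qed.

Lemma cfun_innov t (c : nat -> 'cV[R]_m) : cfun Pr (fun o => \sum_(s < t) dotv (c s) (e s o)) (\sum_(s < t) quadf Rb (c s)).
Proof.
have := @cfun_innov_eps t c 0; rewrite quadf0 addr0.
rewrite (_ : (fun o => _) = (fun o => \sum_(s < t) dotv (c s) (e s o))) //.
by apply/funext => o; rewrite dotv0l addr0.
Qed.

End Innovations.

(** * Independence of the innovations from their past *)

Section Past.
Context (R : realType) (dT : measure_display) (T : measurableType dT).
Variable Pr : probability T R.
Variables (m : nat) (e : nat -> T -> 'cV[R]_m) (Rb : 'M[R]_m).

(** Rectangles in single coordinates of the innovations before [t]: a pi-system whose members are
    built by imposing one scalar constraint at a time. *)
Definition past (t : nat) : set (set T) :=
  [set A | exists B : nat -> 'I_m -> set R, (forall s i, measurable (B s i)) /\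
     A = [set o | forall s i, (s < t)%N -> B s i (e s o i 0)]].

Definition linf (c : nat -> 'cV[R]_m) H o := \sum_(s < H) dotv (c s) (e s o).
Definition varf (c : nat -> 'cV[R]_m) H := \sum_(s < H) quadf Rb (c s).

Lemma past_setI t : setI_closed (past t).
Proof.
move=> _ _ [B [mB ->]] [B' [mB' ->]]; exists (fun s i => B s i `&` B' s i); split.
  by move=> s i; exact: measurableI.
apply/seteqP; split => o /= h; first by move=> s i st; case: h => h1 h2; split; [exact: h1|exact: h2].
by split => s i st; case: (h s i st).
Qed.

Lemma past_setT t : past t setT.
Proof. by exists (fun _ _ => setT); split => //; apply/seteqP; split. Qed.

Lemma sub_past t t' : (t <= t')%N -> past t `<=` past t'.
Proof.
move=> tt' _ [B [mB ->]].
exists (fun s i => if (s < t)%N then B s i else setT); split; first by move=> s i; case: ifP.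
apply/seteqP; split => o /= h s i st; first by case: ifP => // /h; exact.
by have := h s i (leq_trans st tt'); rewrite st.
Qed.

Lemma mvec_past s t : (s < t)%N -> mvec (past t) (e s).
Proof.
move=> st i _ B mB; rewrite setTI; apply: sub_sigma_algebra.
exists (fun s' i' => if (s' == s) && (i' == i) then B else setT); split.
  by move=> s' i'; case: ifP.
apply/seteqP; split => o /= h; last by have := h s i st; rewrite !eqxx.
by move=> s' i' _; case: ifP => // /andP[/eqP -> /eqP ->].
Qed.

Lemma measurable_past_linf c t H : (H <= t)%N ->
  measurable_fun setT (linf c H : g_sigma_algebraType (past t) -> R).
Proof.
move=> Ht; apply: measurable_sum => s; apply: mvec_dotv; apply: mvec_past.
exact: leq_trans (ltn_ord s) Ht.
Qed.

Hypothesis me : forall s i, measurable_fun setT (fun o => e s o i 0).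
Hypothesis pRb : forall x, 0 <= quadf Rb x.
Hypothesis hCF : forall H c, cfun Pr (linf c H) (varf c H).

Lemma measurable_linf c H : measurable_fun setT (linf c H).
Proof.
apply: measurable_sum => s; under eq_fun do rewrite dotvE.
by apply: measurable_sum => i; exact: measurable_funM.
Qed.

Lemma varf_ge0 c H : 0 <= varf c H.
Proof. exact: sumr_ge0. Qed.

Lemma linfD c g H o : linf (fun s => c s + g s) H o = linf c H o + linf g H o.
Proof. by rewrite -big_split; apply: eq_bigr => s _; rewrite dotvDl. Qed.

Lemma linfZ a c H o : linf (fun s => a *: c s) H o = a * linf c H o.
Proof. by rewrite mulr_sumr; apply: eq_bigr => s _; rewrite dotvZl. Qed.

Lemma varfZ a c H : varf (fun s => a *: c s) H = a ^+ 2 * varf c H.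
Proof. by rewrite mulr_sumr; apply: eq_bigr => s _; rewrite quadfZv. Qed.

Lemma varfD_disjoint t c g H : (forall s, (s < t)%N -> c s = 0) ->
  (forall s, (t <= s)%N -> g s = 0) ->
  varf (fun s => c s + g s) H = varf c H + varf g H.
Proof.
move=> c0 g0; rewrite -big_split; apply: eq_bigr => s _ /=.
by case: (ltnP s t) => st; [rewrite c0|rewrite g0]; rewrite // ?add0r ?addr0 quadf0 ?add0r ?addr0.
Qed.

Local Notation Ex X := (\int[Pr]_o X o).

Section Decoupled.
Variables (t H : nat).
Hypothesis tH : (t <= H)%N.

(** Restricted to [A], a form supported from [t] on behaves like an independent normal. Quantifying
    over the past form [g] makes the property stable under cutting [A] by one more past
    coordinate. *)
Definition decoupled (A : set T) := measurable A /\
  forall c g z, (forall s, (s < t)%N -> c s = 0) -> (forall s, (t <= s)%N -> g s = 0) ->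
  Ex (fun o => \1_A o * cos (linf (fun s => c s + g s) H o - z)) =
  chi (varf c H) * Ex (fun o => \1_A o * cos (linf g H o - z)).

Lemma decoupled_setT : decoupled setT.
Proof.
split=> // c g z c0 g0.
have h X : Ex (fun o => \1_[set: T] o * X o) = Ex X.
  by apply: eq_Rintegral => o _; rewrite indicE in_setT mul1r.
rewrite !h hCF hCF (varfD_disjoint H c0 g0) chiD ?varf_ge0 //.
by move: (chi _) (chi _) => a b; rewrite mulrA.
Qed.

(** The nonnegative weights [phi1] and [phi2] have the same cosine transform along the coordinate
    [f], because a multiple of [f] can be absorbed into the past form [g]. Fourier uniqueness then
    equates their masses on the event that [f] lies in [B], and the common part coming from the 1
    cancels. *)
Lemma decoupled_setI A (B : set R) (s0 : nat) (i0 : 'I_m) : (s0 < t)%N -> measurable B ->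
  decoupled A -> decoupled (A `&` (fun o => e s0 o i0 0) @^-1` B).
Proof.
move=> s0t mB [mA hA].
pose f o := e s0 o i0 0.
have mf : measurable_fun setT f by exact: me.
have mfB : measurable (f @^-1` B) by rewrite -[X in measurable X]setTI; exact: mf.
split; first exact: measurableI.
move=> c g z c0 g0.
pose fc s : 'cV[R]_m := if s == s0 then delta_mx i0 0 else 0.
have fc0 s : (t <= s)%N -> fc s = 0.
  by rewrite /fc; case: eqP => // ->; rewrite leqNgt s0t.
have fE o : f o = linf fc H o.
  rewrite /linf (bigD1 (Ordinal (leq_trans s0t tH))) //= big1 ?addr0 => [|j].
    rewrite /fc eqxx dotvE (bigD1 i0) //= big1 ?addr0 => [|k ki]; rewrite !mxE ?eqxx ?mul1r //.
    by rewrite (negbTE ki) mul0r.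
  rewrite -val_eqE /= => /negbTE js; by rewrite /fc js dotv0l.
pose L := linf (fun s => c s + g s) H; pose G := linf g H.
pose k := chi (varf c H).
have k1 : `|k| <= 1 by exact: normr_chi.
have mL : measurable_fun setT L by exact: measurable_linf.
have mG : measurable_fun setT G by exact: measurable_linf.
have bA := bm_indic R mA.
pose phi1 o : R := \1_A o * (1 + cos (L o - z)).
pose phi2 o : R := \1_A o * (1 + k * cos (G o - z)).
have b1 : bmfun phi1.
  by apply: bmM => //; apply: bmD; [exact: bm_cst|exact: bm_cos].
have b2 : bmfun phi2.
  apply: bmM => //; apply: bmD; first exact: bm_cst.
  by apply: bmM; [exact: bm_cst|exact: bm_cos].
have phi1b o : 0 <= phi1 o <= 2.
  rewrite /phi1 indicE; have := cos_geN1 (L o - z); have := cos_le1 (L o - z).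
  by case: (_ \in _); rewrite ?mul1r ?mul0r; lra.
have phi2b o : 0 <= phi2 o <= 2.
  rewrite /phi2 indicE; have := cos_geN1 (G o - z); have := cos_le1 (G o - z).
  by move: k1; rewrite ler_norml; case: (_ \in _); rewrite ?mul1r ?mul0r; nra.
(* product-to-sum formulas reduce both transforms to the hypothesis on [A] *)
have expand (q : R) (X : T -> R) th y : measurable_fun setT X ->
   Ex (fun o => \1_A o * (1 + q * cos (X o - z)) * (1 + cos (th * f o - y))) =
   Ex (fun o => \1_A o) + q * Ex (fun o => \1_A o * cos (X o - z)) +
   Ex (fun o => \1_A o * cos (th * f o - y)) +
   q / 2 * Ex (fun o => \1_A o * cos (X o + th * f o - (z + y))) +
   q / 2 * Ex (fun o => \1_A o * cos (X o + (- th) * f o - (z - y))).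
  move=> mX.
  have bc (Y : T -> R) a : measurable_fun setT Y -> bmfun (fun o => \1_A o * cos (Y o - a)).
    by move=> mY; apply: bmM => //; exact: bm_cos.
  have mth a : measurable_fun setT (fun o => a * f o) by exact: measurable_funM.
  have mXth a : measurable_fun setT (fun o => X o + a * f o) by exact: measurable_funD.
  rewrite -!ExZ; try exact: bc.
  have bq a (Y : T -> R) : bmfun Y -> bmfun (fun o => a * Y o).
    by move=> bY; apply: bmM => //; exact: bm_cst.
  rewrite -!ExD //; try (by repeat (apply: bmD); rewrite //; try apply: bq; try exact: bc).
  apply: eq_Rintegral => o _.
  have -> : cos (X o + th * f o - (z + y)) = cos ((X o - z) + (th * f o - y)) by congr cos; ring.
  have -> : cos (X o + - th * f o - (z - y)) = cos ((X o - z) - (th * f o - y)) by congr cos; ring.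
  by move: (X o - z) (th * f o - y) => a b; rewrite cosD cosB; field.
have fourier th y :
  (\int[Pr]_o (phi1 o * (1 + cos (th * f o - y)))%:E =
   \int[Pr]_o (phi2 o * (1 + cos (th * f o - y)))%:E)%E.
  have bth : bmfun (fun o => 1 + cos (th * f o - y)).
    by apply: bmD; [exact: bm_cst|apply: bm_cos; exact: measurable_funM].
  rewrite !Ex_EFin; try exact: bmM.
  congr EFin.
  have -> : Ex (fun o => phi1 o * (1 + cos (th * f o - y))) =
            Ex (fun o => \1_A o * (1 + 1 * cos (L o - z)) * (1 + cos (th * f o - y))).
    by apply: eq_Rintegral => o _; rewrite mul1r.
  rewrite (expand 1 L) // (expand k G) //.
  have hL th' z' : Ex (fun o => \1_A o * cos (L o + th' * f o - z')) =
      k * Ex (fun o => \1_A o * cos (G o + th' * f o - z')).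
    have gg0 s : (t <= s)%N -> g s + th' *: fc s = 0.
      by move=> ts; rewrite g0 // fc0 // scaler0 addr0.
    have := hA c (fun s => g s + th' *: fc s) z' c0 gg0.
    have E1 : (fun o => \1_A o * cos (linf (fun s => c s + (g s + th' *: fc s)) H o - z')) =
        (fun o => \1_A o * cos (L o + th' * f o - z')).
      by apply/funext => o; rewrite !linfD linfZ /L linfD fE addrA.
    have E2 : (fun o => \1_A o * cos (linf (fun s => g s + th' *: fc s) H o - z')) =
        (fun o => \1_A o * cos (G o + th' * f o - z')).
      by apply/funext => o; rewrite linfD linfZ fE.
    by rewrite E1 E2.
  rewrite !hL -/k (hA c g z c0 g0) -/k -/G.
  by field.
have := fourier_unique b1.1 mf b2.1 mf phi1b phi2b fourier mB.
rewrite !Ex_restrict // => -[].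
have E1 : (fun o => \1_(f @^-1` B) o * phi1 o) =
   (fun o => \1_(A `&` f @^-1` B) o + \1_(A `&` f @^-1` B) o * cos (L o - z)).
  by apply/funext => o; rewrite /phi1 indicI /=; ring.
have E2 : (fun o => \1_(f @^-1` B) o * phi2 o) =
   (fun o => \1_(A `&` f @^-1` B) o + k * (\1_(A `&` f @^-1` B) o * cos (G o - z))).
  by apply/funext => o; rewrite /phi2 indicI /=; ring.
have bI : bmfun (\1_(A `&` f @^-1` B) : T -> R) by apply: bm_indic; exact: measurableI.
have bIG : bmfun (fun o => \1_(A `&` f @^-1` B) o * cos (G o - z)).
  by apply: bmM => //; exact: bm_cos.
have bIL : bmfun (fun o => \1_(A `&` f @^-1` B) o * cos (L o - z)).
  by apply: bmM => //; exact: bm_cos.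
rewrite E1 E2 ExD // ExD //; last by apply: bmM => //; exact: bm_cst.
by rewrite ExZ // => /addrI.
Qed.

Lemma past_decoupled A : past t A -> decoupled A.
Proof.
move=> [B [mB ->]].
(* The constraints are imposed along a list, which permits induction; those at times from [t] on are
   void. *)
pose AL (l : seq (nat * 'I_m)) := [set o | forall q, q \in l -> (q.1 < t)%N -> B q.1 q.2 (e q.1 o q.2 0)].
have h l : decoupled (AL l).
  elim: l => [|[s i] l IH].
    by rewrite (_ : AL [::] = setT); [exact: decoupled_setT|apply/seteqP; split].
  have [st|st] := ltnP s t.
    rewrite (_ : AL _ = AL l `&` (fun o => e s o i 0) @^-1` B s i); first exact: decoupled_setI.
    apply/seteqP; split => o /= h.
      split; last by apply: (h (s, i)); rewrite ?mem_head.
      by move=> q ql; apply: h; rewrite inE ql orbT.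
    by case: h => h1 h2 q; rewrite inE => /orP[/eqP -> //|]; exact: h1.
  rewrite (_ : AL _ = AL l) //; apply/seteqP; split => o /= h.
    by move=> q ql; apply: h; rewrite inE ql orbT.
  by move=> q; rewrite inE => /orP[/eqP -> /=|]; [rewrite ltnNge st|exact: h].
rewrite (_ : [set o | _] = AL [seq (s, i) | s <- iota 0 t, i <- enum 'I_m]) //.
apply/seteqP; split => o /= ho; first by move=> [s i] /= _; exact: ho.
move=> s i st; apply: (ho (s, i)) => //; apply/allpairsP; exists (s, i) => /=; split => //.
  by rewrite mem_iota.
by rewrite mem_enum.
Qed.

End Decoupled.

Variable X0 : T -> R.
Hypothesis mX0 : measurable_fun setT X0.
Hypothesis cX0 : forall th, cfun Pr (fun o => th * X0 o) (th ^+ 2).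
Hypothesis lX0 : forall B, measurable B -> Pr (X0 @^-1` B) = gprob 1 B.

(** Fourier uniqueness compares the weight [\1_A] carried by [linf c H] with the constant weight
    [Pr A] carried by the standard normal [X0]; the decoupling of [A] makes their transforms
    agree. *)
Theorem past_independence t H A c B : (t <= H)%N -> past t A ->
  (forall s, (s < t)%N -> c s = 0) -> varf c H = 1 -> measurable B ->
  (Pr (A `&` linf c H @^-1` B) = Pr A * gprob 1 B)%E.
Proof.
move=> tH pA c0 vc mB.
have [mA dA] := past_decoupled tH pA.
pose a := fine (Pr A).
have aE : Pr A = a%:E by rewrite /a fineK // fin_num_measure.
have a0 : 0 <= a by rewrite /a fine_ge0.
have a1 : a <= 1 by rewrite -lee_fin -aE probability_le1.
have mL := measurable_linf c H.
have bA := bm_indic R mA.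
have fourier th y :
  (\int[Pr]_o (\1_A o * (1 + cos (th * linf c H o - y)))%:E =
   \int[Pr]_o (a * (1 + cos (th * X0 o - y)))%:E)%E.
  have bX : bmfun (fun o => cos (th * X0 o - y)).
    by apply: bm_cos; exact: measurable_funM.
  have bL : bmfun (fun o => cos (th * linf c H o - y)).
    by apply: bm_cos; exact: measurable_funM.
  rewrite !Ex_EFin; last 2 first.
  - by apply: bmM; [exact: bm_cst|apply: bmD => //; exact: bm_cst].
  - by apply: bmM => //; apply: bmD => //; exact: bm_cst.
  congr EFin.
  rewrite ExZ; last by apply: bmD => //; exact: bm_cst.
  rewrite [X in a * X]ExD //; last exact: bm_cst.
  rewrite Ex_cst cX0.
  have -> : Ex (fun o => \1_A o * (1 + cos (th * linf c H o - y))) =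
    Ex (fun o => \1_A o) + Ex (fun o => \1_A o * cos (th * linf c H o - y)).
    rewrite -ExD //; last exact: bmM.
    by apply: eq_Rintegral => o _; ring.
  have -> : Ex (fun o => \1_A o * cos (th * linf c H o - y)) = chi (th ^+ 2) * (cos y * a).
    have z0 s : (s < t)%N -> th *: c s = 0 by move=> st; rewrite c0 // scaler0.
    have := dA (fun s => th *: c s) (fun=> 0) y z0 (fun _ _ => erefl).
    rewrite varfZ vc mulr1.
    have -> : (fun o => \1_A o * cos (linf (fun s => th *: c s + 0) H o - y)) =
       (fun o => \1_A o * cos (th * linf c H o - y)).
      by apply/funext => o; rewrite linfD linfZ [linf (fun=> 0) H o]big1 ?addr0 // => s _; rewrite dotv0l.
    move=> ->; congr (_ * _).
    have -> : Ex (fun o => \1_A o * cos (linf (fun=> 0) H o - y)) = Ex (fun o => cos y * \1_A o).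
      apply: eq_Rintegral => o _; rewrite [linf (fun=> 0) H o]big1 ?sub0r ?cosN 1?mulrC // => s _.
      by rewrite dotv0l.
    by rewrite ExZ // /a -Ex_indic.
  have -> : Ex (fun o => \1_A o) = a by apply: EFin_inj; rewrite Ex_indic.
  by move: (chi _) => q; ring.
have ab (o : T) : 0 <= (\1_A o : R) <= 1.
  by rewrite indicE; case: (_ \in _); rewrite ?lexx ?ler01.
have a01 (o : T) : 0 <= a <= 1 by rewrite a0.
have ma : measurable_fun setT (fun _ : T => a) by [].
have := fourier_unique bA.1 mL ma mX0 ab a01 fourier mB.
have mLB : measurable (linf c H @^-1` B) by rewrite -[X in measurable X]setTI; exact: mL.
have mXB : measurable (X0 @^-1` B) by rewrite -[X in measurable X]setTI; exact: mX0.
have -> : (\int[Pr]_(o in X0 @^-1` B) a%:E = a%:E * gprob 1 B)%E.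
  by rewrite integral_cst //; congr (_ * _)%E; exact: lX0.
by rewrite integral_indic // aE => <-.
Qed.

End Past.

(** * Moments and self-normalized sums *)

Section MeasurableMatrix.
Context (R : realType) d (T : measurableType d).

Definition mmx a b (F : T -> 'M[R]_(a, b)) := forall i j, measurable_fun setT (fun o => F o i j).

Lemma mmxD a b (F G : T -> 'M[R]_(a, b)) : mmx F -> mmx G -> mmx (fun o => F o + G o).
Proof. by move=> mF mG i j; under eq_fun do rewrite mxE; exact: measurable_funD. Qed.

Lemma mmx_mul a b c (F : T -> 'M[R]_(a, b)) (G : T -> 'M[R]_(b, c)) :
  mmx F -> mmx G -> mmx (fun o => F o *m G o).
Proof.
move=> mF mG i j; under eq_fun do rewrite mxE.
by apply: measurable_sum => k; exact: measurable_funM.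
Qed.

Lemma mmx_tr a b (F : T -> 'M[R]_(a, b)) : mmx F -> mmx (fun o => (F o)^T).
Proof. by move=> mF i j; under eq_fun do rewrite mxE; exact: mF. Qed.

Lemma mmx_cst a b (F : 'M[R]_(a, b)) : mmx (fun=> F).
Proof. by move=> i j. Qed.

Lemma mmx_sum (I : Type) (r : seq I) a b (F : I -> T -> 'M[R]_(a, b)) :
  (forall i, mmx (F i)) -> mmx (fun o => \sum_(i <- r) F i o).
Proof.
move=> mF i j; under eq_fun do rewrite summxE.
by apply: measurable_sum => k; exact: mF.
Qed.

Lemma mmxZ a b (f : T -> R) (F : T -> 'M[R]_(a, b)) : measurable_fun setT f ->
  mmx F -> mmx (fun o => f o *: F o).
Proof. by move=> mf mF i j; under eq_fun do rewrite mxE; exact: measurable_funM. Qed.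

Lemma measurable_det a (F : T -> 'M[R]_a) : mmx F -> measurable_fun setT (fun o => \det (F o)).
Proof.
move=> mF; apply: measurable_sum => s; apply: measurable_funM => //.
by apply: measurable_prod => i _; exact: mF.
Qed.

(** By the cofactor formula; the inverse of the determinant is measurable because inversion is
    continuous off 0. *)
Lemma mmx_invmx a (F : T -> 'M[R]_a) : mmx F -> (forall o, F o \in unitmx) ->
  mmx (fun o => invmx (F o)).
Proof.
move=> mF uF i j.
have -> : (fun o => invmx (F o) i j) = (fun o => (\det (F o))^-1 * cofactor (F o) j i).
  by apply/funext => o; rewrite /invmx uF !mxE.
apply: measurable_funM.
  apply: (@measurable_comp _ _ _ _ _ _ [set x : R | x != 0] (fun x => x^-1)) => //.
  - rewrite (_ : [set x : R | x != 0] = ~` [set 0]); first by apply: measurableC.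
    by apply/seteqP; split => x /= /eqP.
  - by move=> _ [t _ <-] /=; rewrite -unitfE -unitmxE.
  - apply: open_continuous_measurable_fun; last by move=> x; rewrite inE /= => x0; exact: inv_continuous.
    rewrite (_ : [set x : R | x != 0] = ~` [set 0]); first by apply: closed_openC; exact: closed_eq.
    by apply/seteqP; split => x /= /eqP.
  - exact: measurable_det.
apply: measurable_funM => //; apply: measurable_det => i' j'.
by under eq_fun do rewrite !mxE; exact: mF.
Qed.

Lemma measurable_dotv a (F G : T -> 'cV[R]_a) : mmx F -> mmx G ->
  measurable_fun setT (fun o => dotv (F o) (G o)).
Proof.
move=> mF mG; under eq_fun do rewrite dotvE.
by apply: measurable_sum => k; exact: measurable_funM.
Qed.

End MeasurableMatrix.

Section Markov.
Context (R : realType) d (T : measurableType d) (P : probability T R).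

Lemma markov_bound (X : T -> R) (C c : R) : measurable_fun setT X -> (forall o, 0 <= X o) ->
  (\int[P]_o (X o)%:E <= C%:E)%E -> 0 < c ->
  measurable [set o | c <= X o] /\ (P [set o | (c <= X o)%R] <= (C / c)%:E)%E.
Proof.
move=> mX X0 iX c0.
have mA : measurable [set o | c <= X o].
  rewrite (_ : [set o | _] = setT `&` X @^-1` `[c, +oo[%classic); first exact: mX.
  by apply/seteqP; split => o /=; rewrite in_itv /= andbT => //; case.
split=> //; rewrite mulrC EFinM lee_pdivlMl //; apply: le_trans iX.
rewrite -integral_cst // integral_mkcond; apply: ge0_le_integral => //.
- by move=> o _; rewrite patchE; case: ifP => // _; rewrite lee_fin ltW.
- by apply/(measurable_restrictT _ mA).
- exact/measurable_EFinP.
- move=> o _; rewrite patchE; case: ifPn => [|_]; last by rewrite lee_fin.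
  by rewrite inE /= lee_fin.
Qed.

End Markov.

Section SecondMomentConstant.
Variable R : realType.

(** The second moment of the standard normal. It stays symbolic: second moments are only compared
    with one another, for which finiteness and positivity suffice. *)
Definition gauss_m2 : R := \int[gprob 1]_x (x ^+ 2).

Lemma gauss_m2_fin : (\int[gprob (1 : R)]_x (x ^+ 2)%:E < +oo)%E.
Proof.
have a2 : 4^-1 < 2^-1 :> R by lra.
have := gprob1_exp_sqr a2 => h.
apply: (@le_lt_trans _ _ (\int[gprob 1]_x (4%:E * (expR (4^-1 * x ^+ 2))%:E))%E).
  apply: ge0_le_integral => //.
  - by move=> x _; rewrite lee_fin sqr_ge0.
  - by apply/measurable_EFinP; exact: measurable_funX.
  - apply: emeasurable_funM => //; apply/measurable_EFinP; apply: measurableT_comp => //.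
    exact: measurable_funM.
  - move=> x _; rewrite -EFinM lee_fin.
    have := expR_ge1Dx (4^-1 * x ^+ 2); lra.
rewrite ge0_integralZl //.
- by rewrite h -EFinM ltry.
- apply/measurable_EFinP; apply: measurableT_comp => //; exact: measurable_funM.
Qed.

Lemma gauss_m2E : (\int[gprob (1 : R)]_x (x ^+ 2)%:E = (gauss_m2)%:E)%E.
Proof.
rewrite /gauss_m2 /Rintegral fineK // ge0_fin_numE ?gauss_m2_fin //.
by apply: integral_ge0 => x _; rewrite lee_fin sqr_ge0.
Qed.

(** The tangent bound for [expR] gives [2 <= x ^+ 2 + 2 * expR (- x ^+ 2 / 2)]; integrating, the
    second moment is at least [2 - Num.sqrt 2]. *)
Lemma gauss_m2_gt0 : 0 < gauss_m2.
Proof.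
have a2 : - 2^-1 < 2^-1 :> R by lra.
have h := gprob1_exp_sqr a2.
have mexp : measurable_fun setT (fun x : R => (expR (- 2^-1 * x ^+ 2))%:E).
  by apply/measurable_EFinP; apply: measurableT_comp => //; exact: measurable_funM.
have : (2%:E <= gauss_m2%:E + (2 * (Num.sqrt (1 - 2 * - 2^-1))^-1)%:E)%E.
  rewrite EFinM -h -gauss_m2E -ge0_integralZl //.
  have n1 (x : R) : (0 <= (x ^+ 2)%:E)%E by rewrite lee_fin sqr_ge0.
  have n2 (x : R) : (0 <= 2%:E * (expR (- 2^-1 * x ^+ 2))%:E)%E.
    by rewrite mule_ge0 // lee_fin expR_ge0.
  have m1 : measurable_fun setT (fun x : R => (x ^+ 2)%:E).
    by apply/measurable_EFinP; exact: measurable_funX.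
  have m2 : measurable_fun setT (fun x : R => 2%:E * (expR (- 2^-1 * x ^+ 2))%:E)%E.
    exact: emeasurable_funM.
  rewrite -ge0_integralD //.
  have i2 : (\int[gprob (1 : R)]_x 2%:E = 2%:E)%E.
    by rewrite integral_cst //= (@probability_setT _ _ _ (gprob 1)) mule1.
  rewrite -[leLHS]i2.
  apply: ge0_le_integral => //.
  - exact: emeasurable_funD.
  - move=> x _; rewrite -EFinM -EFinD lee_fin.
    have := expR_ge1Dx (- 2^-1 * x ^+ 2); lra.
rewrite -EFinD lee_fin (_ : 1 - 2 * - 2^-1 = 2); last by field.
have s0 : 0 < Num.sqrt (2 : R) by rewrite sqrtr_gt0.
have ss : Num.sqrt (2 : R) ^+ 2 = 2 by rewrite sqr_sqrtr.
have -> : 2 * (Num.sqrt (2 : R))^-1 = Num.sqrt 2.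
  by rewrite -{1}ss expr2 mulfK // gt_eqF.
have : Num.sqrt (2 : R) < 2 by nra.
lra.
Qed.

End SecondMomentConstant.

Lemma ln_sqrtr (R : realType) (x : R) : 0 < x -> ln x = 2 * ln (Num.sqrt x).
Proof.
by move=> x0; rewrite -{1}(sqr_sqrtr (ltW x0)) lnXn ?sqrtr_gt0 // [RHS]mulr_natl.
Qed.

(** * Second moments and the method of mixtures *)

Section WhiteInnovations.
Context (R : realType) (dT : measure_display) (T : measurableType dT).
Variable Pr : probability T R.
Variables (m : nat) (e : nat -> T -> 'cV[R]_m) (Rb : 'M[R]_m).
Hypothesis me : forall s i, measurable_fun setT (fun o => e s o i 0).
Hypothesis pRb : posdef Rb.
Hypothesis white : forall t H A c B, (t <= H)%N -> past e t A ->
  (forall s, (s < t)%N -> c s = 0) -> varf Rb c H = 1 -> measurable B ->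
  (Pr (A `&` linf e c H @^-1` B) = Pr A * gprob 1 B)%E.

Local Notation linf := (linf e).
Local Notation varf := (varf Rb).
Local Notation past := (past e).
Local Notation TG t := (g_sigma_algebraType (past t)).

Lemma past_measurable t : past t `<=` measurable.
Proof.
move=> _ [B [mB ->]].
have -> : [set o | forall s i, (s < t)%N -> B s i (e s o i 0)] =
  \bigcap_(s in [set k | (k < t)%N]) \bigcap_(i in [set: 'I_m]) ((fun o => e s o i 0) @^-1` B s i).
  apply/seteqP; split => o /= h; first by move=> s st i _; exact: h.
  by move=> s i st; exact: h.
apply: fin_bigcap_measurable; first by exact: finite_II.
move=> s _; apply: fin_bigcap_measurable => // i _.
by rewrite -[X in measurable X]setTI; exact: me.
Qed.

Lemma white_decouple t H c (F : TG t * R -> \bar R) : (t <= H)%N ->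
  (forall s, (s < t)%N -> c s = 0) -> varf c H = 1 ->
  measurable_fun setT F -> (forall z, 0 <= F z)%E ->
  (\int[Pr]_o F (o, linf c H o) = \int[Pr]_o \int[gprob 1]_h F (o, h))%E.
Proof.
move=> tH c0 vc mF F0; apply: decouple => //.
- exact: past_setI.
- exact: past_setT.
- exact: past_measurable.
- exact: measurable_linf.
- by move=> A B pA mB; exact: (white tH pA c0 vc mB).
Qed.

(** After division by its deviation the form is standard normal, by whiteness over the trivial past
    at time 0. A zero variance forces all coefficients to vanish. *)
Lemma linf_second_moment c H :
  (\int[Pr]_o (linf c H o ^+ 2)%:E = (gauss_m2 R * varf c H)%:E)%E.
Proof.
have pq x : 0 <= quadf Rb x by case: (posdef_psd pRb) => _; exact.
have v0 : 0 <= varf c H by exact: sumr_ge0.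
move: v0; rewrite le_eqVlt => /predU1P[v0|v0].
  have c0 (s : 'I_H) : c s = 0.
    apply/eqP; apply: contraT => cs.
    have : varf c H != 0.
      rewrite /varf (bigD1 s) //= gt_eqF // ltr_wpDr //; first exact: sumr_ge0.
      by case: pRb => _; apply.
    by rewrite -v0 eqxx.
  rewrite -v0 mulr0 integral0_eq // => o _.
  by rewrite /linf big1 ?expr0n // => s _; rewrite c0 dotv0l.
pose r := Num.sqrt (varf c H).
have r0 : 0 < r by rewrite sqrtr_gt0.
pose c' s := r^-1 *: c s.
have vc' : varf c' H = 1.
  by rewrite varfZ exprVn sqr_sqrtr ?(ltW v0) // mulVf // gt_eqF.
have E o : linf c H o = r * linf c' H o.
  by rewrite linfZ mulrA divff ?mul1r // gt_eqF.
pose F (z : TG 0 * R) : \bar R := ((r * z.2) ^+ 2)%:E.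
have mF : measurable_fun setT F.
  apply/measurable_EFinP; apply: measurable_funX; apply: measurable_funM => //.
have F0 z : (0 <= F z)%E by rewrite lee_fin sqr_ge0.
under eq_integral do rewrite E.
have := @white_decouple 0 H c' F (leq0n _) (fun s => ltac:(by [])) vc' mF F0.
rewrite /F /= => ->.
have -> : (\int[gprob 1]_h ((r * h) ^+ 2)%:E = (gauss_m2 R * varf c H)%:E)%E.
  under eq_integral do rewrite exprMn EFinM.
  rewrite ge0_integralZl //.
  - by rewrite gauss_m2E -EFinM sqr_sqrtr ?(ltW v0) // mulrC.
  - by apply/measurable_EFinP; exact: measurable_funX.
  - by move=> x _; rewrite lee_fin sqr_ge0.
  - by rewrite lee_fin sqr_ge0.
by rewrite integral_cst //= probability_setT mule1.
Qed.

Section SelfNormalized.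
Variables (d q : nat) (tau : R) (z : nat -> T -> 'cV[R]_d) (zeta : 'cV[R]_m).
Hypothesis tau0 : 0 < tau.
Hypothesis mz : forall j, mvec (past (j + q)) (z j).
Hypothesis zeta1 : quadf Rb zeta = 1.

Definition gramV J o : 'M[R]_d := tau%:M + \sum_(j < J) z j o *m (z j o)^T.
Definition crossS J o : 'cV[R]_d := \sum_(j < J) dotv zeta (e (j + q) o) *: z j o.

Lemma gramV_posdef J o : posdef (gramV J o).
Proof. by apply: posdefD; [exact: posdef_scalar|apply: psd_sum => j; exact: psd_mulT]. Qed.

Let mmz j J : (j <= J)%N -> @mmx R _ (TG (J + q)) _ _ (z j).
Proof.
move=> jJ r c; rewrite ord1; apply: (measurable_fun_sigmaS _ (@mz j r)) => A pA.
by apply: sub_sigma_algebra; apply: sub_past pA; rewrite leq_add2r.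
Qed.

Let mmV J : @mmx R _ (TG (J + q)) _ _ (gramV J).
Proof.
apply: mmxD; first exact: mmx_cst.
apply: mmx_sum => j; apply: mmx_mul; first by apply: mmz; exact: ltnW.
by apply: mmx_tr; apply: mmz; exact: ltnW.
Qed.

Let mmS J : @mmx R _ (TG (J + q)) _ _ (crossS J).
Proof.
apply: mmx_sum => j; apply: mmxZ; last by apply: mmz; exact: ltnW.
by apply: mvec_dotv; apply: mvec_past; rewrite ltn_add2r.
Qed.

Definition quadS J o := dotv (crossS J o) (invmx (gramV J o) *m crossS J o).
(** Up to the factor [Num.sqrt (tau ^+ d)], this is the average of the exponential martingales
    attached to all directions [x], with [x] drawn from a centred normal of covariance the inverse
    of [tau%:M]. *)
Definition mixture J o := expR (quadS J o / 2) / Num.sqrt (\det (gramV J o)).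

Let mmIV J : @mmx R _ (TG (J + q)) _ _ (fun o => invmx (gramV J o)).
Proof. by apply: mmx_invmx; [exact: mmV|move=> o; apply: posdef_unit; exact: gramV_posdef]. Qed.

Let mquadS J : measurable_fun setT (quadS J : TG (J + q) -> R).
Proof. by apply: measurable_dotv; [exact: mmS|apply: mmx_mul; [exact: mmIV|exact: mmS]]. Qed.

Let minvsqrtdet J : measurable_fun setT ((fun o => (Num.sqrt (\det (gramV J o)))^-1) : TG (J + q) -> R).
Proof.
have -> : (fun o => (Num.sqrt (\det (gramV J o)))^-1) =
   (fun o => expR (- 2^-1 * ln (\det (gramV J o)))).
  apply/funext => o; have d0 := posdef_det_gt0 (gramV_posdef J o).
  have s0 : 0 < Num.sqrt (\det (gramV J o)) by rewrite sqrtr_gt0.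
  apply: (@mulfI _ (Num.sqrt (\det (gramV J o)))); first by rewrite gt_eqF.
  rewrite mulfV ?gt_eqF ?sqrtr_gt0 //.
  rewrite -{1}(lnK (_ : Num.sqrt (\det (gramV J o)) \is Num.pos)) ?posrE ?sqrtr_gt0 //.
  rewrite -expRD.
  rewrite [ln (\det _)]ln_sqrtr //.
  by rewrite (_ : _ + _ = 0) ?expR0 //; field.
apply: measurableT_comp => //; apply: measurable_funM => //.
by apply: measurableT_comp; [exact: measurable_ln|apply: measurable_det; exact: mmV].
Qed.

Let mmix J : measurable_fun setT (mixture J : TG (J + q) -> R).
Proof.
apply: measurable_funM; last exact: minvsqrtdet.
by apply: measurableT_comp => //; apply: measurable_funM => //; exact: mquadS.
Qed.

(** By the rank one formulas, a step multiplies the mixture by [Num.sqrt (w o)] and by an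
    exponential of the new innovation. With the past frozen that exponential integrates to the
    inverse of [Num.sqrt (w o)]. *)
Lemma mixture_integral J : (\int[Pr]_o (mixture J o)%:E = ((Num.sqrt (tau ^+ d))^-1)%:E)%E.
Proof.
elim: J => [|J IH].
  have -> : (fun o => (mixture 0 o)%:E) = cst ((Num.sqrt (tau ^+ d))^-1)%:E.
    apply/funext => o; rewrite /mixture /quadS /crossS /gramV !big_ord0 dotv0l mul0r expR0.
    by rewrite addr0 det_scalar mul1r.
  by rewrite integral_cst //= probability_setT mule1.
pose t := (J + q)%N.
(* A single coefficient at time [t = J + q], the first time outside the past that measures [z J]. *)
pose c s : 'cV[R]_m := if s == t then zeta else 0.
have c0 s : (s < t)%N -> c s = 0 by rewrite /c ltn_neqAle => /andP[/negbTE ->].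
have vc : varf c t.+1 = 1.
  rewrite /varf big_ord_recr /= big1 => [|s _]; first by rewrite add0r /c eqxx zeta1.
  by rewrite c0 // quadf0.
have lc o : linf c t.+1 o = dotv zeta (e t o).
  rewrite /linf big_ord_recr /= big1 => [|s _]; first by rewrite add0r /c eqxx.
  by rewrite c0 // dotv0l.
pose u o := dotv (z J o) (invmx (gramV J o) *m z J o).
pose b o := dotv (z J o) (invmx (gramV J o) *m crossS J o).
have mu : measurable_fun setT (u : TG t -> R).
  by apply: measurable_dotv; [exact: mmz|apply: mmx_mul; [exact: mmIV|exact: mmz]].
have mb : measurable_fun setT (b : TG t -> R).
  by apply: measurable_dotv; [exact: mmz|apply: mmx_mul; [exact: mmIV|exact: mmS]].
have u0 o : 0 <= u o.
  have [L uL LE] := Cholesky (gramV_posdef J o).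
  by rewrite /u LE dotv_inv_Cholesky // dotv_ge0.
pose w o := (1 + u o)^-1.
have w0 o : 0 < w o by rewrite invr_gt0 ltr_pwDl.
have mw : measurable_fun setT (w : TG t -> R).
  have -> : (w : TG t -> R) = (fun o => expR (- ln (1 + u o))).
    by apply/funext => o; rewrite expRN lnK // posrE ltr_pwDl.
  apply: measurableT_comp => //; apply: measurableT_comp => //.
  by apply: measurableT_comp; [exact: measurable_ln|exact: measurable_funD].
have msw : measurable_fun setT ((fun o => Num.sqrt (w o)) : TG t -> R).
  apply: measurableT_comp; last exact: mw.
  by apply: continuous_measurable_fun; exact: sqrt_continuous.
pose F (p : TG t * R) : \bar R := (mixture J p.1 * Num.sqrt (w p.1) *
   expR (p.2 ^+ 2 / 2 - (p.2 - b p.1) ^+ 2 / (2 * (1 + u p.1))))%:E.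
have mix0 j o : 0 <= mixture j o by rewrite divr_ge0 ?expR_ge0 ?sqrtr_ge0.
have F0 p : (0 <= F p)%E by rewrite lee_fin !mulr_ge0 ?expR_ge0 ?sqrtr_ge0.
have mF : measurable_fun setT F.
  apply/measurable_EFinP; apply: measurable_funM.
    apply: measurable_funM; first exact: (measurableT_comp (@mmix J)).
    exact: (measurableT_comp msw).
  apply: measurableT_comp => //; apply: measurable_funB.
    by apply: measurable_funM => //; apply: measurable_funX.
  have -> : (fun p : TG t * R => (p.2 - b p.1) ^+ 2 / (2 * (1 + u p.1))) =
    (fun p => (p.2 - b p.1) ^+ 2 * (2^-1 * w p.1)).
    by apply/funext => p; rewrite /w invfM.
  apply: measurable_funM.
    by apply: measurable_funX; apply: measurable_funB => //; exact: (measurableT_comp mb).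
  by apply: measurable_funM => //; exact: (measurableT_comp mw).
have step o : mixture J.+1 o = mixture J o * Num.sqrt (w o) *
   expR (dotv zeta (e t o) ^+ 2 / 2 - (dotv zeta (e t o) - b o) ^+ 2 / (2 * (1 + u o))).
  rewrite /mixture /quadS.
  have -> : crossS J.+1 o = crossS J o + dotv zeta (e t o) *: z J o by rewrite /crossS big_ord_recr.
  have -> : gramV J.+1 o = gramV J o + z J o *m (z J o)^T.
    by rewrite /gramV big_ord_recr /= addrA.
  rewrite quad_rank1; last exact: gramV_posdef.
  rewrite det_rank1; last by apply: posdef_unit; exact: gramV_posdef.
  rewrite -/(u o) -/(b o) sqrtrM ?(ltW (posdef_det_gt0 (gramV_posdef J o))) //.
  rewrite sqrtrV ?addr_ge0 //.
  have h0 : 0 < 1 + u o by rewrite ltr_pwDl.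
  have D0 := posdef_det_gt0 (gramV_posdef J o).
  set Q := dotv (crossS J o) _; set D := \det _ in D0 *.
  have -> : (Q + dotv zeta (e t o) ^+ 2 - (dotv zeta (e t o) - b o) ^+ 2 / (1 + u o)) / 2 =
    Q / 2 + (dotv zeta (e t o) ^+ 2 / 2 - (dotv zeta (e t o) - b o) ^+ 2 / (2 * (1 + u o))).
    by field; rewrite gt_eqF.
  rewrite expRD; field.
  by rewrite !gt_eqF // sqrtr_gt0.
have := @white_decouple t t.+1 c F (leqnSn _) c0 vc mF F0.
under eq_integral do rewrite lc.
rewrite /F /= => h.
under eq_integral do rewrite step.
rewrite h -IH; apply: eq_integral => o _.
under eq_integral do rewrite EFinM.
rewrite ge0_integralZl //.
- rewrite gprob1_self_normalized // -EFinM; congr EFin.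
  rewrite -mulrA -sqrtrM ?(ltW (w0 o)) // mulVf ?sqrtr1 ?mulr1 //.
  by rewrite gt_eqF // ltr_pwDl.
- apply/measurable_EFinP; apply: measurableT_comp => //; apply: measurable_funB.
    by apply: measurable_funM.
  by apply: measurable_funM => //; apply: measurable_funX; exact: measurable_funB.
- by rewrite lee_fin mulr_ge0 ?sqrtr_ge0.
Qed.

(** Markov for the mixture at the level [delta^-1] times its mean; taking logarithms gives the
    bound. *)
Lemma self_normalized_bound J (delta : R) : 0 < delta ->
  exists B : set T, [/\ measurable B, (Pr B <= delta%:E)%E &
   forall o, ~ B o -> quadS J o <= 2 * ln delta^-1 + ln (\det (gramV J o) / tau ^+ d)].
Proof.
move=> d0.
have st0 : 0 < Num.sqrt (tau ^+ d) by rewrite sqrtr_gt0 exprn_gt0.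
have mM : measurable_fun setT (mixture J : T -> R).
  exact: (measurable_fun_sub (@past_measurable _) (@mmix J)).
have M0 o : 0 <= mixture J o by rewrite divr_ge0 ?expR_ge0 ?sqrtr_ge0.
have c0 : 0 < delta^-1 / Num.sqrt (tau ^+ d) by rewrite divr_gt0 // invr_gt0.
have iM : (\int[Pr]_o (mixture J o)%:E <= ((Num.sqrt (tau ^+ d))^-1)%:E)%E.
  by rewrite mixture_integral.
have [mB pB] := markov_bound mM M0 iM c0.
exists [set o | delta^-1 / Num.sqrt (tau ^+ d) <= mixture J o]; split => //.
  apply: le_trans pB _; rewrite lee_fin invfM !invrK mulrC -mulrA divff ?mulr1 //.
  by rewrite gt_eqF.
move=> o /negP; rewrite -ltNge /mixture => h.
have D0 := posdef_det_gt0 (gramV_posdef J o).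
have sD0 : 0 < Num.sqrt (\det (gramV J o)) by rewrite sqrtr_gt0.
rewrite ltr_pdivrMr // in h.
have h2 : expR (quadS J o / 2) < delta^-1 * Num.sqrt (\det (gramV J o) / tau ^+ d).
  apply: lt_le_trans h _; rewrite sqrtrM ?(ltW D0) // sqrtrV ?exprn_ge0 ?(ltW tau0) //.
  by rewrite -mulrA [X in _ * X]mulrC.
have r0 : 0 < \det (gramV J o) / tau ^+ d by rewrite divr_gt0 // exprn_gt0.
have h3 : quadS J o / 2 < ln (delta^-1 * Num.sqrt (\det (gramV J o) / tau ^+ d)).
  by rewrite -ltr_expR lnK // posrE mulr_gt0 ?invr_gt0 // sqrtr_gt0.
rewrite lnM ?posrE ?invr_gt0 ?sqrtr_gt0 // in h3.
rewrite [ln (_ / _)]ln_sqrtr //; lra.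
Qed.

End SelfNormalized.

End WhiteInnovations.

(** * Chi-square concentration *)

(** Jensen, from the tangent to [expR] at the mean [y]. *)
Lemma expR_mean_le (R : realType) (p : nat) (x : 'I_p -> R) : (0 < p)%N ->
  expR ((\sum_i x i) / p%:R) <= (\sum_i expR (x i)) / p%:R.
Proof.
move=> p0; have pR : 0 < p%:R :> R by rewrite ltr0n.
set y := _ / _.
rewrite ler_pdivlMr //.
have h i : expR y * (1 + (x i - y)) <= expR (x i).
  have -> : expR (x i) = expR y * expR (x i - y) by rewrite -expRD addrC subrK.
  by rewrite ler_wpM2l ?expR_ge0 // expR_ge1Dx.
apply: le_trans (_ : \sum_i (expR y * (1 + (x i - y))) <= _); last exact: ler_sum.
rewrite -mulr_sumr big_split /= sumrB !sumr_const card_ord -mulr_natr.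
rewrite (_ : \sum_i x i = y * p%:R); last by rewrite /y divfK // gt_eqF.
by rewrite -[y *+ p]mulr_natr subrr addr0 mul1r.
Qed.

Section ChiSquare.
Context (R : realType) (dT : measure_display) (T : measurableType dT).
Variable Pr : probability T R.
Variables (m : nat) (e : nat -> T -> 'cV[R]_m) (Rb : 'M[R]_m).
Hypothesis me : forall s i, measurable_fun setT (fun o => e s o i 0).
Hypothesis pRb : posdef Rb.
Hypothesis white : forall t H A c B, (t <= H)%N -> past e t A ->
  (forall s, (s < t)%N -> c s = 0) -> varf Rb c H = 1 -> measurable B ->
  (Pr (A `&` linf e c H @^-1` B) = Pr A * gprob 1 B)%E.

Local Notation TG t := (g_sigma_algebraType (past e t)).

Variables (p : nat) (u : nat -> 'cV[R]_m).
Hypothesis p0 : (0 < p)%N.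
Hypothesis u1 : \sum_(i < p) quadf Rb (u i) = 1.

Definition window j o := \sum_(i < p) dotv (u i) (e (j + i)%N o).

Let cw j s : 'cV[R]_m := if (s < j)%N then 0 else u (s - j)%N.

Let window_linf j o : linf e (cw j) (j + p) o = window j o.
Proof.
rewrite /linf big_split_ord /= big1 ?add0r => [|s _]; last by rewrite /cw ltn_ord dotv0l.
by apply: eq_bigr => i _; rewrite /cw ltnNge leq_addr /= addKn.
Qed.

Let window_varf j : varf Rb (cw j) (j + p) = 1.
Proof.
rewrite /varf big_split_ord /= big1 ?add0r => [|s _]; last by rewrite /cw ltn_ord quadf0.
by rewrite -u1; apply: eq_bigr => i _; rewrite /cw ltnNge leq_addr /= addKn.
Qed.

Let measurable_window j J : (j + p <= J)%N -> measurable_fun setT (window j : TG J -> R).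
Proof.
move=> jJ; have := measurable_past_linf (cw j) jJ.
have -> : window j = linf e (cw j) (j + p) by apply/funext => o; rewrite window_linf.
exact.
Qed.

Section Exponential.
Variable a : R.
Hypothesis a2 : a < 2^-1.
Let w := Num.sqrt (1 - 2 * a).
Let w0 : 0 < w. Proof. by rewrite sqrtr_gt0; have := a2; lra. Qed.

(** Windows whose starting times share a residue modulo [p] do not overlap, so each new factor is
    independent of the earlier ones; [w] normalizes it to mean 1. *)
Let prodr r J o := \prod_(j < J) (if (j %% p == r)%N then w * expR (a * window j o ^+ 2) else 1).

Let prodr_ge0 r J o : 0 <= prodr r J o.
Proof. by apply: prodr_ge0 => j _; case: ifP => // _; rewrite mulr_ge0 ?expR_ge0 // ltW. Qed.

Let measurable_prodr r J t : (forall j, (j < J)%N -> (j %% p == r)%N -> (j + p <= t)%N) ->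
  measurable_fun setT (prodr r J : TG t -> R).
Proof.
move=> h; apply: measurable_prod => j _; case jr: (j %% p == r)%N => //.
apply: measurable_funM => //; apply: measurableT_comp => //; apply: measurable_funM => //.
by apply: measurable_funX; apply: measurable_window; exact: h.
Qed.

Let prodr_integral r J : (\int[Pr]_o (prodr r J o)%:E = 1%:E)%E.
Proof.
elim: J => [|J IH].
  rewrite (_ : (fun o => _) = cst 1%:E); last by apply/funext => o; rewrite /prodr big_ord0.
  by rewrite integral_cst //= probability_setT mule1.
have [Jr|Jr] := boolP (J %% p == r)%N; last first.
  rewrite -IH; apply: eq_integral => o _.
  by rewrite /prodr big_ord_recr /= (negbTE Jr) mulr1.
(* Distinct times in one residue class differ by at least [p], so an earlier window has ended when
   the window at [J] starts. *)
have hJ j : (j < J)%N -> (j %% p == r)%N -> (j + p <= J)%N.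
  move=> jJ; rewrite -(eqP Jr) eq_sym (eqn_mod_dvd p (ltnW jJ)) => /dvdn_leq.
  by rewrite subn_gt0 => /(_ jJ); rewrite leq_subRL ?(ltnW jJ).
have mP := measurable_prodr hJ.
pose F (z : TG J * R) : \bar R := (prodr r J z.1 * (w * expR (a * z.2 ^+ 2)))%:E.
have F0 z : (0 <= F z)%E by rewrite lee_fin !mulr_ge0 ?expR_ge0 // ltW.
have mF : measurable_fun setT F.
  apply/measurable_EFinP; apply: measurable_funM; first exact: (measurableT_comp mP).
  apply: measurable_funM => //; apply: measurableT_comp => //; apply: measurable_funM => //.
  exact: measurable_funX.
have cw0 s : (s < J)%N -> cw J s = 0 by rewrite /cw => ->.
have := white_decouple me white (leq_addr p J) cw0 (window_varf J) mF F0.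
under eq_integral do rewrite window_linf.
rewrite /F /= => h.
rewrite (eq_integral (fun o => (prodr r J o * (w * expR (a * window J o ^+ 2)))%:E)); last first.
  by move=> o _; rewrite /prodr big_ord_recr /= Jr.
rewrite h -IH; apply: eq_integral => o _.
under eq_integral do rewrite EFinM EFinM.
rewrite ge0_integralZl //.
- rewrite ge0_integralZl //.
  + by rewrite gprob1_exp_sqr // -!EFinM mulfV ?mulr1 // gt_eqF.
  + by apply/measurable_EFinP; apply: measurableT_comp => //; exact: measurable_funM.
  + by rewrite lee_fin (ltW w0).
- apply: emeasurable_funM => //.
  by apply/measurable_EFinP; apply: measurableT_comp => //; exact: measurable_funM.
- by move=> x _; rewrite mule_ge0 // lee_fin ?expR_ge0 // (ltW w0).
- by rewrite lee_fin.
Qed.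

(** Markov controls the arithmetic mean of the [p] products and Jensen bounds their geometric mean
    by it. In the geometric mean every window occurs, at exponent [1 / p]; this is the origin of the
    factor [p] before [ln delta^-1]. *)
Lemma chi_square_bound N (delta : R) : 0 < delta ->
  exists B : set T, [/\ measurable B, (Pr B <= delta%:E)%E &
    forall o, ~ B o -> a * \sum_(j < N) window j o ^+ 2 + N%:R / 2 * ln (1 - 2 * a) <
                       p%:R * ln delta^-1].
Proof.
move=> d0; have pR : 0 < p%:R :> R by rewrite ltr0n.
pose X o : R := (\sum_(r < p) prodr r N o) / p%:R.
have mpr r : measurable_fun setT (prodr r N : T -> R).
  apply: (measurable_fun_sub (past_measurable me (t := N + p)) (@measurable_prodr r N (N + p) _)).
  by move=> j jN _; rewrite leq_add2r ltnW.
have mX : measurable_fun setT X.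
  by apply: measurable_funM => //; apply: measurable_sum => r; exact: mpr.
have X0 o : 0 <= X o by rewrite divr_ge0 ?ler0n // sumr_ge0.
have iX : (\int[Pr]_o (X o)%:E <= 1%:E)%E.
  under eq_integral do rewrite EFinM -sumEFin.
  rewrite ge0_integralZr //.
  - rewrite ge0_integral_sum //.
    + rewrite (eq_bigr (fun=> 1%:E)) => [|r _]; last exact: prodr_integral.
      by rewrite sumEFin sumr_const card_ord -EFinM mulfV ?gt_eqF.
    + by move=> r; apply/measurable_EFinP; exact: mpr.
    + by move=> r o _; exact: prodr_ge0.
  - suff -> : (fun x => (\sum_(i < p) (prodr i N x)%:E)%R) = EFin \o (fun x => \sum_(i < p) prodr i N x).
      by apply/measurable_EFinP; apply: measurable_sum => r; exact: mpr.
    by apply/funext => x /=; rewrite sumEFin.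
  - by move=> o _; rewrite sumEFin lee_fin; apply: sumr_ge0.
have di0 : 0 < delta^-1 by rewrite invr_gt0.
have [mB pB] := markov_bound mX X0 iX di0.
exists [set o | delta^-1 <= X o]; split => //.
  by apply: le_trans pB _; rewrite div1r invrK.
move=> o /negP; rewrite -ltNge => Xd.
pose yr (r : 'I_p) : R := \sum_(j < N) (if (j %% p == r)%N then ln w + a * window j o ^+ 2 else 0).
have prE (r : 'I_p) : prodr r N o = expR (yr r).
  rewrite /prodr /yr expR_sum; apply: eq_bigr => j _.
  by case: ifP => _; rewrite ?expR0 // expRD lnK.
have sy : \sum_r yr r = N%:R * ln w + a * \sum_(j < N) window j o ^+ 2.
  rewrite /yr exchange_big /= (eq_bigr (fun j : 'I_N => ln w + a * window j o ^+ 2)) => [|j _].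
    by rewrite big_split /= -mulr_sumr sumr_const card_ord mulr_natl.
  rewrite (bigD1 (Ordinal (ltn_pmod j p0))) //= eqxx big1 ?addr0 // => r.
  by rewrite -val_eqE /= eq_sym => /negbTE ->.
have := expR_mean_le yr p0.
rewrite -(eq_bigr _ (fun r _ => prE r)) -/(X o) => h.
have : expR ((\sum_i yr i) / p%:R) < delta^-1 by exact: le_lt_trans h Xd.
rewrite -[X in _ < X](lnK di0) ltr_expR ltr_pdivrMr // sy.
have -> : ln w = 2^-1 * ln (1 - 2 * a).
  by rewrite [ln (1 - _)]ln_sqrtr ?mulrA ?mulVf ?mul1r //; move: a2; lra.
rewrite mulrC; lra.
Qed.

End Exponential.

End ChiSquare.

(** * Windows of the output *)

Section Blocks.
Context (R : realType) (p : nat) (q : 'I_p -> nat).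

Lemma dotv_mxcol (u : 'cV[R]_(\sum_i q i)) (V : forall i, 'cV[R]_(q i)) :
  dotv u (\mxcol_i V i) = \sum_i dotv (submxcol u i) (V i).
Proof.
by rewrite -{1}(submxcolK u) /dotv tr_mxcol mul_mxrow_mxcol summxE.
Qed.

Lemma dotv_submxcol (u v : 'cV[R]_(\sum_i q i)) :
  dotv u v = \sum_i dotv (submxcol u i) (submxcol v i).
Proof. by rewrite -{1}(submxcolK v) dotv_mxcol. Qed.

Lemma quadf_mxdiag (D : forall i, 'M[R]_(q i)) (u : 'cV[R]_(\sum_i q i)) :
  quadf (\mxdiag_i D i) u = \sum_i quadf (D i) (submxcol u i).
Proof.
rewrite quadfE -{2}(submxcolK u) mul_mxdiag_mxcol dotv_mxcol.
by apply: eq_bigr => i _; rewrite quadfE.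
Qed.

End Blocks.

Section Windows.
Variables (R : realType) (n m p : nat) (A : 'M[R]_n) (C : 'M[R]_(m, n)) (K : 'M[R]_(n, m)).
Local Notation Tp := (toepmx A C p K).
Local Notation Op := (obsmx A C p).

Section Recursion.
Variables (x : nat -> 'cV[R]_n) (y e : nat -> 'cV[R]_m).
Hypothesis xS : forall s, x s.+1 = A *m x s + K *m e s.
Hypothesis yE : forall s, y s = C *m x s + e s.

Lemma state_unroll s i :
  x (s + i)%N = A ^+ i *m x s + \sum_(l < i) A ^+ (i - l - 1) *m K *m e (s + l)%N.
Proof.
elim: i => [|i IH]; first by rewrite addn0 big_ord0 addr0 expr0 mul1mx.
rewrite addnS xS IH big_ord_recr /= mulmxDr mulmxA exprS -mulmxE addrA; congr (_ + _ + _).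
  rewrite mulmx_sumr; apply: eq_bigr => l _.
  rewrite !mulmxA; congr (_ *m _ *m _); rewrite mulmxE -exprS; congr (_ ^+ _).
  by have := ltn_ord l; lia.
by rewrite subSn // subnn expr0 mul1mx.
Qed.

Lemma window_decomposition s :
  \mxcol_(i < p) y (s + i)%N = Op *m x s + Tp *m \mxcol_(i < p) e (s + i)%N.
Proof.
rewrite /obsmx /toepmx mxcol_mul mul_mxblock_mxrow -mxcolD; apply: eq_mxcol => i.
rewrite yE state_unroll mulmxDr mulmxA -addrA; congr (_ + _).
rewrite [RHS](bigID (fun j : 'I_p => (j < i)%N)) /=; congr (_ + _).
  rewrite mulmx_sumr (big_ord_narrow (ltnW (ltn_ord i))) /= .
  by apply: eq_bigr => l _; rewrite ltn_ord !mulmxA.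
rewrite (bigD1 i) /= ?ltnn // eqxx mul1mx big1 ?addr0 // => j /andP[ij ji].
by rewrite (negbTE ij) eq_sym (negbTE ji) mul0mx.
Qed.

End Recursion.

(** The adjoint of the state recursion, run backwards from 0 at the end of the window. It gives the
    blocks of the transposed Toeplitz matrix in closed form. *)
Definition costate (u : 'cV[R]_(\sum_(i < p) m)) (j : nat) : 'cV[R]_n :=
  \sum_(i < p | (j <= i)%N) (A ^+ (i - j))^T *m (C^T *m submxcol u i).

Lemma costate_end u : costate u p = 0.
Proof. by rewrite /costate big1 // => i; rewrite leqNgt ltn_ord. Qed.

Lemma costateS u (j : 'I_p) : costate u j = C^T *m submxcol u j + A^T *m costate u j.+1.
Proof.
rewrite /costate (bigD1 j) //= subnn expr0 trmx1 mul1mx; congr (_ + _).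
rewrite mulmx_sumr; apply: eq_big => i.
  by rewrite ltn_neqAle andbC [in RHS]eq_sym.
move=> /andP[ji ij]; rewrite !mulmxA; congr (_ *m _ *m _).
rewrite -trmx_mul mulmxE -exprSr; congr ((_ ^+ _)^T).
have : (nat_of_ord i != j)%N by [].
lia.
Qed.

Lemma toepmxT_block u (j : 'I_p) :
  submxcol (Tp^T *m u) j = submxcol u j + K^T *m costate u j.+1.
Proof.
rewrite -{1}(submxcolK u) /toepmx tr_mxblock mul_mxblock_mxrow mxcolK.
rewrite (bigID (fun i : 'I_p => (j < i)%N)) /= addrC; congr (_ + _).
  rewrite (bigD1 j) /= ?ltnn // eqxx trmx1 mul1mx big1 ?addr0 // => i /andP[ij ji].
  by rewrite (negbTE ij) (negbTE ji) trmx0 mul0mx.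
rewrite mulmx_sumr; apply: eq_bigr => i ji.
rewrite ji !trmx_mul !mulmxA; congr (_ *m _ *m _ *m _).
by rewrite -subnDA addn1.
Qed.

Lemma quadf_SigmaE Rb u :
  quadf (SigmaE A C p K Rb) u = \sum_(i < p) quadf Rb (submxcol (Tp^T *m u) i).
Proof. by rewrite /SigmaE quadf_congr quadf_mxdiag. Qed.

End Windows.

Section SigmaELowerBound.
Variables (R : realType) (n m p : nat) (A : 'M[R]_n) (C : 'M[R]_(m, n)).
Variables (Q P : 'M[R]_n) (Rv : 'M[R]_m).
Hypotheses (hR : posdef Rv) (hP : posdef P) (hQ : forall s, 0 <= quadf Q s).
Let K := kgain A C P Rv.
Let Rb := C *m P *m C^T + Rv.
Hypothesis hRic : P = (A - K *m C) *m P *m (A - K *m C)^T + Q + K *m Rv *m K^T.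

(* The Riccati equation makes [quadf P (costate u j)] telescope along the window. *)
Lemma SigmaE_ge_sigma_min u :
  sigma_min Rv * dotv u u <= quadf (SigmaE A C p K Rb) u.
Proof.
rewrite quadf_SigmaE dotv_submxcol mulr_sumr.
have st (i : 'I_p) : sigma_min Rv * dotv (submxcol u i) (submxcol u i) +
    (quadf P (costate A C u i) - quadf P (costate A C u i.+1)) <=
    quadf Rb (submxcol ((toepmx A C p K)^T *m u) i).
  rewrite toepmxT_block (predicted_variance_step hR hP hRic) -costateS.
  have := sigma_min_quadf (submxcol u i) (posdef_psd hR).
  have := hQ (costate A C u i.+1); lra.
apply: le_trans (ler_sum _ (fun i _ => st i)); rewrite big_split /= lerDl.
have := @telescope_sumr _ 0 p (fun j => - quadf P (costate A C u j)) (leq0n p).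
rewrite big_mkord => h.
rewrite (eq_bigr (fun i : 'I_p => - quadf P (costate A C u i.+1) - - quadf P (costate A C u i))).
  rewrite h costate_end quadf0 oppr0 add0r opprK.
  by case: (posdef_psd hP) => _; exact.
by move=> i _; rewrite opprK addrC.
Qed.

End SigmaELowerBound.

(** * Moving averages of the innovations and monotone second moments *)

Section LagForms.
Context (R : realType) (dT : measure_display) (T : measurableType dT).
Variable Pr : probability T R.
Variables (m : nat) (e : nat -> T -> 'cV[R]_m) (Rb : 'M[R]_m).
Hypothesis me : forall s i, measurable_fun setT (fun o => e s o i 0).
Hypothesis pRb : posdef Rb.
Hypothesis white : forall t H A c B, (t <= H)%N -> past e t A ->
  (forall s, (s < t)%N -> c s = 0) -> varf Rb c H = 1 -> measurable B ->
  (Pr (A `&` linf e c H @^-1` B) = Pr A * gprob 1 B)%E.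

(** From [t0] on the coefficients depend on the lag alone, lag 0 being the innovation at [t - 1],
    the last one in [past e t]. Raising [t] only adds terms, so second moments grow. The bound [t0]
    keeps clear of truncated subtraction in windows. *)
Definition lagform t0 (f : nat -> T -> R) :=
  exists c, forall t o, (t0 <= t)%N -> f t o = linf e (fun s => c (t - s.+1)%N) t o.

Lemma lagformD t0 f g : lagform t0 f -> lagform t0 g -> lagform t0 (fun t o => f t o + g t o).
Proof.
move=> [c hc] [c' hc']; exists (fun l => c l + c' l) => t o tt.
by rewrite hc // hc' // -linfD.
Qed.

Lemma lagform_sum t0 (I : Type) (r : seq I) (F : I -> nat -> T -> R) :
  (forall i, lagform t0 (F i)) -> lagform t0 (fun t o => \sum_(i <- r) F i t o).
Proof.
move=> h; elim: r => [|i r IH].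
  exists (fun=> 0) => t o _; rewrite big_nil /linf big1 // => s _; exact: dotv0l.
have [c hc] := lagformD (h i) IH.
by exists c => t o /hc; rewrite big_cons.
Qed.

Lemma lagformW t0 t1 f : (t0 <= t1)%N -> lagform t0 f -> lagform t1 f.
Proof. by move=> t01 [c hc]; exists c => t o /(leq_trans t01)/hc. Qed.

Lemma lagform_shift t0 d f : lagform t0 f -> lagform (t0 + d) (fun t => f (t - d)%N).
Proof.
move=> [c hc]; exists (fun l => if (l < d)%N then 0 else c (l - d)%N) => t o td.
rewrite hc; last by lia.
rewrite /linf; have -> : t = (t - d + d)%N by lia.
rewrite big_split_ord /= [X in _ + X]big1 ?addr0 => [|s _].
  rewrite addnK; apply: eq_bigr => s _; have sl := ltn_ord s.
  rewrite (_ : (_ < d)%N = false); last by lia.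
  by congr (dotv (c _) _); lia.
have sl := ltn_ord s; rewrite (_ : (_ < d)%N = true) ?dotv0l //; lia.
Qed.

Lemma lagform_measurable t0 f t : lagform t0 f -> (t0 <= t)%N ->
  measurable_fun setT (f t : g_sigma_algebraType (past e t) -> R).
Proof.
move=> [c hc] tt; rewrite (_ : f t = linf e (fun s => c (t - s.+1)%N) t); first exact: measurable_past_linf.
by apply/funext => o; exact: hc.
Qed.

Lemma lagform_second_moment t0 f : lagform t0 f ->
  exists2 V : nat -> R, {homo V : s t / (s <= t)%N >-> s <= t} &
    forall t, (t0 <= t)%N -> (\int[Pr]_o (f t o ^+ 2)%:E = (V t)%:E)%E.
Proof.
move=> [c hc]; exists (fun t => gauss_m2 R * \sum_(l < t) quadf Rb (c l)).
  move=> s t st; rewrite ler_pM2l ?gauss_m2_gt0 //.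
  rewrite -(subnKC st) big_split_ord /= lerDl; apply: sumr_ge0 => i _.
  by case: (posdef_psd pRb) => _; exact.
move=> t tt; rewrite (eq_integral (fun o => (linf e (fun s => c (t - s.+1)%N) t o ^+ 2)%:E)) => [|o _].
  rewrite (linf_second_moment me pRb white) /varf; congr (_ * _)%:E.
  by rewrite [LHS](reindex_inj rev_ord_inj) /=; apply: eq_bigr => s _; congr (quadf Rb (c _)); have := ltn_ord s; lia.
by rewrite hc.
Qed.

Definition lagvec t0 d (X : nat -> T -> 'cV[R]_d) := forall u, lagform t0 (fun t o => dotv u (X t o)).

Lemma dotv_delta d (x : 'cV[R]_d) i : dotv (delta_mx i 0) x = x i 0.
Proof.
rewrite dotvE (bigD1 i) //= big1 => [|j ji]; rewrite !mxE ?eqxx ?mul1r ?addr0 //.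
by rewrite (negbTE ji) mul0r.
Qed.

Lemma lagvec_mvec t0 d (X : nat -> T -> 'cV[R]_d) t : lagvec t0 X -> (t0 <= t)%N ->
  mvec (past e t) (X t).
Proof.
move=> hX tt i; have := lagform_measurable (hX (delta_mx i 0)) tt.
by apply: eq_measurable_fun => o _; rewrite dotv_delta.
Qed.

Lemma mvec_measurable t d (X : T -> 'cV[R]_d) i : mvec (past e t) X ->
  measurable_fun setT (fun o => X o i 0).
Proof. by move=> /(_ i) h; apply: measurable_fun_sub h; exact: past_measurable. Qed.

(** [second_moment] applies [fine] entrywise. Finite second moments of the coordinates make all
    products integrable, so these entries are true expectations. *)
Lemma quadf_second_moment d (X : T -> 'cV[R]_d) u :
  (forall i, measurable_fun setT (fun o => X o i 0)) ->
  (forall i, (\int[Pr]_o (X o i 0 ^+ 2)%:E < +oo)%E) ->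
  (\int[Pr]_o (dotv u (X o) ^+ 2)%:E = (quadf (second_moment Pr X) u)%:E)%E.
Proof.
move=> mX fX.
have mij i j : measurable_fun setT (fun o => X o i 0 * X o j 0) by exact: measurable_funM.
have isq i : Pr.-integrable setT (fun o => (X o i 0 ^+ 2)%:E).
  apply/integrableP; split; first by apply/measurable_EFinP; exact: measurable_funX.
  by under eq_integral do rewrite gee0_abs ?lee_fin ?sqr_ge0 //; exact: fX.
have iij i j : Pr.-integrable setT (fun o => (X o i 0 * X o j 0)%:E).
  apply: (le_integrable _ _ _ (integrableD measurableT (isq i) (isq j))) => //.
    by apply/measurable_EFinP.
  move=> o _; rewrite /= lee_fin [leRHS]ger0_norm ?addr_ge0 ?sqr_ge0 // ler_norml.
  by apply/andP; split; nra.
have mE i j : ((second_moment Pr X i j)%:E = \int[Pr]_o (X o i 0 * X o j 0)%:E)%E.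
  rewrite /second_moment mxE unlock fineK.
    by apply: eq_integral => o _; rewrite !mxE big_ord1 !mxE.
  rewrite (eq_integral (fun o => (X o i 0 * X o j 0)%:E)); last first.
    by move=> o _; rewrite !mxE big_ord1 !mxE.
  exact: integrable_fin_num.
rewrite (eq_integral (fun o => \sum_i \sum_j ((u i 0 * u j 0)%:E * (X o i 0 * X o j 0)%:E))%E); last first.
  move=> o _; rewrite expr2 dotvE mulr_suml -sumEFin; apply: eq_bigr => i _.
  by rewrite mulr_sumr -sumEFin; apply: eq_bigr => j _; rewrite -EFinM; congr EFin; ring.
rewrite integral_sum //; last first.
  move=> i; apply: (@integrable_sum _ _ _ _ _ measurableT _ _ _ (fun j o => (u i 0 * u j 0)%:E * (X o i 0 * X o j 0)%:E)%E) => j _ .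
  by apply: integrableZl => //; exact: iij.
rewrite quadfE dotvE -sumEFin; apply: eq_bigr => i _.
rewrite integral_sum //; last by move=> j; apply: integrableZl => //; exact: iij.
rewrite mxE mulr_sumr -sumEFin; apply: eq_bigr => j _.
rewrite (integralZl measurableT (iij i j)).
by rewrite -mE -EFinM; congr EFin; ring.
Qed.

Section Moments.
Variables (t0 d : nat) (X : nat -> T -> 'cV[R]_d).
Hypothesis hX : lagvec t0 X.

Lemma lagvec_second_moment t u : (t0 <= t)%N ->
  (\int[Pr]_o (dotv u (X t o) ^+ 2)%:E = (quadf (second_moment Pr (X t)) u)%:E)%E.
Proof.
move=> tt; apply: quadf_second_moment => i; first exact: mvec_measurable (lagvec_mvec hX tt).
have [V _ hV] := lagform_second_moment (hX (delta_mx i 0)).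
by have := hV t tt; under eq_integral do rewrite dotv_delta; move=> ->; rewrite ltry.
Qed.

Lemma second_moment_mono s t u : (t0 <= s)%N -> (s <= t)%N ->
  quadf (second_moment Pr (X s)) u <= quadf (second_moment Pr (X t)) u.
Proof.
move=> ts st; have [V V1 hV] := lagform_second_moment (hX u).
have tt := leq_trans ts st.
have [<-] : (V s)%:E = (quadf (second_moment Pr (X s)) u)%:E by rewrite -hV // lagvec_second_moment.
have [<-] : (V t)%:E = (quadf (second_moment Pr (X t)) u)%:E by rewrite -hV // lagvec_second_moment.
exact: V1.
Qed.

(** The expected energy is a sum over time of the traces of [M] applied to the second moments; by
    monotonicity each is bounded by the one at time [k]. *)
Lemma energy_moment a (M : 'M[R]_(a, d)) N k : (forall j, (j < N)%N -> (t0 + j <= k)%N) ->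
  (\int[Pr]_o (\sum_(j < N) dotv (M *m X (t0 + j)%N o) (M *m X (t0 + j)%N o))%:E <=
   (N%:R * \sum_r quadf (second_moment Pr (X k)) (M^T *m delta_mx r 0))%:E)%E.
Proof.
move=> hN.
have mm (j : 'I_N) r : measurable_fun setT (fun o => dotv (M^T *m delta_mx r 0) (X (t0 + j)%N o)).
  by apply: measurable_fun_sub (lagform_measurable (hX _) (leq_addr _ _)); exact: past_measurable.
rewrite (eq_integral (fun o => \sum_(j < N) \sum_r
    (dotv (M^T *m delta_mx r 0) (X (t0 + j)%N o) ^+ 2)%:E)%E); last first.
  move=> o _; rewrite -sumEFin; apply: eq_bigr => j _; rewrite dotvE -sumEFin.
  apply: eq_bigr => r _; rewrite dotv_mulmxl trmxK dotv_delta expr2 //.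
rewrite ge0_integral_sum //.
- have -> : (N%:R * \sum_r quadf (second_moment Pr (X k)) (M^T *m delta_mx r 0))%:E =
    (\sum_(j < N) (\sum_r quadf (second_moment Pr (X k)) (M^T *m delta_mx r 0))%:E)%E.
    by rewrite sumEFin sumr_const card_ord mulr_natl.
  apply: lee_sum => j _; rewrite ge0_integral_sum //.
  + rewrite -sumEFin; apply: lee_sum => r _; rewrite lagvec_second_moment ?leq_addr // lee_fin.
    by apply: second_moment_mono; rewrite ?leq_addr ?hN.
  + by move=> r; apply/measurable_EFinP; apply: measurable_funX.
  + by move=> r o _; rewrite lee_fin sqr_ge0.
- move=> j; apply: emeasurable_sum => r.
  by apply/measurable_EFinP; apply: measurable_funX.
- by move=> j o _; apply: sume_ge0 => r _; rewrite lee_fin sqr_ge0.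
Qed.

End Moments.

End LagForms.

Section FilterMoments.
Context (R : realType) (dT : measure_display) (T : measurableType dT).
Variable Pr : probability T R.
Variables (n m : nat) (A : 'M[R]_n) (C : 'M[R]_(m, n)) (K : 'M[R]_(n, m)).
Variables (xh : nat -> T -> 'cV[R]_n) (y e : nat -> T -> 'cV[R]_m) (Rb : 'M[R]_m).
Hypothesis x0 : forall o, xh 0%N o = 0.
Hypothesis xS : forall s o, xh s.+1 o = A *m xh s o + K *m e s o.
Hypothesis yE : forall s o, y s o = C *m xh s o + e s o.

Lemma lagvec_xhat : lagvec e 0 xh.
Proof.
move=> a; exists (fun l => (A ^+ l *m K)^T *m a) => t o _.
have := @state_unroll _ _ _ A K (fun s => xh s o) (fun s => e s o) (fun s => xS s o) 0%N t.
rewrite add0n x0 mulmx0 add0r => ->.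
rewrite dotv_sumr /linf; apply: eq_bigr => l _.
by rewrite dotvC dotv_mulmxl dotvC -subnDA addn1.
Qed.

(** The delay by 1 is needed because the output at time [t] contains the innovation at [t], which
    lies outside [past e t]. *)
Lemma lagform_output b : lagform e 1 (fun t o => dotv b (y (t - 1)%N o)).
Proof.
have hx := @lagform_shift _ _ _ _ e 0 1 _ (lagvec_xhat (C^T *m b)).
have he : lagform e 1 (fun t o => dotv b (e (t - 1)%N o)).
  exists (fun l => if l == 0%N then b else 0) => t o t1.
  have -> : t = (t.-1).+1 by lia.
  rewrite /linf big_ord_recr /= subnn eqxx big1 ?add0r => [|s _]; first by rewrite subn1.
  by have sl := ltn_ord s; rewrite (_ : (_ == _) = false) ?dotv0l //; apply/negbTE; lia.
have [c hc] := lagformD hx he.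
exists c => t o t1; rewrite -hc // yE dotvDr; congr (_ + _).
by rewrite dotvC dotv_mulmxl dotvC.
Qed.

Variable p : nat.

Lemma lagvec_stack : lagvec e p (stack p y).
Proof.
move=> u.
have [c hc] : lagform e p (fun t o => \sum_(i < p) dotv (submxcol u i) (y (t - (p - i.+1) - 1)%N o)).
  apply: lagform_sum => i; apply: lagformW (lagform_shift (p - i.+1) (lagform_output _)).
  by have := ltn_ord i; lia.
exists c => t o tp; rewrite -hc // /stack dotv_mxcol; apply: eq_bigr => i _.
by congr (dotv _ (y _ o)); have := ltn_ord i; lia.
Qed.

Lemma stack_decomposition t o :
  stack p y t o = obsmx A C p *m xh (t - p)%N o + toepmx A C p K *m stack p e t o.
Proof.
exact: (@window_decomposition _ _ _ p A C K (fun s => xh s o) (fun s => y s o)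
  (fun s => e s o) (fun s => xS s o) (fun s => yE s o) (t - p)%N).
Qed.

Hypothesis me : forall s i, measurable_fun setT (fun o => e s o i 0).
Hypothesis pRb : posdef Rb.
Hypothesis white : forall t H A c B, (t <= H)%N -> past e t A ->
  (forall s, (s < t)%N -> c s = 0) -> varf Rb c H = 1 -> measurable B ->
  (Pr (A `&` linf e c H @^-1` B) = Pr A * gprob 1 B)%E.

(** The filter state at [t - p] and the window of innovations that follows it involve disjoint
    times, so their variances add and the state part may be dropped. Together with the lower bound
    on [SigmaE] it makes the second moment of the output window invertible. *)
Lemma second_moment_stack_ge t u : (p <= t)%N ->
  gauss_m2 R * quadf (SigmaE A C p K Rb) u <= quadf (second_moment Pr (stack p y t)) u.
Proof.
move=> pt; have [c hc] := lagvec_xhat ((obsmx A C p)^T *m u).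
pose ub (i : nat) := if insub i is Some i' then submxcol ((toepmx A C p K)^T *m u) (i' : 'I_p) else 0.
pose d s := if (s < t - p)%N then c (t - p - s.+1)%N else ub (s - (t - p))%N.
have tE : t = (t - p + p)%N by lia.
have ubE (i : 'I_p) : ub i = submxcol ((toepmx A C p K)^T *m u) i by rewrite /ub valK.
have dE o : dotv u (stack p y t o) = linf e d t o.
  rewrite stack_decomposition // dotvDr.
  have -> : dotv u (obsmx A C p *m xh (t - p)%N o) = linf e (fun s => c (t - p - s.+1)%N) (t - p) o.
    by rewrite -hc // dotvC dotv_mulmxl dotvC.
  rewrite [in RHS]tE /linf big_split_ord /=; congr (_ + _).
    by apply: eq_bigr => s _; rewrite /d ltn_ord.
  rewrite dotvC dotv_mulmxl dotvC /stack dotv_mxcol; apply: eq_bigr => i _.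
  by rewrite /d ltnNge leq_addr /= addKn ubE.
rewrite -lee_fin -(lagvec_second_moment me pRb white lagvec_stack) //.
under eq_integral do rewrite dE.
rewrite (linf_second_moment me pRb white) lee_fin ler_pM2l ?gauss_m2_gt0 //.
rewrite quadf_SigmaE /varf [in leRHS]tE big_split_ord /=.
have -> : \sum_(i < p) quadf Rb (submxcol ((toepmx A C p K)^T *m u) i) =
  \sum_(i < p) quadf Rb (d (t - p + i)%N).
  by apply: eq_bigr => i _; rewrite /d ltnNge leq_addr /= addKn ubE.
by rewrite lerDr; apply: sumr_ge0 => i _; case: (posdef_psd pRb) => _; exact.
Qed.

End FilterMoments.

(** * High-probability events *)

Section MarkovEvent.
Context (R : realType) d (T : measurableType d) (P : probability T R).

Lemma markov_event (X : T -> R) (C delta : R) : measurable_fun setT X -> (forall o, 0 <= X o) ->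
  (\int[P]_o (X o)%:E <= C%:E)%E -> 0 < delta ->
  exists B : set T, [/\ measurable B, (P B <= delta%:E)%E & forall o, ~ B o -> X o <= C / delta].
Proof.
move=> mX X0 iX d0.
have C0 : 0 <= C.
  by rewrite -lee_fin; apply: le_trans iX; apply: integral_ge0 => o _; rewrite lee_fin.
have [C1|C1] := ltP 0 C.
  have [mB pB] := markov_bound mX X0 iX (divr_gt0 C1 d0).
  exists [set o | C / delta <= X o]; split => //; last by move=> o /negP; rewrite -ltNge => /ltW.
  by apply: le_trans pB _; rewrite invf_div mulrCA divff ?mulr1 ?gt_eqF.
(* At threshold 0 Markov gives no information; instead the zero integral makes [X] vanish almost
   everywhere. *)
have {}C1 : C = 0 by apply/eqP; rewrite eq_le C1 C0.
have : ae_eq P setT (EFin \o X) (cst 0%E).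
  apply/(ae_eq_integral_abs P measurableT); first exact/measurable_EFinP.
  apply/eqP; rewrite eq_le; apply/andP; split; last exact: integral_ge0.
  rewrite (eq_integral (fun o => (X o)%:E)) => [|o _]; first by move: iX; rewrite C1.
  by rewrite /= ger0_norm.
move=> [B [mB B0 sB]]; exists B; split => //; first by rewrite B0 lee_fin ltW.
move=> o nB; rewrite C1 mul0r; have [//|x] := leP (X o) 0.
exfalso; apply: nB; apply: sB => /= h.
by have [] := h I => x1; rewrite x1 ltxx in x.
Qed.

End MarkovEvent.

Section EnergyEvents.
Context (R : realType) (dT : measure_display) (T : measurableType dT).
Variable Pr : probability T R.
Variables (m : nat) (e : nat -> T -> 'cV[R]_m) (Rb : 'M[R]_m).
Hypothesis me : forall s i, measurable_fun setT (fun o => e s o i 0).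
Hypothesis pRb : posdef Rb.
Hypothesis white : forall t H A c B, (t <= H)%N -> past e t A ->
  (forall s, (s < t)%N -> c s = 0) -> varf Rb c H = 1 -> measurable B ->
  (Pr (A `&` linf e c H @^-1` B) = Pr A * gprob 1 B)%E.
Variables (t0 d k N : nat) (X : nat -> T -> 'cV[R]_d).
Hypothesis hX : lagvec e t0 X.
Hypothesis hN : forall j, (j < N)%N -> (t0 + j <= k)%N.
Local Notation Gamma := (second_moment Pr (X k)).

Lemma energy_event a (M : 'M[R]_(a, d)) c (delta : R) : 0 < delta ->
  \sum_r quadf Gamma (M^T *m delta_mx r 0) <= c ->
  exists B : set T, [/\ measurable B, (Pr B <= delta%:E)%E & forall o, ~ B o ->
    \sum_(j < N) dotv (M *m X (t0 + j)%N o) (M *m X (t0 + j)%N o) <= N%:R * c / delta].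
Proof.
move=> d0 hc; apply: markov_event => //.
- apply: measurable_sum => j; apply: measurable_dotv; apply: mmx_mul; try exact: mmx_cst.
    move=> i l; rewrite (ord1 l).
    exact: (mvec_measurable me i (lagvec_mvec hX (leq_addr j t0))).
  move=> i l; rewrite (ord1 l).
  exact: (mvec_measurable me i (lagvec_mvec hX (leq_addr j t0))).
- by move=> o; apply: sumr_ge0 => j _; exact: dotv_ge0.
- apply: le_trans (energy_moment me pRb white hX M hN) _.
  by rewrite lee_fin ler_wpM2l.
Qed.

(** Whitening by the Cholesky factor makes the expected energy at most [N * d]. Markov is spent on
    that single scalar, and Cauchy-Schwarz then serves all directions [u] at once. *)
Lemma gram_event (delta : R) : 0 < delta -> posdef Gamma ->
  exists B : set T, [/\ measurable B, (Pr B <= delta%:E)%E & forall o, ~ B o -> forall u,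
    \sum_(j < N) dotv u (X (t0 + j)%N o) ^+ 2 <= N%:R * (d%:R / delta) * quadf Gamma u].
Proof.
move=> d0 pG; have [L uL GL] := Cholesky pG.
have hs : \sum_r quadf Gamma ((invmx L)^T *m delta_mx r 0) <= d%:R.
  rewrite (eq_bigr (fun=> 1)) ?sumr_const ?card_ord // => r _.
  rewrite {1}GL quadf_mulT mulmxA -trmx_mul mulVmx // trmx1 mul1mx dotv_delta.
  by rewrite mxE !eqxx.
have [B [mB pB hB]] := energy_event d0 hs.
exists B; split => // o /hB h u.
rewrite {1}GL quadf_mulT mulrA; apply: le_trans (ler_wpM2r (dotv_ge0 _) h).
rewrite mulr_suml; apply: ler_sum => j _.
rewrite -{1}(mulKVmx uL (X (t0 + j)%N o)) [dotv u _]dotvC (dotv_mulmxl L).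
exact: dotv_CauchySchwarz.
Qed.

Lemma trace_event (delta : R) : 0 < delta ->
  exists B : set T, [/\ measurable B, (Pr B <= delta%:E)%E & forall o, ~ B o ->
    \sum_(j < N) dotv (X (t0 + j)%N o) (X (t0 + j)%N o) <= N%:R * (d%:R * opnorm Gamma) / delta].
Proof.
move=> d0.
have hs : \sum_r quadf Gamma ((1%:M : 'M[R]_d)^T *m delta_mx r 0) <= d%:R * opnorm Gamma.
  rewrite -[d in d%:R]card_ord -[leRHS]mulrC mulr_natr -sumr_const; apply: ler_sum => r _.
  rewrite trmx1 mul1mx; apply: le_trans (quadf_opnorm _ _) _.
  by rewrite dotv_delta mxE !eqxx mulr1.
have [B [mB pB hB]] := energy_event d0 hs.
exists B; split => // o /hB; by under eq_bigr do rewrite !mul1mx.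
Qed.

End EnergyEvents.

Lemma union_event (R : realType) d (T : measurableType d) (P : probability T R) (I : eqType)
    (N : seq I) (Q : I -> T -> Prop) (delta : R) :
  (forall z, z \in N -> exists B : set T,
    [/\ measurable B, (P B <= delta%:E)%E & forall o, ~ B o -> Q z o]) ->
  exists B : set T, [/\ measurable B, (P B <= ((size N)%:R * delta)%:E)%E &
    forall o, ~ B o -> forall z, z \in N -> Q z o].
Proof.
elim: N => [_|a N IH h]; first by exists set0; split => //; rewrite measure0 mul0r.
have [B [mB pB hB]] := h a (mem_head _ _).
have [B' [mB' pB' hB']] := IH (fun z zN => h z (mem_behead (s := a :: N) zN)).
exists (B `|` B'); split; first exact: measurableU.
  apply: le_trans (measureU2 _ _ _) _ => //.
  by rewrite /= -natr1 mulrDl mul1r addrC EFinD leeD.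
move=> o nB z; rewrite inE => /orP[/eqP ->|zN]; first by apply: hB => h'; apply: nB; left.
by apply: hB' => // h'; apply: nB; right.
Qed.

(** A matrix and its transpose have the same norm: pair [x] with [M^T *m (M *m x)] and apply
    Cauchy-Schwarz. *)
Lemma dotv_mulmx_tr (R : realType) a b (M : 'M[R]_(a, b)) c : 0 <= c ->
  (forall u, dotv (M^T *m u) (M^T *m u) <= c * dotv u u) ->
  forall x, dotv (M *m x) (M *m x) <= c * dotv x x.
Proof.
move=> c0 h x; have := dotv_CauchySchwarz x (M^T *m (M *m x)).
rewrite dotvC dotv_mulmxl trmxK expr2 => /le_trans/(_ (ler_wpM2l (dotv_ge0 x) (h _))).
have := dotv_ge0 (M *m x); rewrite le_eqVlt => /orP[/eqP <-|y0]; last first.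
  by rewrite mulrA [dotv x x * c]mulrC ler_pM2r.
by move=> _; rewrite mulr_ge0 ?dotv_ge0.
Qed.

Section CrossEvent.
Context (R : realType) (dT : measure_display) (T : measurableType dT).
Variable Pr : probability T R.
Variables (m : nat) (e : nat -> T -> 'cV[R]_m) (Rb : 'M[R]_m).
Hypothesis me : forall s i, measurable_fun setT (fun o => e s o i 0).
Hypothesis pRb : posdef Rb.
Hypothesis white : forall t H A c B, (t <= H)%N -> past e t A ->
  (forall s, (s < t)%N -> c s = 0) -> varf Rb c H = 1 -> measurable B ->
  (Pr (A `&` linf e c H @^-1` B) = Pr A * gprob 1 B)%E.
Variables (d q : nat) (tau : R) (z : nat -> T -> 'cV[R]_d).
Hypothesis tau0 : 0 < tau.
Hypothesis mz : forall j, mvec (past e (j + q)) (z j).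

Lemma det_gramV_ge J o : tau ^+ d <= \det (gramV tau z J o).
Proof.
rewrite -det_scalar; apply: det_le_Loewner; first exact: posdef_scalar.
  exact: gramV_posdef.
move=> x; rewrite quadfD lerDl quadf_sum; apply: sumr_ge0 => j _.
by rewrite quadf_outer sqr_ge0.
Qed.

Definition crossM J o : 'M[R]_(d, m) := \sum_(j < J) z j o *m (e (j + q)%N o)^T.

Lemma crossM_dir J o u : crossM J o *m u = \sum_(j < J) dotv u (e (j + q)%N o) *: z j o.
Proof.
rewrite mulmx_suml; apply: eq_bigr => j _; rewrite -mulmxA.
have -> : (e (j + q)%N o)^T *m u = (dotv u (e (j + q)%N o))%:M.
  by rewrite dotvC /dotv [LHS]mx11_scalar.
by rewrite mul_mx_scalar.
Qed.

(** The scalar bound is used in the directions [invmx L^T *m x], which have unit variance, for [x]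
    in a net of the sphere, each at level [delta / 27 ^+ m]. The net bound for the matrix [M],
    whitened on both sides, covers all directions at the cost of 16/9. *)
Lemma cross_event J (delta : R) : 0 < delta -> delta <= 1 ->
  exists B : set T, [/\ measurable B, (Pr B <= delta%:E)%E & forall o, ~ B o -> forall u,
    dotv (crossM J o *m u) (invmx (gramV tau z J o) *m (crossM J o *m u)) <=
    16 / 9 * (2 * ln (27 ^+ m / delta) + ln (\det (gramV tau z J o) / tau ^+ d)) * quadf Rb u].
Proof.
move=> d0 d1; have [L uL RbL] := Cholesky pRb; have uLT : L^T \in unitmx by rewrite unitmx_tr.
have [N [sN N1 Nnet]] := sphere_net R m.
pose delta' := delta / 27 ^+ m.
have p27 : 0 < 27 ^+ m :> R by rewrite exprn_gt0.
have d'0 : 0 < delta' by rewrite divr_gt0.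
have ndir x : x \in N -> exists B : set T, [/\ measurable B, (Pr B <= delta'%:E)%E &
    forall o, ~ B o -> quadS e q tau z (invmx L^T *m x) J o <=
     2 * ln delta'^-1 + ln (\det (gramV tau z J o) / tau ^+ d)].
  move=> xN; apply: (self_normalized_bound me white tau0 mz) => //.
  by rewrite RbL quadf_mulT mulKVmx // N1.
have [B [mB pB hB]] := union_event ndir.
exists B; split => //.
  apply: le_trans pB _; rewrite lee_fin /delta' mulrCA -[leRHS]mulr1 ler_pM2l //.
  by rewrite ler_pdivrMr // mul1r -natrX ler_nat.
move=> o /hB h u.
have [Lv uLv VL] := Cholesky (gramV_posdef z tau0 J o).
pose M := invmx Lv *m crossM J o *m invmx L^T.
have lnD0 : 0 <= ln (\det (gramV tau z J o) / tau ^+ d).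
  by rewrite ln_ge0 // ler_pdivlMr ?exprn_gt0 // mul1r det_gramV_ge.
have := @net_mulmx _ _ N Nnet _ M (2 * ln (27 ^+ m / delta) + ln (\det (gramV tau z J o) / tau ^+ d)).
have dE : delta'^-1 = 27 ^+ m / delta by rewrite /delta' invf_div.
move=> /(_ _ _ (L^T *m u)); rewrite RbL quadf_mulT.
have -> : M *m (L^T *m u) = invmx Lv *m (crossM J o *m u) by rewrite /M -!mulmxA mulKmx.
rewrite -(dotv_inv_Cholesky _ _ uLv) -VL; apply.
  rewrite addr_ge0 // mulr_ge0 // ln_ge0 // ler_pdivlMr // mul1r.
  apply: le_trans d1 _; apply: exprn_ege1; lra.
move=> x xN; rewrite -dE; apply: le_trans (h x xN).
rewrite /quadS VL dotv_inv_Cholesky // /M /crossS -crossM_dir.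
by rewrite -!mulmxA.
Qed.

End CrossEvent.

(** * From forms to operator norms, and the constant of (c) *)

Section SelfNormalizedNorm.
Variable R : realType.

Lemma invmx_sqr d (B : 'M[R]_d) : B \in unitmx -> invmx (B *m B) = invmx B *m invmx B.
Proof.
move=> uB; apply: (@row_full_inj _ _ _ _ (B *m B)); rewrite ?row_full_unit ?unitmx_mul ?uB //.
by rewrite mulmxV ?unitmx_mul ?uB // mulmxA mulmxK // mulmxV.
Qed.

(* When [V] has no square root, [msqrt V] is the junk value [0] and so is [minvsqrt V]. *)
Lemma opnorm_minvsqrt m d (V : 'M[R]_d) (S : 'M[R]_(m, d)) c : posdef V -> 0 <= c ->
  (forall u, dotv (S^T *m u) (invmx V *m (S^T *m u)) <= c * dotv u u) ->
  opnorm (S *m minvsqrt V) <= Num.sqrt c.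
Proof.
move=> pV c0 h; rewrite /minvsqrt /msqrt; case: xgetP => [B _ [[sB _] BV]|_]; last first.
  apply: opnorm_le => [|x _]; first exact: sqrtr_ge0.
  have -> : invmx (0 : 'M[R]_d) = 0.
    case: d {V S pV h x} => [|d]; first by apply/matrixP => -[].
    by rewrite /invmx unitmxE det0 unitr0.
  by rewrite mulmx0 mul0mx dotv0l sqr_ge0.
have uB : B \in unitmx by have := posdef_unit pV; rewrite -BV unitmx_mul => /andP[].
apply: opnorm_le => [|x x1]; first exact: sqrtr_ge0.
rewrite sqr_sqrtr // -[c]mulr1 -x1; apply: dotv_mulmx_tr => // u.
have -> : (S *m invmx B)^T *m u = invmx B *m (S^T *m u).
  by rewrite trmx_mul trmx_inv sB mulmxA.
apply: le_trans (h u); rewrite -BV invmx_sqr // (dotv_mulmxl (invmx B)) trmx_inv sB.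
by rewrite mulmxA.
Qed.

Lemma det_lam_shift d lam (G : 'M[R]_d) : lam != 0 ->
  \det (lam%:M + G) = lam ^+ d * \det (lam^-1 *: G + 1%:M).
Proof.
move=> l0; rewrite -detZ; congr (\det _).
by rewrite scalerDr scalerA mulfV // scale1r scalemx1 addrC.
Qed.

Lemma det_shift_ge1 d lam (G : 'M[R]_d) : 0 < lam -> posdef G -> 1 <= \det (lam^-1 *: G + 1%:M).
Proof.
move=> l0 pG; have p1 : posdef (1%:M : 'M[R]_d) by exact: posdef_scalar.
have pG' : posdef (lam^-1 *: G) by apply: posdefZ; rewrite ?invr_gt0.
rewrite -{1}[1](det1 R d); apply: det_le_Loewner => //; first by apply: posdefD => //; exact: posdef_psd.
by move=> x; rewrite quadfD lerDr; case: (posdef_psd pG') => _; exact.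
Qed.

(** Because [1 <= c], the shift [lam] is dominated along with the Gram part: the whole matrix lies
    below [c *: (lam%:M + G)], and determinants are monotone. *)
Lemma det_gram_le d lam c J (z : 'I_J -> 'cV[R]_d) (G : 'M[R]_d) : 0 < lam -> 1 <= c -> posdef G ->
  (forall u, \sum_j dotv u (z j) ^+ 2 <= c * quadf G u) ->
  \det (lam%:M + \sum_j z j *m (z j)^T) / lam ^+ d <= c ^+ d * \det (lam^-1 *: G + 1%:M).
Proof.
move=> l0 c1 pG h.
have c0 : 0 < c by apply: lt_le_trans c1.
have pS : psd (\sum_j z j *m (z j)^T) by apply: psd_sum => j; exact: psd_mulT.
have pl : posdef (lam%:M : 'M[R]_d) by exact: posdef_scalar.
rewrite ler_pdivrMr ?exprn_gt0 // -mulrA [_ * lam ^+ d]mulrC -det_lam_shift ?gt_eqF // -detZ.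
apply: det_le_Loewner; first exact: posdefD.
  by apply: posdefZ => //; apply: posdefD => //; exact: posdef_psd.
move=> u; rewrite quadfD quadfZ quadfD mulrDr; apply: lerD.
  by rewrite ler_peMl //; case: (posdef_psd pl) => _; exact.
rewrite quadf_sum; apply: le_trans (h u); apply: ler_sum => j _.
by rewrite quadf_outer dotvC.
Qed.

(** The critical term is the logarithm of the net. By [2 <= p], [16 / 9 * 2 * 3 * m] is at most
    [16 / 3 * (m * p)], below the factor 8 of [g1]. The remaining coefficients 16/9 and 32/9 stay
    below 4 and 8. *)
Lemma g1_bound (m p N : nat) (delta r D V : R) : (0 < m)%N -> (2 <= p)%N -> (0 < N)%N ->
  0 < delta -> delta < 1 -> 0 <= r -> 1 <= D -> 0 < V ->
  V <= (N%:R * ((m * p)%:R / delta)) ^+ (m * p) * D ->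
  Num.sqrt (16 / 9 * (2 * ln (27 ^+ m / delta) + ln V) * r) <=
  Num.sqrt 8 * Num.sqrt (r * m%:R * p%:R) *
  Num.sqrt (ln (3 * m%:R * p%:R / delta) + 2^-1 * ln N%:R + (2 * m%:R * p%:R)^-1 * ln D).
Proof.
move=> m0 p2 N0 d0 d1 r0 D1 V0 VD.
have mR : 1 <= m%:R :> R by rewrite ler1n.
have pR : 2 <= p%:R :> R by rewrite ler_nat.
have NR : 1 <= N%:R :> R by rewrite ler1n.
set mr : R := m%:R in mR *; set pr : R := p%:R in pR *; set Nr : R := N%:R in NR VD *.
set q : R := mr * pr.
have q1 : 1 <= q by rewrite /q; nra.
have qm : 2 * mr <= q by rewrite /q; nra.
have q2 : 2 <= q by rewrite /q; nra.
have q0 : 0 < q by lra.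
have di : 1 <= delta^-1 by rewrite invf_ge1 // ltW.
have di0 : 0 < delta^-1 by lra.
have l3 : 0 <= ln 3 :> R by rewrite ln_ge0 // ler1n.
have li : 0 <= ln delta^-1 by rewrite ln_ge0.
have lN : 0 <= ln Nr by rewrite ln_ge0.
have lq : 0 <= ln q by rewrite ln_ge0.
have lD : 0 <= ln D by rewrite ln_ge0.
have lV : ln V <= q * (ln Nr + ln q + ln delta^-1) + ln D.
  apply: le_trans (_ : ln ((Nr * ((m * p)%:R / delta)) ^+ (m * p) * D) <= _).
    rewrite ler_ln ?posrE //; apply: lt_le_trans VD => //.
  have qE : (m * p)%:R = q by rewrite natrM.
  have c0 : 0 < Nr * (q / delta) by rewrite !mulr_gt0 //; lra.
  rewrite qE lnM ?posrE ?exprn_gt0 //; last lra.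
  have N0' : 0 < Nr by lra.
  by rewrite lnXn // -mulr_natl qE [ln (Nr * _)]lnM ?posrE ?divr_gt0 // [ln (q / _)]lnM ?posrE // addrA.
have E1 : ln (27 ^+ m / delta) = 3 * mr * ln 3 + ln delta^-1.
  have E : 27 = 3 ^+ 3 :> R by ring.
  by rewrite lnM ?posrE ?exprn_gt0 // lnXn // E lnXn // -[LHS]addrC -(mulr_natl (_ *+ _)) -(mulr_natl (ln 3)) -/mr; ring.
have E2 : ln (3 * mr * pr / delta) = ln 3 + ln q + ln delta^-1.
  have q3 : 0 < 3 * q by lra.
  by rewrite -(mulrA 3) -/q lnM ?posrE // lnM ?posrE.
rewrite -sqrtrM; last by lra.
rewrite -sqrtrM; last by rewrite -mulrA !mulr_ge0 //; lra.
rewrite ler_wsqrtr // E1 E2 -(mulrA r) -/q -(mulrA 2 mr) -/q.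
have -> : 8 * (r * q) * (ln 3 + ln q + ln delta^-1 + 2^-1 * ln Nr + (2 * q)^-1 * ln D) =
  (8 * q * ln 3 + 8 * q * ln q + 8 * q * ln delta^-1 + 4 * q * ln Nr + 4 * ln D) * r.
  by field; lra.
apply: ler_wpM2r => //.
have h1 : mr * ln 3 <= q * ln 3 / 2 by nra.
have h2 : 2 * ln delta^-1 <= q * ln delta^-1 by rewrite ler_wpM2r.
have h3 : 0 <= q * ln 3 by rewrite mulr_ge0 // ltW.
have h4 : 0 <= q * ln q by rewrite mulr_ge0 // ltW.
have h5 : 0 <= q * ln Nr by rewrite mulr_ge0 // ltW.
have h6 : 0 <= q * ln delta^-1 by rewrite mulr_ge0 // ltW.
move: h1 h2 h3 h4 h5 h6 lV lD; lra.
Qed.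

End SelfNormalizedNorm.

Lemma expR_ge_pow (R : realType) (q : nat) (x : R) : (0 < q)%N -> - q%:R <= x ->
  (1 + x / q%:R) ^+ q <= expR x.
Proof.
move=> q0 xq; have qR : 0 < q%:R :> R by rewrite ltr0n.
have -> : expR x = expR (x / q%:R) ^+ q by rewrite -expRM_natl mulrCA mulfV ?mulr1 // gt_eqF.
apply: lerXn2r; rewrite ?nnegrE ?expR_ge0 ?expR_ge1Dx //.
by rewrite -lerBlDl sub0r ler_pdivlMr // mulN1r.
Qed.

(** The numbers 29/128 here and 35/128 below are those for which [chi_square_concentration] closes
    with equality: [10 * (3 / 256) + 5 * (29 / 128) = 5 / 4] and
    [3 * (35 / 128) - 6 * (3 / 256) = 3 / 4]. *)
Lemma ln_4_5_ge (R : realType) : - (29 / 128) <= ln (4 / 5) :> R.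
Proof.
have p45 : 0 < 4 / 5 :> R by lra.
rewrite -[leRHS]opprK lerN2 -lnV ?posrE // -[leRHS]expRK ler_ln ?posrE ?expR_gt0 //.
  apply: le_trans (expR_ge_pow (q := 8) _ _) => //; lra.
Qed.

Lemma ln_4_3_ge (R : realType) : 35 / 128 <= ln (4 / 3) :> R.
Proof.
have p34 : 0 < 3 / 4 :> R by lra.
have -> : ln (4 / 3) = - ln (3 / 4) :> R by rewrite -lnV ?posrE // invf_div.
rewrite lerNr -[leRHS]expRK ler_ln ?posrE ?expR_gt0 //.
apply: le_trans (expR_ge_pow (q := 4) _ _) => //; lra.
Qed.

(** * Concentration of the noise Gram matrix *)

Section NoiseGram.
Context (R : realType) (dT : measure_display) (T : measurableType dT).
Variable Pr : probability T R.
Variables (m : nat) (e : nat -> T -> 'cV[R]_m) (Rb : 'M[R]_m).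
Hypothesis me : forall s i, measurable_fun setT (fun o => e s o i 0).
Hypothesis pRb : posdef Rb.
Hypothesis white : forall t H A c B, (t <= H)%N -> past e t A ->
  (forall s, (s < t)%N -> c s = 0) -> varf Rb c H = 1 -> measurable B ->
  (Pr (A `&` linf e c H @^-1` B) = Pr A * gprob 1 B)%E.

(** The exponents 1/10 and -1/6 give the upper and the lower tail. The deviation is held to a
    quarter because [net_quadf] will double it to the half that (a) allows. *)
Lemma chi_square_concentration p (u : nat -> 'cV[R]_m) N (delta : R) : (0 < p)%N ->
  \sum_(i < p) quadf Rb (u i) = 1 -> 0 < delta ->
  256 / 3 * (p%:R * ln delta^-1) <= N%:R ->
  exists B : set T, [/\ measurable B, (Pr B <= (2 * delta)%:E)%E & forall o, ~ B o ->
    `|\sum_(j < N) window e p u j o ^+ 2 - N%:R| <= N%:R / 4].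
Proof.
move=> p0 u1 d0 hN.
have a1 : (10^-1 : R) < 2^-1 by lra.
have a2 : (- 6^-1 : R) < 2^-1 by lra.
have [B [mB pB hB]] := chi_square_bound me white p0 u1 a1 N d0.
have [B' [mB' pB' hB']] := chi_square_bound me white p0 u1 a2 N d0.
exists (B `|` B'); split; first exact: measurableU.
  apply: le_trans (measureU2 _ _ _) _ => //.
  by rewrite mulr_natl mulr2n EFinD leeD.
move=> o nB.
have /hB h : ~ B o by move=> h'; apply: nB; left.
have /hB' h' : ~ B' o by move=> h'; apply: nB; right.
move: h h'; have -> : 1 - 2 * 10^-1 = 4 / 5 :> R by field.
have -> : 1 - 2 * - 6^-1 = 4 / 3 :> R by field.
have := ln_4_5_ge R; have := ln_4_3_ge R; have : 0 <= N%:R :> R by rewrite ler0n.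
move: hN; set l := p%:R * _; set S := \sum_(j < N) _; move: (ln (4 / 5)) (ln (4 / 3)) => x y.
move: N%:R l S => n l S hl n0 hy hx h h'.
have h1 : n * - (29 / 128) <= n * x by rewrite ler_wpM2l.
have h2 : n * (35 / 128) <= n * y by rewrite ler_wpM2l.
by rewrite ler_norml; apply/andP; split; lra.
Qed.

Lemma noise_gram_event p N (delta : R) : (0 < p)%N -> 0 < delta -> delta <= 1 ->
  128 * (m%:R * p%:R ^+ 2 * ln 9 + p%:R * ln 2 + p%:R * ln delta^-1) <= N%:R ->
  exists B : set T, [/\ measurable B, (Pr B <= delta%:E)%E & forall o, ~ B o ->
    forall u : 'I_p -> 'cV[R]_m, N%:R / 2 * \sum_(i < p) quadf Rb (u i) <=
      \sum_(j < N) (\sum_(i < p) dotv (u i) (e (j + i)%N o)) ^+ 2].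
Proof.
move=> p0 d0 d1 hN; have [L uL RbL] := Cholesky pRb; have uLT : L^T \in unitmx by rewrite unitmx_tr.
pose D := (\sum_(i < p) m)%N.
have DE : D = (p * m)%N by rewrite /D sum_nat_const card_ord.
have [S [sS S1 Snet]] := sphere_net R D.
have p27 : 0 < 27 ^+ D :> R by rewrite exprn_gt0.
pose delta' := delta / (2 * 27 ^+ D).
have d'0 : 0 < delta' by rewrite divr_gt0 ?mulr_gt0.
pose uz (z : 'cV[R]_D) (i : nat) : 'cV[R]_m :=
  if insub i is Some i' then invmx L^T *m submxcol z (i' : 'I_p) else 0.
have uzE z (i : 'I_p) : uz z i = invmx L^T *m submxcol z i by rewrite /uz valK.
(* Since [256 / 3 * ln 27 = 128 * ln 9], the net in dimension [D = p * m] meets the leading term of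
   [k1] with equality; the other terms have slack. *)
have hN' : 256 / 3 * (p%:R * ln delta'^-1) <= N%:R.
  apply: le_trans hN; have -> : ln delta'^-1 = ln 2 + D%:R * (3 * ln 3) + ln delta^-1.
    have E : 27 = 3 ^+ 3 :> R by ring.
    rewrite /delta' invf_div lnM ?posrE ?invr_gt0 ?mulr_gt0 // lnM ?posrE // lnXn // E lnXn //.
    by rewrite -(mulr_natl (_ *+ _)) -(mulr_natl (ln 3)).
  have E : 9 = 3 ^+ 2 :> R by ring.
  rewrite E lnXn // -(mulr_natl (ln 3)) DE natrM.
  have pR : 1 <= p%:R :> R by rewrite ler1n.
  have m0 : 0 <= m%:R :> R by rewrite ler0n.
  have l2 : 0 <= ln 2 :> R by rewrite ln_ge0 // ler1n.
  have l3 : 0 <= ln 3 :> R by rewrite ln_ge0 // ler1n.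
  have li : 0 <= ln delta^-1 by rewrite ln_ge0 // invf_ge1.
  have h1 : 0 <= p%:R * ln 2 :> R by rewrite mulr_ge0 // ler0n.
  have h2 : 0 <= p%:R * ln delta^-1 :> R by rewrite mulr_ge0 // ler0n.
  move: li h1 h2; move: (ln 2) (ln 3) (ln _) (p%:R) (m%:R) => x y z P0 M0; lra.
have ndir z : z \in S -> exists B : set T, [/\ measurable B, (Pr B <= (2 * delta')%:E)%E &
    forall o, ~ B o -> `|\sum_(j < N) window e p (uz z) j o ^+ 2 - N%:R| <= N%:R / 4].
  move=> zS; apply: chi_square_concentration => //.
  rewrite -(S1 z zS) dotv_submxcol; apply: eq_bigr => i _.
  by rewrite uzE RbL quadf_mulT mulKVmx.
have [B [mB pB hB]] := union_event ndir.
exists B; split => //.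
  apply: le_trans pB _; rewrite lee_fin /delta'.
  have -> : 2 * (delta / (2 * 27 ^+ D)) = delta / 27 ^+ D by field; rewrite gt_eqF.
  rewrite mulrCA -[leRHS]mulr1 ler_pM2l // ler_pdivrMr // mul1r -natrX ler_nat //.
move=> o /hB h u.
pose g (j : 'I_N) : 'cV[R]_D := \mxcol_(i < p) (invmx L *m e (j + i)%N o).
(* The deviation of the whitened Gram matrix from [N] times the identity is a symmetric form of both
   signs, hence the two-sided control on the net. *)
pose G := \sum_(j < N) g j *m (g j)^T - N%:R *: 1%:M.
have GE z : quadf G z = \sum_(j < N) (\sum_(i < p) dotv (invmx L^T *m submxcol z i) (e (j + i)%N o)) ^+ 2
    - N%:R * dotv z z.
  rewrite /G quadfD quadfN quadfZ quadf1 quadf_sum; congr (_ - _); apply: eq_bigr => j _.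
  rewrite quadf_outer dotvC /g dotv_mxcol; congr (_ ^+ 2); apply: eq_bigr => i _.
  by rewrite dotv_mulmxl trmx_inv trmxK.
have sG : symmx G.
  rewrite /symmx /G linearB /= linearZ /= trmx1 raddf_sum; congr (_ - _).
  by apply: eq_bigr => j _; rewrite /= trmx_mul trmxK.
have n4 : 0 <= N%:R / 4 :> R by rewrite divr_ge0 ?ler0n.
have hS z : z \in S -> `|quadf G z| <= N%:R / 4.
  move=> zS; rewrite GE S1 // mulr1; have := h z zS.
  congr (`|_ - _| <= _); apply: eq_bigr => j _; congr (_ ^+ 2).
  by rewrite /window; apply: eq_bigr => i _; rewrite uzE.
have := net_quadf S1 Snet sG n4 hS (\mxcol_(i < p) (L^T *m u i)).
rewrite GE ler_norml => /andP[+ _].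
have -> : dotv (\mxcol_(i < p) (L^T *m u i)) (\mxcol_(i < p) (L^T *m u i)) = \sum_(i < p) quadf Rb (u i).
  by rewrite dotv_mxcol; apply: eq_bigr => i _; rewrite mxcolK RbL quadf_mulT.
have -> : \sum_(j < N) (\sum_(i < p) dotv (invmx L^T *m submxcol (\mxcol_(i < p) (L^T *m u i)) i) (e (j + i)%N o)) ^+ 2 =
  \sum_(j < N) (\sum_(i < p) dotv (u i) (e (j + i)%N o)) ^+ 2.
  by apply: eq_bigr => j _; congr (_ ^+ 2); apply: eq_bigr => i _; rewrite mxcolK mulKmx.
lra.
Qed.

End NoiseGram.

(** Bernoulli's inequality: the power [x] of [1 + G / x] is at most [1 + G]. It is convexity of
    [expR] between 0 and [y], read off the tangent at [y * x]. *)
Lemma ln1D_div (R : realType) (x G : R) : 0 < x -> x <= 1 -> 0 <= G ->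
  ln (1 + G / x) <= ln (1 + G) / x.
Proof.
move=> x0 x1 G0; have Gx : 0 <= G / x by rewrite divr_ge0 // ltW.
set y := ln _; have yE : expR y = 1 + G / x by rewrite lnK // posrE; lra.
rewrite ler_pdivlMr // -[y * x]expRK ler_ln ?posrE ?expR_gt0 //; last lra.
have -> : 1 + G = x * expR y + (1 - x) * expR 0.
  by rewrite yE expR0 mulrDr mulrCA mulfV ?gt_eqF // !mulr1; ring.
have h (t : R) : expR (y * x) * (1 + (t - y * x)) <= expR t.
  have -> : expR t = expR (y * x) * expR (t - y * x) by rewrite -expRD addrC subrK.
  by rewrite ler_wpM2l ?expR_ge0 ?expR_ge1Dx.
have h1 : x * (expR (y * x) * (1 + (y - y * x))) <= x * expR y by rewrite ler_wpM2l // ltW.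
have h2 : (1 - x) * (expR (y * x) * (1 + (0 - y * x))) <= (1 - x) * expR 0.
  by rewrite ler_wpM2l //; lra.
apply: le_trans (lerD h1 h2); rewrite le_eqVlt; apply/orP; left; apply/eqP; ring.
Qed.

(* [27 ^+ m] is the cardinality bound of [sphere_net]; [5 ^+ m] absorbs it because [27 ^ 4 <= 5 ^ 9]. *)
Lemma k2_bound (R : realType) (n m p k : nat) (sigmaR nO nG delta : R) :
  (0 < p)%N -> (p <= k)%N -> 0 < sigmaR -> 0 <= nO -> 0 <= nG -> 0 < delta -> delta < 1 ->
  k2 n m p sigmaR nO nG delta <= k%:R ->
  16 * p%:R * (16 / 9 * (2 * ln (27 ^+ m * p%:R / delta) +
    n%:R * ln (1 + n%:R * nO ^+ 2 * nG / delta / (sigmaR / 4)))) <= (k - p + 1)%N%:R.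
Proof.
move=> p0 pk s0 O0 G0 d0 d1; rewrite /k2.
set G := n%:R * nO ^+ 2 * nG / delta.
have GG : 0 <= G by rewrite /G !mulr_ge0 ?ler0n ?sqr_ge0 // invr_ge0 ltW.
(* Capping [sigmaR / 4] at 1 lets [ln1D_div] move it out of the logarithm, where it becomes the
   prefactor [64 / Num.min 4 sigmaR]. *)
pose x := Num.min 4 sigmaR / 4.
have mE : Num.min 4 sigmaR = 4 * x by rewrite /x; field.
have x0 : 0 < x by rewrite divr_gt0 // lt_min s0 andbT; lra.
have x1 : x <= 1 by rewrite ler_pdivrMr // mul1r ge_min lexx.
have xs : x <= sigmaR / 4 by rewrite ler_pM2r // ge_min lexx orbT.
have NE : (k - p + 1)%N%:R = k%:R - p%:R + 1 :> R by rewrite natrD natrB.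
rewrite NE mE (addrC G 1).
have pR : 1 <= p%:R :> R by rewrite ler1n.
have li : 0 <= ln (p%:R / delta) by rewrite ln_ge0 // ler_pdivlMr //; lra.
have l5 : 0 <= ln 5 :> R by rewrite ln_ge0 // ler1n.
have l27 : 4 * ln 27 <= 9 * ln 5 :> R.
  have -> : 4 * ln 27 = ln (27 ^+ 4) :> R by rewrite lnXn // mulr_natl.
  have -> : 9 * ln 5 = ln (5 ^+ 9) :> R by rewrite lnXn // mulr_natl.
  by rewrite ler_ln ?posrE ?exprn_gt0 //; lra.
have pd : 0 < p%:R / delta by rewrite divr_gt0 // ltr0n.
have -> : ln (27 ^+ m * p%:R / delta) = m%:R * ln 27 + ln (p%:R / delta).
  by rewrite -mulrA lnM ?posrE ?exprn_gt0 // lnXn // (mulr_natl (ln 27)).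
have -> : ln (p%:R * 5 ^+ m / delta) = m%:R * ln 5 + ln (p%:R / delta).
  by rewrite [p%:R * _]mulrC -mulrA lnM ?posrE ?exprn_gt0 // lnXn // (mulr_natl (ln 5)).
have lG : ln (1 + G / (sigmaR / 4)) <= ln (1 + G) / x.
  apply: le_trans (ln1D_div x0 x1 GG).
  have s4 : 0 < sigmaR / 4 by rewrite divr_gt0.
  have pos t : 0 < t -> 0 < 1 + G / t by move=> t0; rewrite ltr_wpDr // divr_ge0 // ltW.
  by rewrite ler_ln ?posrE ?pos // lerD2l ler_wpM2l // lef_pV2 ?posrE.
have xi : 1 <= x^-1 by rewrite invf_ge1.
have -> : 64 / (4 * x) = 16 * x^-1 by field; rewrite gt_eqF.
have L0 : 0 <= ln (1 + G) by rewrite ln_ge0 // lerDl.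
move: lG l27 li l5 L0; rewrite -/(G / x); move: (ln (1 + G / _)) => Y.
move: (ln 27) (ln 5) (ln (p%:R / delta)) (ln (1 + G)) => a b l L lG l27 l0 b0 L0.
have n0 : 0 <= n%:R :> R by rewrite ler0n.
have m0 : 0 <= m%:R :> R by rewrite ler0n.
move: n%:R m%:R p%:R k%:R pR n0 m0 => nn mm P kk pR n0 m0 hk.
suff : 16 * P * (16 / 9 * (2 * (mm * a + l) + nn * Y)) <= 16 * x^-1 * (4 * P * nn * L + 8 * P * (mm * b + l)).
  by move: hk; lra.
have P0 : 0 <= P by lra.
have e1 : nn * Y <= x^-1 * (nn * L) by rewrite mulrCA ler_wpM2l // mulrC.
have e2 : mm * a <= 9 / 4 * (mm * b) by have := ler_wpM2l m0 l27; lra.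
have mb : 0 <= mm * b by rewrite mulr_ge0.
have e3 : mm * b + l <= x^-1 * (mm * b + l) by rewrite ler_peMl // addr_ge0.
have nL : 0 <= x^-1 * (nn * L) by rewrite !mulr_ge0 // invr_ge0 ltW.
have -> : 16 * x^-1 * (4 * P * nn * L + 8 * P * (mm * b + l)) =
  16 * P * (4 * (x^-1 * (nn * L)) + 8 * (x^-1 * (mm * b + l))) by ring.
rewrite ler_wpM2l ?mulr_ge0 //.
move: e1 e2 e3 nL mb l0; move: (nn * Y) (x^-1 * (nn * L)) (mm * a) (mm * b) (x^-1 * (mm * b + l)); clear => q1 q2 q3 q4 q5 h1 h2 h3 h4 h5 h6; lra.
Qed.

Lemma quadf_scalar (R : realType) d (a : R) (x : 'cV[R]_d) : quadf a%:M x = a * dotv x x.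
Proof. by rewrite -scalemx1 quadfZ quadf1. Qed.

(** * Cross terms between states and innovations *)

Section CrossTerm.
Variable R : realType.

(** Each rank one term lies below its squared length times the identity, so the whole matrix lies
    below [(tau + s)%:M]. *)
Lemma ln_det_le_trace d J (tau : R) (z : 'I_J -> 'cV[R]_d) : 0 < tau ->
  ln (\det (tau%:M + \sum_j z j *m (z j)^T) / tau ^+ d) <=
  d%:R * ln (1 + (\sum_j dotv (z j) (z j)) / tau).
Proof.
move=> t0; set s := \sum_j dotv (z j) (z j).
have s0 : 0 <= s by apply: sumr_ge0 => j _; exact: dotv_ge0.
have pV : posdef (tau%:M + \sum_j z j *m (z j)^T).
  by apply: posdefD; [exact: posdef_scalar | apply: psd_sum => j; exact: psd_mulT].
have st : 0 < 1 + s / tau by rewrite ltr_wpDr // divr_ge0 // ltW.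
have h : \det (tau%:M + \sum_j z j *m (z j)^T) <= (tau + s) ^+ d.
  rewrite -det_scalar; apply: det_le_Loewner => //; first by apply: posdef_scalar; rewrite ltr_wpDr.
  move=> x; rewrite quadfD !quadf_scalar mulrDl lerD2l quadf_sum mulr_suml.
  by apply: ler_sum => j _; rewrite quadf_outer; exact: dotv_CauchySchwarz.
rewrite mulr_natl -lnXn // ler_ln ?posrE ?exprn_gt0 ?divr_gt0 ?exprn_gt0 ?posdef_det_gt0 //.
rewrite ler_pdivrMr ?exprn_gt0 // -exprMn mulrDl mul1r divfK ?gt_eqF //.
Qed.

Lemma dotv_CauchySchwarz_inv d (V : 'M[R]_d) x y : posdef V ->
  dotv x y ^+ 2 <= quadf V x * dotv y (invmx V *m y).
Proof.
move=> pV; have [L uL ->] := Cholesky pV.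
rewrite quadf_mulT dotv_inv_Cholesky // -{1}(mulKVmx uL y) [dotv x _]dotvC (dotv_mulmxl L) mulrC.
exact: dotv_CauchySchwarz.
Qed.

End CrossTerm.

Lemma conj_event (R : realType) d (T : measurableType d) (P : probability T R)
    (Q1 Q2 : T -> Prop) (a b : R) :
  (exists B : set T, [/\ measurable B, (P B <= a%:E)%E & forall o, ~ B o -> Q1 o]) ->
  (exists B : set T, [/\ measurable B, (P B <= b%:E)%E & forall o, ~ B o -> Q2 o]) ->
  exists B : set T, [/\ measurable B, (P B <= (a + b)%:E)%E & forall o, ~ B o -> Q1 o /\ Q2 o].
Proof.
move=> [B [mB pB hB]] [B' [mB' pB' hB']].
exists (B `|` B'); split; first exact: measurableU.
  by apply: le_trans (measureU2 _ _ _) _ => //; rewrite EFinD leeD.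
by move=> o nB; split; [apply: hB | apply: hB'] => h; apply: nB; [left | right].
Qed.

Section GramColumns.
Variables (R : realType) (a b : nat) (U : 'I_b -> 'cV[R]_a).

Lemma gram_columns : (\matrix_(i, j) U j i 0) *m (\matrix_(i, j) U j i 0)^T = \sum_j U j *m (U j)^T.
Proof.
apply/matrixP => i l; rewrite !mxE summxE; apply: eq_bigr => j _.
by rewrite !mxE big_ord1 !mxE.
Qed.

Lemma quadf_gram u :
  quadf (\sum_j U j *m (U j)^T) u = \sum_j dotv u (U j) ^+ 2.
Proof. by rewrite quadf_sum; apply: eq_bigr => j _; rewrite quadf_outer dotvC. Qed.

End GramColumns.

Section CrossTermBound.
Variable R : realType.

Lemma sum_sqr_le p (t : 'I_p -> R) : (\sum_i t i) ^+ 2 <= p%:R * \sum_i t i ^+ 2.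
Proof.
have := dotv_CauchySchwarz (const_mx 1 : 'cV[R]_p) (\col_i t i).
rewrite !dotvE; congr (_ ^+ 2 <= _ * _).
- by apply: eq_bigr => i _; rewrite !mxE mul1r.
- by under eq_bigr do rewrite !mxE mulr1; rewrite sumr_const card_ord.
- by apply: eq_bigr => i _; rewrite !mxE expr2.
Qed.

(** The cross term [c] is split over the [p] lags, each measured in the norm of [V]. The shift [tau]
    adds at most [b / 2], so [c ^+ 2 <= (al + b / 2) * (b / 8)]. This is below [((al + b) / 4) ^+ 2]
    by exactly [al ^+ 2 / 16], hence [2 * c] takes away at most half of [al + b]. *)
Lemma cross_term_le n p N (tau W : R) (x : 'I_N -> 'cV[R]_n) (w : 'cV[R]_n)
    (f : 'I_p -> 'I_N -> R) (r : 'I_p -> R) :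
  let V := tau%:M + \sum_j x j *m (x j)^T in
  let s i := \sum_j f i j *: x j in
  let b := \sum_j (\sum_i f i j) ^+ 2 in
  (0 < N)%N -> 0 < tau -> 0 <= W -> 16 * p%:R * W <= N%:R ->
  (forall i, dotv (s i) (invmx V *m s i) <= W * r i) ->
  N%:R / 2 * \sum_i r i <= b -> tau * dotv w w <= b / 2 ->
  2^-1 * \sum_j dotv w (x j) ^+ 2 + 2^-1 * b <= \sum_j (dotv w (x j) + \sum_i f i j) ^+ 2.
Proof.
move=> V s b N0 t0 W0 hW hs hr hw.
have NR : 0 < N%:R :> R by rewrite ltr0n.
have pV : posdef V.
  by apply: posdefD; [exact: posdef_scalar | apply: psd_sum => j; exact: psd_mulT].
set al := \sum_j dotv w (x j) ^+ 2.
set c := \sum_j dotv w (x j) * \sum_i f i j.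
have -> : \sum_j (dotv w (x j) + \sum_i f i j) ^+ 2 = al + 2 * c + b.
  rewrite /al /b /c mulr_sumr -!big_split /=; apply: eq_bigr => j _.
  rewrite sqrrD; ring.
have al0 : 0 <= al by apply: sumr_ge0 => j _; exact: sqr_ge0.
have b0 : 0 <= b by apply: sumr_ge0 => j _; exact: sqr_ge0.
have cE : c = \sum_i dotv w (s i).
  rewrite /c; under eq_bigr do rewrite mulr_sumr.
  rewrite exchange_big /=; apply: eq_bigr => i _; rewrite dotv_sumr.
  by apply: eq_bigr => j _; rewrite dotvZr mulrC.
have qV : quadf V w <= al + b / 2.
  by rewrite /V quadfD quadf_scalar addrC quadf_gram lerD2l.
have qV0 : 0 <= quadf V w by case: (posdef_psd pV) => _; exact.
have c2 : c ^+ 2 <= p%:R * ((al + b / 2) * (W * \sum_i r i)).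
  rewrite cE; apply: le_trans (sum_sqr_le _) _; rewrite ler_wpM2l ?ler0n //.
  apply: le_trans (_ : \sum_i (quadf V w * (W * r i)) <= _).
    apply: ler_sum => i _; apply: le_trans (dotv_CauchySchwarz_inv _ _ pV) _.
    by rewrite ler_wpM2l.
  rewrite -mulr_sumr -mulr_sumr ler_wpM2r //.
  rewrite mulr_sumr; apply: sumr_ge0 => i _.
  apply: le_trans (hs i).
  have [L uL ->] := Cholesky pV; rewrite dotv_inv_Cholesky //; exact: dotv_ge0.
have c3 : c ^+ 2 <= ((al + b) / 4) ^+ 2.
  have h1 : (al + b / 2) * (p%:R * W * (\sum_i r i)) <= (al + b / 2) * (b / 8).
    rewrite ler_wpM2l ?addr_ge0 ?divr_ge0 //.
    have [S0|S0] := leP 0 (\sum_i r i); last first.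
      by apply: le_trans (_ : 0 <= _); [rewrite mulr_ge0_le0 ?mulr_ge0 ?ler0n // ltW | rewrite divr_ge0].
    have : p%:R * W * \sum_i r i <= N%:R / 16 * \sum_i r i by rewrite ler_wpM2r //; lra.
    lra.
  apply: le_trans c2 _; apply: le_trans (_ : (al + b / 2) * (b / 8) <= _).
    by apply: le_trans h1; rewrite le_eqVlt; apply/orP; left; apply/eqP; ring.
  nra.
have : `|c| <= (al + b) / 4.
  by rewrite -(@ler_pXn2r _ 2) ?nnegrE ?divr_ge0 ?addr_ge0 // real_normK ?num_real.
by rewrite ler_norml => /andP[]; lra.
Qed.

End CrossTermBound.

Lemma dotv_trmx_opnorm (R : realType) a b (M : 'M[R]_(a, b)) u :
  dotv (M^T *m u) (M^T *m u) <= opnorm M ^+ 2 * dotv u u.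
Proof. by apply: dotv_mulmx_tr; rewrite ?sqr_ge0 // trmxK => x; exact: dotv_mulmx_opnorm. Qed.

Section FilterEvents.
Context (R : realType) (dT : measure_display) (T : measurableType dT).
Variable Pr : probability T R.
Variables (n m : nat) (A : 'M[R]_n) (C : 'M[R]_(m, n)) (K : 'M[R]_(n, m)).
Variables (xh : nat -> T -> 'cV[R]_n) (y e : nat -> T -> 'cV[R]_m) (Rb : 'M[R]_m).
Hypothesis x0 : forall o, xh 0%N o = 0.
Hypothesis xS : forall s o, xh s.+1 o = A *m xh s o + K *m e s o.
Hypothesis yE : forall s o, y s o = C *m xh s o + e s o.
Hypothesis me : forall s i, measurable_fun setT (fun o => e s o i 0).
Hypothesis pRb : posdef Rb.
Hypothesis white : forall t H A c B, (t <= H)%N -> past e t A ->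
  (forall s, (s < t)%N -> c s = 0) -> varf Rb c H = 1 -> measurable B ->
  (Pr (A `&` linf e c H @^-1` B) = Pr A * gprob 1 B)%E.
Variables (p k : nat) (delta : R).
Hypotheses (p0 : (0 < p)%N) (pk : (p <= k)%N) (d0 : 0 < delta) (d1 : delta < 1).
Local Notation N := (k - p + 1)%N.
Local Notation Tp := (toepmx A C p K).
Local Notation Op := (obsmx A C p).

Lemma dotv_stack v j o :
  dotv v (stack p e (p + j)%N o) = \sum_(i < p) dotv (submxcol v i) (e (j + i)%N o).
Proof. by rewrite /stack dotv_mxcol; apply: eq_bigr => i _; rewrite addKn. Qed.

Definition noise_lower_bound o := forall u, N%:R / 2 * quadf (SigmaE A C p K Rb) u <=
  \sum_(j < N) dotv (Tp^T *m u) (stack p e (p + j)%N o) ^+ 2.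

Lemma noise_part_event : exists B : set T, [/\ measurable B, (Pr B <= delta%:E)%E &
  forall o, ~ B o -> k1 m p delta <= k%:R -> noise_lower_bound o].
Proof.
(* The threshold is deterministic: below it the claim is void and the empty exceptional event
   serves. *)
have [hk|hk] := leP (k1 m p delta) k%:R; last first.
  by exists set0; split; rewrite ?measure0 ?lee_fin ?(ltW d0).
have hN : 128 * (m%:R * p%:R ^+ 2 * ln 9 + p%:R * ln 2 + p%:R * ln delta^-1) <= N%:R.
  by rewrite natrD natrB //; move: hk; rewrite /k1; set t := 128 * _; lra.
have [B [mB pB hB]] := noise_gram_event me pRb white p0 d0 (ltW d1) hN.
exists B; split => // o /hB h _ u.
rewrite quadf_SigmaE; apply: le_trans (h _) _.
by rewrite le_eqVlt; apply/orP; left; apply/eqP; apply: eq_bigr => j _; rewrite dotv_stack.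
Qed.

(** The noise bound is a premise at the outcome [o], so its event is charged only once. All [p] lags
    share one [delta]; the other pays for the trace of the states. *)
Lemma cross_part_event sigmaR : 0 < sigmaR ->
  (forall u, sigmaR * dotv u u <= quadf (SigmaE A C p K Rb) u) ->
  exists B : set T, [/\ measurable B, (Pr B <= (delta + delta)%:E)%E & forall o, ~ B o ->
    k2 n m p sigmaR (opnorm Op) (opnorm (second_moment Pr (xh (k - p)%N))) delta <= k%:R ->
    noise_lower_bound o -> forall u,
    2^-1 * \sum_(j < N) dotv (Op^T *m u) (xh j o) ^+ 2 +
    2^-1 * \sum_(j < N) dotv (Tp^T *m u) (stack p e (p + j)%N o) ^+ 2 <=
    \sum_(j < N) dotv u (stack p y (p + j)%N o) ^+ 2].
Proof.
move=> s0 hsig.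
have N0 : (0 < N)%N by rewrite addn1.
have NR : 0 < N%:R :> R by rewrite ltr0n.
have pR : 0 < p%:R :> R by rewrite ltr0n.
have decomp u (j : nat) o : dotv u (stack p y (p + j)%N o) =
    dotv (Op^T *m u) (xh j o) + dotv (Tp^T *m u) (stack p e (p + j)%N o).
  by rewrite (stack_decomposition xS yE) dotvDr addKn; congr (_ + _); rewrite dotvC dotv_mulmxl dotvC.
have lx := lagvec_xhat x0 xS.
have hmx j : mvec (past e j) (xh j) by exact: lagvec_mvec lx _.
(* In this case [tau] below would divide by 0; the states then do not reach the output window and
   the inequality is immediate. *)
have [Oz|Oz] := eqVneq (opnorm Op) 0.
  exists set0; split; rewrite ?measure0 ?lee_fin ?addr_ge0 ?(ltW d0) // => o _ _ _ u.
  have := dotv_trmx_opnorm Op u; rewrite Oz expr0n mul0r => w0.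
  have {}w0 : Op^T *m u = 0 by apply/eqP; rewrite -dotv_eq0 eq_le w0 dotv_ge0.
  under [leRHS]eq_bigr do rewrite decomp w0 dotv0l add0r.
  rewrite w0 big1 ?mulr0 ?add0r => [|j _]; last by rewrite dotv0l expr0n.
  set S := \sum_(j < _) _; have : 0 <= S by apply: sumr_ge0 => j _; exact: sqr_ge0.
  lra.
have O1 : 0 < opnorm Op by rewrite lt_def Oz opnorm_ge0.
(* With this choice [tau] times the squared length of [Op^T *m u] is at most [N / 4] times
   [quadf SigmaE], thus half of the noise energy. In the quotient of the trace bound by [tau] the
   factor [N] cancels, leaving the argument of the logarithm in [k2]. *)
pose tau := sigmaR / 4 * N%:R / opnorm Op ^+ 2.
have t0 : 0 < tau by rewrite !divr_gt0 ?mulr_gt0 ?exprn_gt0 ?divr_gt0.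
have ncross (i : 'I_p) : i \in enum 'I_p -> exists B : set T,
    [/\ measurable B, (Pr B <= (delta / p%:R)%:E)%E & forall o, ~ B o -> forall u,
      dotv (crossM e i xh N o *m u) (invmx (gramV tau xh N o) *m (crossM e i xh N o *m u)) <=
      16 / 9 * (2 * ln (27 ^+ m / (delta / p%:R)) + ln (\det (gramV tau xh N o) / tau ^+ n)) * quadf Rb u].
  have mz (j : nat) : mvec (past e (j + i)%N) (xh j).
    apply: mvecS (hmx j) => B pB; apply: sub_sigma_algebra.
    by move: B pB; apply: sub_past; exact: leq_addr.
  have dp0 : 0 < delta / p%:R by rewrite divr_gt0.
  have dp1 : delta / p%:R <= 1.
    by rewrite ler_pdivrMr // mul1r; apply: le_trans (ltW d1) _; rewrite ler1n.
  by move=> _; exact: (cross_event me pRb white t0 mz N dp0 dp1).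
have := union_event ncross.
have -> : (size (enum 'I_p))%:R * (delta / p%:R) = delta.
  by rewrite size_enum_ord mulrCA mulfV ?mulr1 // gt_eqF.
have hN (j : nat) : (j < N)%N -> (0 + j <= k - p)%N by rewrite add0n addn1 ltnS.
move=> /conj_event/(_ (trace_event me pRb white lx hN d0)) [B [mB pB hB]].
exists B; split => // o /hB[h1 h2] hk2 hnoise u.
set W := 16 / 9 * (2 * ln (27 ^+ m / (delta / p%:R)) + ln (\det (gramV tau xh N o) / tau ^+ n)).
have lD0 : 0 <= ln (\det (gramV tau xh N o) / tau ^+ n).
  by rewrite ln_ge0 // ler_pdivlMr ?exprn_gt0 // mul1r; exact: det_gramV_ge.
have eqd : 27 ^+ m / (delta / p%:R) = 27 ^+ m * p%:R / delta by rewrite invf_div mulrA.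
have p1 : 1 <= p%:R :> R by rewrite ler1n.
have W0 : 0 <= W.
  rewrite mulr_ge0 ?addr_ge0 // mulr_ge0 // ln_ge0 // eqd ler_pdivlMr // mul1r.
  apply: le_trans (ltW d1) _; rewrite mulr_ege1 // exprn_ege1 //; lra.
have WN : 16 * p%:R * W <= N%:R.
  apply: le_trans (k2_bound p0 pk s0 (opnorm_ge0 _) (opnorm_ge0 _) d0 d1 hk2).
  rewrite ler_wpM2l ?mulr_ge0 ?(ltW pR) // /W eqd ler_wpM2l // lerD2l.
  apply: le_trans (ln_det_le_trace _ t0) _; rewrite ler_wpM2l ?ler0n //.
  have tr0 : 0 <= \sum_(j < N) dotv (xh j o) (xh j o) by apply: sumr_ge0 => j _; exact: dotv_ge0.
  have g0 := opnorm_ge0 (second_moment Pr (xh (k - p)%N)).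
  rewrite ler_ln ?posrE; first last.
  - by rewrite ltr_wpDr // divr_ge0 ?divr_ge0 ?mulr_ge0 ?ler0n ?sqr_ge0 // ltW.
  - by rewrite ltr_wpDr // divr_ge0 // ltW.
  rewrite lerD2l ler_pdivrMr //; apply: le_trans h2 _.
  rewrite le_eqVlt; apply/orP; left; apply/eqP; rewrite /tau; field.
  by rewrite Oz !gt_eqF.
pose f (i : 'I_p) (j : 'I_N) := dotv (submxcol (Tp^T *m u) i) (e (j + i)%N o).
have := @cross_term_le _ n p N tau W (fun j => xh j o) (Op^T *m u) f
  (fun i => quadf Rb (submxcol (Tp^T *m u) i)) N0 t0 W0 WN.
have bE : \sum_(j < N) (\sum_i f i j) ^+ 2 = \sum_(j < N) dotv (Tp^T *m u) (stack p e (p + j)%N o) ^+ 2.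
  by apply: eq_bigr => j _; rewrite dotv_stack.
rewrite bE => H.
have -> : \sum_(j < N) dotv u (stack p y (p + j)%N o) ^+ 2 =
   \sum_(j < N) (dotv (Op^T *m u) (xh j o) + \sum_i f i j) ^+ 2.
  by apply: eq_bigr => j _; rewrite decomp dotv_stack.
have hn := hnoise u.
apply: H.
- move=> i; rewrite -crossM_dir; exact: h1 i (mem_enum _ i) _.
- by rewrite -quadf_SigmaE.
have hO : opnorm Op ^+ 2 != 0 by rewrite expf_neq0.
have := ler_wpM2l (ltW t0) (dotv_trmx_opnorm Op u); have := ler_wpM2l (ltW NR) (hsig u).
have -> : tau * (opnorm Op ^+ 2 * dotv u u) = N%:R * (sigmaR * dotv u u) / 4.
  by rewrite /tau; field.
lra.
Qed.

End FilterEvents.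

Section InnovationsWhite.
Context (R : realType) (dT : measure_display) (T : measurableType dT).
Variable Pr : probability T R.
Variables (n m : nat) (A : 'M[R]_n) (C : 'M[R]_(m, n)).
Variables (Q : 'M[R]_n) (Rv : 'M[R]_m) (P : 'M[R]_n).
Variables (x0 : T -> 'cV[R]_n) (w : nat -> T -> 'cV[R]_n) (v : nat -> T -> 'cV[R]_m).
Hypothesis hx0 : gaussian_vec Pr x0 P.
Hypothesis hw : forall k, gaussian_vec Pr (w k) Q.
Hypothesis hv : forall k, gaussian_vec Pr (v k) Rv.
Hypothesis hind : mutually_independent Pr
  (fun i : option (nat + nat) => match i with
    | None => vec_events x0
    | Some (inl k) => vec_events (w k)
    | Some (inr k) => vec_events (v k) end).
Hypotheses (hR : posdef Rv) (hP : posdef P).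
Hypothesis hRic : P = (A - kgain A C P Rv *m C) *m P *m (A - kgain A C P Rv *m C)^T + Q +
  kgain A C P Rv *m Rv *m (kgain A C P Rv)^T.
Hypothesis m0 : (0 < m)%N.
Local Notation e := (innov A C (kgain A C P Rv) (output A C x0 w v)).
Local Notation Rb := (C *m P *m C^T + Rv).

(* A standard normal variable on [T] itself, read off the observation noise. *)
Lemma standard_normal_direction : exists u : 'cV[R]_m, quadf Rv u = 1.
Proof.
pose u : 'cV[R]_m := delta_mx (Ordinal m0) 0.
have u0 : u != 0 by rewrite -dotv_eq0 dotv_delta mxE !eqxx oner_eq0.
have q0 : 0 < quadf Rv u by case: hR => _; exact.
have s0 : 0 < Num.sqrt (quadf Rv u) by rewrite sqrtr_gt0.
exists ((Num.sqrt (quadf Rv u))^-1 *: u).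
by rewrite quadfZv exprVn sqr_sqrtr ?ltW // mulVf // gt_eqF.
Qed.

Lemma innovations_white t H B0 c B : (t <= H)%N -> past e t B0 ->
  (forall s, (s < t)%N -> c s = 0) -> varf Rb c H = 1 -> measurable B ->
  (Pr (B0 `&` linf e c H @^-1` B) = Pr B0 * gprob 1 B)%E.
Proof.
have [u u1] := standard_normal_direction.
have mX : measurable_fun setT (fun o => dotv u (v 0%N o)).
  apply: measurable_dotv; first exact: mmx_cst.
  by move=> i j; rewrite (ord1 j); case: (hv 0%N) => + _; exact.
apply: (past_independence (measurable_innov A C hx0 hw hv) _ _ mX).
- by move=> x; case: (posdef_psd (innov_cov_posdef C hR hP)) => _; exact.
- by move=> K c'; exact: (cfun_innov hx0 hw hv hind hR hP hRic).
- move=> th; apply: law_cfun; [exact: measurable_funM | exact: sqr_ge0 | ] => D mD.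
  have -> : (fun o => th * dotv u (v 0%N o)) = (fun o => dotv (th *: u) (v 0%N o)).
    by apply/funext => o; rewrite dotvZl.
  by rewrite (gaussian_law_dotv _ (hv 0%N) mD) quadfZv u1 mulr1.
- by move=> D mD; rewrite (gaussian_law_dotv _ (hv 0%N) mD) u1.
Qed.

End InnovationsWhite.

Lemma sum_nat_shift (V : nmodType) (F : nat -> V) p k : (p <= k)%N ->
  \sum_(p <= t < k.+1) F t = \sum_(j < k - p + 1) F (p + j)%N.
Proof.
move=> pk; rewrite -{1}[p]add0n big_addn big_mkord subSn // -addn1.
by apply: eq_bigr => j _; rewrite addnC.
Qed.

Section SelfNormalizedEvent.
Context (R : realType) (dT : measure_display) (T : measurableType dT).
Variable Pr : probability T R.
Variables (m p k : nat) (Z : nat -> T -> 'cV[R]_(\sum_(i < p) m)) (e : nat -> T -> 'cV[R]_m).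
Variables (Rb : 'M[R]_m) (lam delta : R).
Hypothesis me : forall s i, measurable_fun setT (fun o => e s o i 0).
Hypothesis pRb : posdef Rb.
Hypothesis white : forall t H A c B, (t <= H)%N -> past e t A ->
  (forall s, (s < t)%N -> c s = 0) -> varf Rb c H = 1 -> measurable B ->
  (Pr (A `&` linf e c H @^-1` B) = Pr A * gprob 1 B)%E.
Hypotheses (m0 : (0 < m)%N) (p2 : (2 <= p)%N) (pk : (p <= k)%N).
Hypotheses (lam0 : 0 < lam) (d0 : 0 < delta) (d1 : delta < 1).
Hypothesis hZ : lagvec e p Z.
Local Notation N := (k - p + 1)%N.
Local Notation Gamma := (second_moment Pr (Z k)).

Lemma barmx_gram o : barmx Z k o *m (barmx Z k o)^T = \sum_(j < N) Z (p + j)%N o *m (Z (p + j)%N o)^T.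
Proof. exact: (gram_columns (fun j : 'I_N => Z (p + j)%N o)). Qed.

Lemma Smx_tr o : (Smx e Z k o)^T = crossM e p (fun j => Z (p + j)%N) N o.
Proof.
rewrite /Smx /crossM raddf_sum /= sum_nat_shift //.
by apply: eq_bigr => j _; rewrite trmx_mul trmxK addnC.
Qed.

(** The determinant is bounded on the event of (b), which enters as a premise, so only the net of
    directions costs probability. The lag is [p]: the window [Z (p + j)] is measured by innovations
    before [p + j] and is paired with the innovation at [p + j]. *)
Lemma self_normalized_event : posdef Gamma ->
  exists B : set T, [/\ measurable B, (Pr B <= delta%:E)%E & forall o, ~ B o ->
    (forall u, \sum_(j < N) dotv u (Z (p + j)%N o) ^+ 2 <=
       N%:R * ((m * p)%:R / delta) * quadf Gamma u) ->
    opnorm (Smx e Z k o *m minvsqrt (lam%:M + barmx Z k o *m (barmx Z k o)^T))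
     <= g1 m p k (opnorm Rb) delta (ln (\det (lam^-1 *: Gamma + 1%:M)))].
Proof.
move=> pG.
have mz (j : nat) : mvec (past e (j + p)%N) (Z (p + j)%N).
  by rewrite addnC; apply: lagvec_mvec hZ _; exact: leq_addr.
have [B [mB pB hB]] := cross_event me pRb white lam0 mz N d0 (ltW d1).
exists B; split => // o /hB h hG.
have pV := @gramV_posdef _ _ _ _ lam (fun j => Z (p + j)%N) lam0 N o.
have VE : lam%:M + barmx Z k o *m (barmx Z k o)^T = gramV lam (fun j => Z (p + j)%N) N o.
  by rewrite barmx_gram.
have N0 : (0 < N)%N by rewrite addn1.
have dE : (\sum_(i < p) m = m * p)%N by rewrite sum_nat_const card_ord mulnC.
have D1 := det_shift_ge1 lam0 pG.
pose V := \det (gramV lam (fun j => Z (p + j)%N) N o) / lam ^+ (\sum_(i < p) m)%N.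
have V1 : 1 <= V by rewrite ler_pdivlMr ?exprn_gt0 // mul1r; exact: det_gramV_ge.
have hV : V <= (N%:R * ((m * p)%:R / delta)) ^+ (m * p) * \det (lam^-1 *: Gamma + 1%:M).
  rewrite -{2}dE; apply: det_gram_le => //.
  have : 1 <= N%:R :> R by rewrite ler1n.
  have : 1 <= (m * p)%:R / delta.
    rewrite ler_pdivlMr // mul1r; apply: le_trans (ltW d1) _.
    by rewrite ler1n muln_gt0 m0 (leq_trans _ p2).
  by move=> h1 h2; exact: mulr_ege1.
have := g1_bound m0 p2 N0 d0 d1 (opnorm_ge0 Rb) D1 (lt_le_trans ltr01 V1) hV.
rewrite -/(g1 _ _ _ _ _ _); apply: le_trans; rewrite VE.
have W0 : 0 <= 16 / 9 * (2 * ln (27 ^+ m / delta) + ln V).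
  rewrite mulr_ge0 // addr_ge0 ?(ln_ge0 V1) // mulr_ge0 // ln_ge0 // ler_pdivlMr // mul1r.
  apply: le_trans (ltW d1) _; apply: exprn_ege1; lra.
apply: opnorm_minvsqrt => //; first by rewrite mulr_ge0 // opnorm_ge0.
move=> u; rewrite Smx_tr; apply: le_trans (h u) _.
by rewrite -[leRHS]mulrA ler_wpM2l //; exact: quadf_opnorm.
Qed.

End SelfNormalizedEvent.

(** * Simultaneous bounds *)

Lemma event_complement (R : realType) d (T : measurableType d) (P : probability T R)
    (Q : T -> Prop) (a : R) :
  (exists B : set T, [/\ measurable B, (P B <= a%:E)%E & forall o, ~ B o -> Q o]) ->
  exists G : set T, measurable G /\ ((1 - a)%:E <= P G)%E /\ forall o, G o -> Q o.
Proof.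
move=> [B [mB pB hB]]; exists (~` B); split; first exact: measurableC.
split; last exact: hB.
by rewrite probability_setC // EFinB leeB.
Qed.

Lemma loewner_le_dim0 (R : realType) d (M N : 'M[R]_d) : d = 0%N -> loewner_le M N.
Proof.
move=> h x; have -> : x = 0 by apply/matrixP => i; have := ltn_ord i; rewrite {2}h.
by rewrite !quadf0.
Qed.

Lemma second_moment_sym (R : realType) (dT : measure_display) (T : measurableType dT)
  (Pr : probability T R) d (X : T -> 'cV[R]_d) : symmx (second_moment Pr X).
Proof.
apply/matrixP => i j; rewrite !mxE; congr (fine _).
by congr expectation; apply/funext => o; rewrite !mxE; apply: eq_bigr => l _; rewrite !mxE mulrC.
Qed.

Lemma g1_ge0 (R : realType) m p k (r delta D : R) : 0 <= g1 m p k r delta D.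
Proof. by rewrite /g1 !mulr_ge0 ?sqrtr_ge0. Qed.

Section FilterConcentration.
Context (R : realType) (dT : measure_display) (T : measurableType dT).
Variable Pr : probability T R.
Variables (n m : nat) (A : 'M[R]_n) (C : 'M[R]_(m, n)) (K : 'M[R]_(n, m)).
Variables (xh : nat -> T -> 'cV[R]_n) (y e : nat -> T -> 'cV[R]_m) (Rb : 'M[R]_m).
Hypothesis x0 : forall o, xh 0%N o = 0.
Hypothesis xS : forall s o, xh s.+1 o = A *m xh s o + K *m e s o.
Hypothesis yE : forall s o, y s o = C *m xh s o + e s o.
Hypothesis me : forall s i, measurable_fun setT (fun o => e s o i 0).
Hypothesis pRb : posdef Rb.
Hypothesis white : forall t H A c B, (t <= H)%N -> past e t A ->
  (forall s, (s < t)%N -> c s = 0) -> varf Rb c H = 1 -> measurable B ->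
  (Pr (A `&` linf e c H @^-1` B) = Pr A * gprob 1 B)%E.
Variables (p k : nat) (lam delta sigmaR : R).
Hypotheses (m0 : (0 < m)%N) (p2 : (2 <= p)%N) (pk : (p <= k)%N).
Hypotheses (lam0 : 0 < lam) (d0 : 0 < delta) (d1 : delta < 1) (s0 : 0 < sigmaR).
Hypothesis hsig : forall u, sigmaR * dotv u u <= quadf (SigmaE A C p K Rb) u.
Local Notation N := (k - p + 1)%N.
Local Notation Tp := (toepmx A C p K).
Local Notation Op := (obsmx A C p).
Local Notation Z := (stack p y).
Local Notation E := (stack p e).
Local Notation GammaZ := (second_moment Pr (Z k)).

Lemma posdef_stack_moment : posdef GammaZ.
Proof.
split; first exact: second_moment_sym.
move=> u u0; apply: lt_le_trans (second_moment_stack_ge x0 xS yE me pRb white u pk).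
by rewrite mulr_gt0 ?gauss_m2_gt0 //; apply: lt_le_trans (hsig u); rewrite mulr_gt0 ?dotv_gt0.
Qed.

Lemma quadf_congr_gram a b c (M : 'M[R]_(a, b)) (B : 'M[R]_(b, c)) u :
  quadf (M *m B *m B^T *m M^T) u = quadf (B *m B^T) (M^T *m u).
Proof. by rewrite -quadf_congr !mulmxA. Qed.

Lemma filter_concentration :
  exists G : set T, measurable G /\ ((1 - 5 * delta)%:E <= Pr G)%E /\ forall o, G o ->
   ((Num.max (k1 m p delta)
       (k2 n m p sigmaR (opnorm Op) (opnorm (second_moment Pr (xh (k - p)%N))) delta) <= k%:R) ->
      loewner_le ((N%:R / 2) *: SigmaE A C p K Rb) (Tp *m barmx E k o *m (barmx E k o)^T *m Tp^T) /\
      loewner_le ((N%:R / 2 * sigmaR) *: 1%:M) ((N%:R / 2) *: SigmaE A C p K Rb) /\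
      loewner_le (2^-1 *: (Op *m barX p xh k o *m (barX p xh k o)^T *m Op^T)
                  + 2^-1 *: (Tp *m barmx E k o *m (barmx E k o)^T *m Tp^T))
                 (barmx Z k o *m (barmx Z k o)^T)) /\
   loewner_le (barmx Z k o *m (barmx Z k o)^T) ((N%:R * ((m * p)%N%:R / delta)) *: GammaZ) /\
   opnorm (Smx e Z k o *m minvsqrt (lam%:M + barmx Z k o *m (barmx Z k o)^T))
     <= g1 m p k (opnorm Rb) delta (ln (\det (lam^-1 *: GammaZ + 1%:M))).
Proof.
have p0 : (0 < p)%N by exact: leq_trans p2.
have lZ := @lagvec_stack _ _ _ _ _ _ _ _ _ _ _ x0 xS yE p.
have pG := posdef_stack_moment.
have hN (j : nat) : (j < N)%N -> (p + j <= k)%N by rewrite addn1 ltnS => h; rewrite -leq_subRL.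
have ev1 := noise_part_event A C K me pRb white p0 pk d0 d1.
have ev2 := cross_part_event x0 xS yE me pRb white p0 pk d0 d1 s0 hsig.
have ev3 := gram_event me pRb white lZ hN d0 pG.
have ev4 := self_normalized_event me pRb white m0 p2 pk lam0 d0 d1 lZ pG.
(* The five shares of [delta]: one for the noise Gram matrix, two for the cross terms, one for (b)
   and one for (c). *)
have := event_complement (conj_event (conj_event ev1 ev2) (conj_event ev3 ev4)).
have -> : delta + (delta + delta) + (delta + delta) = 5 * delta by ring.
move=> [G [mG [pG' hG]]]; exists G; split => //; split => // o /hG [[h1 h2] [h3 h4]].
have dE : (\sum_(i < p) m = m * p)%N by rewrite sum_nat_const card_ord mulnC.
have qE u : quadf (Tp *m barmx E k o *m (barmx E k o)^T *m Tp^T) u =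
    \sum_(j < N) dotv (Tp^T *m u) (E (p + j)%N o) ^+ 2.
  by rewrite quadf_congr_gram barmx_gram quadf_gram.
have qX u : quadf (Op *m barX p xh k o *m (barX p xh k o)^T *m Op^T) u =
    \sum_(j < N) dotv (Op^T *m u) (xh j o) ^+ 2.
  rewrite quadf_congr_gram -(quadf_gram (fun j : 'I_N => xh j o)).
  by congr quadf; exact: (gram_columns (fun j : 'I_N => xh j o)).
have qZ u : quadf (barmx Z k o *m (barmx Z k o)^T) u = \sum_(j < N) dotv u (Z (p + j)%N o) ^+ 2.
  by rewrite barmx_gram quadf_gram.
split; last split.
- rewrite ge_max => /andP[/h1 nb /h2 cr]; split; last split => u.
  + by move=> u; rewrite quadfZ qE; exact: nb.
  + by rewrite !quadfZ quadf1 -[leLHS]mulrA ler_wpM2l // divr_ge0 ?ler0n.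
  + by rewrite quadfD !quadfZ qE qX qZ; exact: cr.
- by move=> u; rewrite qZ quadfZ -dE; exact: h3.
- by apply: h4 => u; rewrite -dE; exact: h3.
Qed.

End FilterConcentration.

Theorem mainTheorem13
  (R : realType) (dT : measure_display) (T : measurableType dT)
  (Pr : probability T R)
  (n m : nat) (A : 'M[R]_n) (C : 'M[R]_(m, n))
  (Q : 'M[R]_n) (Rv : 'M[R]_m) (P : 'M[R]_n)
  (x0 : T -> 'cV[R]_n) (w : nat -> T -> 'cV[R]_n) (v : nat -> T -> 'cV[R]_m)
  (* noise model *)
  (hQ : symmx Q) (hRsym : symmx Rv)
  (hx0 : gaussian_vec Pr x0 P)
  (hw : forall k, gaussian_vec Pr (w k) Q)
  (hv : forall k, gaussian_vec Pr (v k) Rv)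
  (hind : mutually_independent Pr
     (fun i : option (nat + nat) => match i with
       | None => vec_events x0
       | Some (inl k) => vec_events (w k)
       | Some (inr k) => vec_events (v k) end))
  (* standing assumptions *)
  (hrho : spec_rad_le1 A)
  (hobs : observable A C)
  (hctrQ : controllable A (msqrt Q))
  (hR : posdef Rv)
  (hP : posdef P)
  (hRic : P = (A - kgain A C P Rv *m C) *m P *m (A - kgain A C P Rv *m C)^T
              + Q + kgain A C P Rv *m Rv *m (kgain A C P Rv)^T)
  (hctrK : controllable A (kgain A C P Rv))
  (* parameters *)
  (p k : nat) (lam delta : R)
  (hp : (2 <= p)%N) (hk : (p <= k)%N) (hlam : 0 < lam)
  (hdelta0 : 0 < delta) (hdelta1 : delta < 1) :
  let K := kgain A C P Rv in
  let y := output A C x0 w v in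
  let xh := xhat A C K y in
  let e := innov A C K y in
  let Rbar := C *m P *m C^T + Rv in
  let sigmaR := sigma_min Rv in
  let Z := stack p y in
  let E := stack p e in
  let Tp := toepmx A C p K in
  let Op := obsmx A C p in
  let SigE := SigmaE A C p K Rbar in
  let GammaZ := second_moment Pr (Z k) in
  let Gamma := second_moment Pr (xh (k - p)%N) in
  let N := (k - p + 1)%N in
  (exists G : set T, measurable G /\ ((1 - 5 * delta)%:E <= Pr G)%E /\
   forall o, G o ->
   (* (a) *)
   ((Num.max (k1 m p delta) (k2 n m p sigmaR (opnorm Op) (opnorm Gamma) delta)
       <= k%:R) ->
      loewner_le ((N%:R / 2) *: SigE)
                 (Tp *m barmx E k o *m (barmx E k o)^T *m Tp^T) /\
      loewner_le ((N%:R / 2 * sigmaR) *: 1%:M) ((N%:R / 2) *: SigE) /\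
      loewner_le (2^-1 *: (Op *m barX p xh k o *m (barX p xh k o)^T *m Op^T)
                  + 2^-1 *: (Tp *m barmx E k o *m (barmx E k o)^T *m Tp^T))
                 (barmx Z k o *m (barmx Z k o)^T)) /\
   (* (b) *)
   loewner_le (barmx Z k o *m (barmx Z k o)^T)
              ((N%:R * ((m * p)%N%:R / delta)) *: GammaZ) /\
   (* (c) *)
   opnorm (Smx e Z k o *m minvsqrt (lam%:M + barmx Z k o *m (barmx Z k o)^T))
     <= g1 m p k (opnorm Rbar) delta
          (ln (\det (lam^-1 *: GammaZ + 1%:M)))).
Proof.
move=> K y xh e Rbar sigmaR Z E Tp Op SigE GammaZ Gamma N.
(* Without outputs there is no standard normal direction and [sigma_min] is an infimum over the
   empty set; but all forms then live in dimension 0, and the whole space is the required event. *)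
have [m0|m0] := posnP m.
  exists setT; split => //; split.
    by rewrite probability_setT lee_fin lerBlDl lerDr mulr_ge0 // ltW.
  have D0 : (\sum_(i < p) m = 0)%N by rewrite m0 big1.
  move=> o _; split; last split.
  - by split; [|split]; apply: loewner_le_dim0.
  - exact: loewner_le_dim0.
  apply: opnorm_le => [|x _]; first exact: g1_ge0.
  set z := _ *m x; have -> : z = 0 by apply/matrixP => i; have := ltn_ord i; rewrite {2}m0.
  by rewrite dotv0l sqr_ge0.
apply: (@filter_concentration _ _ _ _ n m A C K xh y e Rbar) => //.
- by move=> s o; rewrite /e /innov addrC subrK.
- exact: (measurable_innov A C hx0 hw hv).
- exact: (innov_cov_posdef C hR hP).
- move=> t H A0 c B; exact: (innovations_white hx0 hw hv hind hR hP hRic m0).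
- exact: (sigma_min_gt0 m0 (posdef_unit hR)).
- move=> u; exact: (SigmaE_ge_sigma_min hR hP (gaussian_psd (hw 0%N)) hRic).
Qed.
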